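(* Let $\$(k)=O(k^s)$ for some $s\ge0$. Let $\gamma=(\gamma_u)_{u\in\mathcal U}$ be POD weights, $\gamma_u=\Gamma_{|u|}\prod_{j\in u}\gamma_j$, such that $p^*:=\mathrm{decay}_{\gamma,1}>1$ and such that there exist $q<p^*$ and $C_q>0$ with $\Gamma_k\le C_q(k!)^q$ for all $k\in\mathbb N$. Let $v_k=[L_k]$ with $L_k=L\lceil a^{k-1}\rceil$ for $k\in\mathbb N$, where $L\in\mathbb N$ and $a\in(1,\infty)$ are fixed, and $v_0=\emptyset$. Assume that there exists an $\alpha\ge1/2$ such that for all $k\in\mathbb N$ and all $n_k\in\mathbb N$ there are quadratures $$Q_{v_k}(f)=\sum_{j=1}^{n_k}a^{(k)}_jf(t^{(j,k)}_{v_k};c),\qquad a^{(k)}_j\in\mathbb R,\ t^{(j,k)}_{v_k}\in D^{v_k},$$ which satisfy, for $\tau=1/2$ if $\alpha=1/2$, and for values $\tau\in[1/2,\min\{\alpha,\mathrm{decay}_\gamma/2\})$ arbitrarily close to $\min\{\alpha,\mathrm{decay}_\gamma/2\}$ if $\alpha>1/2$, the bound $$\sum_{\ell\in u\subseteq[\ell]}\gamma_u\left[e\big((Q_{v_k})_u;H_u\big)\right]^2\le\left(\sum_{\ell\in u\subseteq[\ell]}\gamma_u^{1/(2\tau)}C_\tau^{|u|}\right)^{2\tau}n_k^{-2\tau}\qquad\text{for all }\ell\in v_k\setminus v_{k-1},$$ with constants $C_\tau$ independent of $k$ (and of $n_k,\ell$). Then the multilevel algorithms $Q^{\mathrm{ML}}_m$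 built from these quadratures establish the following upper bounds. If $s\ge(2\alpha-1)/(2\alpha)$, then $$p^{\mathrm{nest}}\le\max\left\{\frac1\alpha,\frac{2s}{\mathrm{decay}_{\gamma,1}-1}\right\}.$$ If $0\le s<(2\alpha-1)/(2\alpha)$, then (i) $p^{\mathrm{nest}}\le\frac1\alpha$ if $\mathrm{decay}_{\gamma,1}\ge2\alpha$; (ii) $p^{\mathrm{nest}}\le\frac{2}{\mathrm{decay}_{\gamma,1}}$ if $2\alpha>\mathrm{decay}_{\gamma,1}>1/(1-s)$; (iii) $p^{\mathrm{nest}}\le\frac{2s}{\mathrm{decay}_{\gamma,1}-1}$ if $1/(1-s)\ge\mathrm{decay}_{\gamma,1}>1$.
   Context: Setting. $\mathbb N=\{1,2,\dots\}$, $\mathbb N_0=\mathbb N\cup\{0\}$, $[n]=\{1,\dots,n\}$; $\mathcal U$ is the set of all finite subsets of $\mathbb N$. $D\subseteq\mathbb R$ is a Borel set, $K:D\times D\to\mathbb R$ is a measurable, not identically zero reproducing kernel (symmetric, positive semidefinite) with anchor $c\in D$, i.e. $K(c,c)=0$; $H=H(K)$ is its reproducing kernel Hilbert space (RKHS). $\rho$ is a probability measure on $D$ with $M:=\int_DK(x,x)\,\rho(dx)<\infty$ and $C_0:=\int_D\int_DK(x,y)\,\rho(dx)\rho(dy)>0$. For $u\in\mathcal U$ put $K_u(x,y)=\prod_{j\in u}K(x_j,y_j)$ for $x,y\in D^{\mathbb N}$ ($K_\emptyset\equiv1$), $H_u=H(K_u)$; functions in $H_u$ depend only on the coordinates in $u$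 and are identified with functions on $D^u$. Weights are families $\gamma=(\gamma_u)_{u\in\mathcal U}$ of non-negative reals with $\sum_u\gamma_uM^{|u|}<\infty$; the set $\mathcal A=\{u\in\mathcal U:\gamma_u>0\}$ is assumed to contain a non-empty set. Let $\mathfrak X=\{x\in D^{\mathbb N}:\sum_{u\in\mathcal A}\gamma_u\prod_{j\in u}K(x_j,x_j)<\infty\}$ and let $\mathcal H_\gamma$ be the RKHS on $\mathfrak X$ with kernel $\sum_{u\in\mathcal A}\gamma_uK_u$. Every $f\in\mathcal H_\gamma$ has a unique representation $f=\sum_{u\in\mathcal A}f_u$, $f_u\in H_u$, and $\|f\|_\gamma^2=\sum_{u\in\mathcal A}\gamma_u^{-1}\|f_u\|_{H_u}^2$. $\mu$ is the infinite product of $\rho$ on $D^{\mathbb N}$ (it satisfies $\mu(\mathfrak X)=1$) and $I(f)=\int_{\mathfrak X}f\,d\mu$. Algorithms and errors. For $u\in\mathcal U$, $x\in D^u$, $(x;c)$ is the point of $D^{\mathbb N}$ whose $j$th coordinate is $x_j$ for $j\in u$ and $c$ otherwise. Admissible algorithms: $Q(f)=\sum_{i=1}^na_if(t_{v_i};c)$ with $n\in\mathbb N_0$, $a_i\in\mathbb R$, $v_i\in\mathcal U$, $t_{v_i}\in(D\setminus\{c\})^{v_i}$ (coordinates equal to $c$ are dropped from $v_i$). $e(Q;\mathcal H_\gamma)=\sup_{\|f\|_\gamma\le1}|I(f)-Q(f)|$. For $u\in\mathcal U$ and $g\in H_u$: $I_u(g)=\int_{D^u}g\,d\rho^u$, $(Q)_u(g)=\sum_ia_ig(t_{v_i};c)$,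 and $e((Q)_u;H_u)=\sup_{\|g\|_{H_u}\le1}|I_u(g)-(Q)_u(g)|$. Cost (nested subspace sampling). $\$:\mathbb N_0\to[1,\infty)$ is a non-decreasing cost function. For a strictly increasing sequence $w=(w_i)_{i\in\mathbb N}$ of sets in $\mathcal U$ put $\mathfrak c_w(x)=\inf\{\$(|w_i|):x_j=c\ \forall j\notin w_i\}$ ($\inf\emptyset=\infty$); $\mathrm{cost}_{\mathrm{nest}}(Q)=\inf_w\sum_{i=1}^n\mathfrak c_w(t_{v_i};c)$, infimum over all such $w$. Tractability. $\mathrm{comp}_{\mathrm{nest}}(\varepsilon)=\inf\{\mathrm{cost}_{\mathrm{nest}}(Q): Q\text{ admissible},\ e(Q;\mathcal H_\gamma)\le\varepsilon\}$; $p^{\mathrm{nest}}$ is the infimum of all $p\ge0$ for which there is $C\ge0$ with $\mathrm{comp}_{\mathrm{nest}}(\varepsilon)\le C\varepsilon^{-p}$ for all $\varepsilon>0$. POD weights. Product and order-dependent (POD) weights are weights $\gamma_u=\Gamma_{|u|}\prod_{j\in u}\gamma_j$ with reals $\gamma_1\ge\gamma_2\ge\cdots\ge0$, $\Gamma_0=\Gamma_1=1$, $\Gamma_2,\Gamma_3,\ldots\ge0$. Decay. $\widehat\gamma_u=\gamma_uC_0^{|u|}$. For $\sigma\in\mathbb N\cup\{\infty\}$ let $u_1(\sigma),u_2(\sigma),\dots$ be the distinct non-empty $u$ with $\gamma_u>0$ and $|u|\le\sigma$, ordered so that $\widehat\gamma_{u_1(\sigma)}\ge\widehat\gamma_{u_2(\sigma)}\ge\cdots$.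 $\mathrm{decay}_{\gamma,\sigma}=\sup\{p\in\mathbb R:\lim_{j\to\infty}\widehat\gamma_{u_j(\sigma)}j^p=0\}$ (equal to $\infty$ if there are only finitely many $u_j(\sigma)$); $\mathrm{decay}_\gamma=\mathrm{decay}_{\gamma,\infty}$. Multilevel algorithms. For $u\in\mathcal U$ let $(\Psi_uf)(x)=f(x_u;c)$ where $x_u=(x_j)_{j\in u}$. For $m\in\mathbb N$ and integers $n_1\ge n_2\ge\cdots\ge n_m$ put $Q^{\mathrm{ML}}_m(f)=f(c,c,\dots)+\sum_{k=1}^mQ_{v_k}(f-\Psi_{v_{k-1}}f)$. That these algorithms ''establish'' a bound $p^{\mathrm{nest}}\le B$ means: for every $p>B$ there is $C$ such that for every $\varepsilon\in(0,1]$ some $Q^{\mathrm{ML}}_m$ (for suitable $m,n_1,\dots,n_m$) has $e(Q^{\mathrm{ML}}_m;\mathcal H_\gamma)\le\varepsilon$ and $\mathrm{cost}_{\mathrm{nest}}(Q^{\mathrm{ML}}_m)\le C\varepsilon^{-p}$. *)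

(* Defs.v *)
(* Coordinates are numbered from 0: the coordinate written
   j in {1, 2, ...} on paper is j.-1 here, [n] is {0, ..., n-1}, and the
   condition l \in u \subset [l] becomes l \in u \subset {0, ..., l}.
   Points of D^N are functions x : nat -> R with all values in D. *)
From mathcomp Require Import all_boot all_order all_algebra.
From mathcomp Require Import finmap.
From mathcomp Require Import all_classical all_reals all_analysis.
Set Implicit Arguments.
Unset Strict Implicit.
Unset Printing Implicit Defensive.
Import Order.TTheory GRing.Theory Num.Theory.
Import numFieldNormedType.Exports.
Local Open Scope classical_set_scope.
Local Open Scope ring_scope.

Definition inftuples (R : realType) (D : set R) : set (nat -> R) :=
  [set x | forall j, D (x j)].

Definition fintuples (R : realType) (D : set R) (u : {fset nat}) :
    set (u -> R) :=
  [set x | forall j, D (x j)].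

(* The point (x; c), for x indexed by u. *)
Definition anchor_ext (R : realType) (c : R) (u : {fset nat}) (x : u -> R) :
    nat -> R :=
  fun j => if insub j is Some k then x k else c.

(* The point (x_u; c), for x in D^N. *)
Definition anchor_proj (R : realType) (c : R) (u : {fset nat}) (x : nat -> R) :
    nat -> R :=
  anchor_ext c (fun k : u => x (val k)).

Definition Psi (R : realType) (c : R) (u : {fset nat}) (f : (nat -> R) -> R) :
    (nat -> R) -> R :=
  fun x => f (anchor_proj c u x).

Definition cylinders (R : realType) (J : Type) : set (set (J -> R)) :=
  [set A | exists j (B : set (measurableTypeR R)),
     measurable B /\ A = [set x | B (x j)]].

Definition prod_space (R : realType) (J : Type) :=
  g_sigma_algebraType (@cylinders R J).

(* m is the product, over the index set J, of copies of rho: this determines m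
   on a pi-system generating the product sigma-algebra. *)
Definition is_product_measure (R : realType)
    (rho : probability (measurableTypeR R) R) (J : choiceType)
    (m : probability (prod_space R J) R) : Prop :=
  forall (s : {fset J}) (B : J -> set (measurableTypeR R)),
    (forall j, measurable (B j)) ->
    m [set x : J -> R | forall j, j \in s -> B j (x j)] =
    (\prod_(j <- s) rho (B j))%E.

Definition anchored_kernel (R : realType) (D : set R) (K : R -> R -> R)
    (c : R) : Prop :=
  [/\ measurable_fun (D `*` D : set (measurableTypeR R * measurableTypeR R))
        (fun z => K z.1 z.2),
      exists x y, [/\ D x, D y & K x y != 0],
      forall x y, D x -> D y -> K x y = K y x,
      forall (n : nat) (x a : 'I_n -> R), (forall i, D (x i)) ->
        0 <= \sum_i \sum_j a i * a j * K (x i) (x j) &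
      D c /\ K c c = 0].

(* An RKHS on X with kernel K: a Hilbert space (a complete normed space whose
   norm is given by the inner product rk_dot) of functions on X, with the
   reproducing property.  The element f stands for the function rk_fun f
   restricted to X; the values of rk_fun f outside X are irrelevant.  Linearity
   of rk_fun f x in f, for x in X, follows from rk_repro.  For a symmetric
   positive semidefinite K this structure exists and is unique up to the
   isometry preserving the functions. *)
Record rkhs (R : realType) (T : Type) (X : set T) (K : T -> T -> R) := Rkhs {
  rk_space :> completeNormedModType R;
  rk_fun : rk_space -> T -> R;
  rk_inj : forall f g : rk_space,
    (forall x, X x -> rk_fun f x = rk_fun g x) -> f = g;
  rk_dot : rk_space -> rk_space -> R;
  rk_dotC : forall f g, rk_dot f g = rk_dot g f;
  rk_dotP : forall (a : R) (f g h : rk_space),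
    rk_dot (a *: f + g) h = a * rk_dot f h + rk_dot g h;
  rk_norm : forall f : rk_space, `|f| ^+ 2 = rk_dot f f;
  rk_section : T -> rk_space;
  rk_sectionE : forall x y, X x -> X y -> rk_fun (rk_section x) y = K y x;
  rk_repro : forall f x, X x -> rk_fun f x = rk_dot f (rk_section x) }.

Definition worst_case_error (R : realType) (T : Type) (X : set T)
    (K : T -> T -> R) (H : rkhs X K) (I Q : (T -> R) -> R) : \bar R :=
  ereal_sup [set (`|I (rk_fun f) - Q (rk_fun f)|)%:E
            | f in [set f : H | `|f| <= 1]].

Definition tensor_kernel (R : realType) (K : R -> R -> R) (u : {fset nat})
    (x y : nat -> R) : R :=
  \prod_(j <- u) K (x j) (y j).

Definition weight_support (R : realType) (gam : {fset nat} -> R) : set {fset nat} :=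
  [set u | 0 < gam u].

Definition weighted_domain (R : realType) (D : set R) (K : R -> R -> R)
    (gam : {fset nat} -> R) : set (nat -> R) :=
  [set x | inftuples D x /\
     (\esum_(u in weight_support gam) (gam u * tensor_kernel K u x x)%:E < +oo)%E].

(* The sum over S of an absolutely summable real family. *)
Definition real_sum (R : realType) (I : choiceType) (S : set I) (f : I -> R) :
    R :=
  fine (\esum_(i in S) (Num.max (f i) 0)%:E
        - \esum_(i in S) (Num.max (- f i) 0)%:E)%E.

Definition weighted_kernel (R : realType) (K : R -> R -> R)
    (gam : {fset nat} -> R) (x y : nat -> R) : R :=
  real_sum (weight_support gam) (fun u => gam u * tensor_kernel K u x y).

(* An algorithm is the list of its pairs (a_i, (t_{v_i}; c)). *)
Definition algorithm (R : realType) := seq (R * (nat -> R)).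

Definition alg_eval (R : realType) (Q : algorithm R) (f : (nat -> R) -> R) : R :=
  \sum_(q <- Q) q.1 * f q.2.

Definition admissible (R : realType) (D : set R) (c : R) (Q : algorithm R) :
    Prop :=
  forall q, q \in Q -> exists (v : {fset nat}) (t : v -> R),
    [/\ fintuples D t, forall j, t j <> c & q.2 = anchor_ext c t].

Definition quadrature (R : realType) (D : set R) (c : R) (v : {fset nat})
    (n : nat) (Q : algorithm R) : Prop :=
  size Q = n /\
  forall q, q \in Q -> exists t : v -> R,
    fintuples D t /\ q.2 = anchor_ext c t.

Definition integral_inf (R : realType) (D : set R) (K : R -> R -> R)
    (gam : {fset nat} -> R) (mu : probability (prod_space R nat) R)
    (f : (nat -> R) -> R) : R :=
  \int[mu]_(x in weighted_domain D K gam) f x.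

Definition integral_fin (R : realType) (D : set R) (c : R) (u : {fset nat})
    (rhou : probability (prod_space R u) R) (g : (nat -> R) -> R) : R :=
  \int[rhou]_(x in @fintuples R D u) g (anchor_ext c x).

Definition node_cost (R : realType) (c : R) (price : nat -> R)
    (w : nat -> {fset nat}) (x : nat -> R) : \bar R :=
  ereal_inf [set (price #|` w i|)%:E
            | i in [set i | forall j, j \notin w i -> x j = c]].

Definition cost_nest (R : realType) (c : R) (price : nat -> R)
    (Q : algorithm R) : \bar R :=
  ereal_inf [set (\sum_(q <- Q) node_cost c price w q.2)%E
            | w in [set w : nat -> {fset nat} |
                      forall i, (w i `<` w i.+1)%fset]].

(* [err] maps an algorithm Q to its worst case error on the weighted space. *)
Definition comp_nest (R : realType) (D : set R) (c : R) (price : nat -> R)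
    (err : algorithm R -> \bar R) (eps : R) : \bar R :=
  ereal_inf [set cost_nest c price Q
            | Q in [set Q | admissible D c Q /\ (err Q <= eps%:E)%E]].

Definition p_nest (R : realType) (D : set R) (c : R) (price : nat -> R)
    (err : algorithm R -> \bar R) : \bar R :=
  ereal_inf [set p%:E | p in [set p : R | 0 <= p /\
    exists2 C : R, 0 <= C & forall eps : R, 0 < eps ->
      (comp_nest D c price err eps <= (C * eps `^ (- p))%:E)%E]].

Definition POD (R : realType) (Gam : nat -> R) (g : nat -> R)
    (u : {fset nat}) : R :=
  Gam #|` u| * \prod_(j <- u) g j.

(* sigma = None stands for sigma = infinity. *)
Definition active (R : realType) (gam : {fset nat} -> R) (sigma : option nat) :
    set {fset nat} :=
  [set u | [/\ u != fset0, 0 < gam u &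
            if sigma is Some s then (#|` u| <= s)%N else true]].

Definition scaled (R : realType) (C0 : R) (gam : {fset nat} -> R)
    (u : {fset nat}) : R :=
  gam u * C0 ^+ #|` u|.

(* e enumerates the active sets in order of non-increasing scaled weight (e i is
   u_{i+1}(sigma)); all such e give the same sequence of scaled weights. *)
Definition decay (R : realType) (C0 : R) (gam : {fset nat} -> R)
    (sigma : option nat) : \bar R :=
  if `[< finite_set (active gam sigma) >] then +oo%E
  else ereal_sup [set p%:E | p in [set p : R |
    exists e : nat -> {fset nat},
      [/\ set_bij [set: nat] (active gam sigma) e,
          forall i j, (i <= j)%N -> scaled C0 gam (e j) <= scaled C0 gam (e i) &
          (fun i => scaled C0 gam (e i) * i.+1%:R `^ p) @ \oo --> (0 : R)]]].

Definition first_coords (n : nat) : {fset nat} :=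
  [fset j | j in iota 0 n]%fset.

(* v_k = [L * ceil (a ^ (k - 1))] for k >= 1, and v_0 is empty. *)
Definition level_set (R : realType) (L : nat) (a : R) (k : nat) : {fset nat} :=
  if k is k'.+1 then first_coords (L * `|Num.ceil (a ^+ k')|)%N else fset0.

(* The algorithm f |-> Q (f - Psi_u f). *)
Definition alg_diff (R : realType) (c : R) (u : {fset nat}) (Q : algorithm R) :
    algorithm R :=
  Q ++ [seq (- q.1, anchor_proj c u q.2) | q <- Q].

Definition multilevel (R : realType) (c : R) (v : nat -> {fset nat})
    (Q : nat -> nat -> algorithm R) (m : nat) (n : nat -> nat) : algorithm R :=
  (1, fun=> c) :: flatten [seq alg_diff c (v k.-1) (Q k (n k)) | k <- iota 1 m].

Lemma multilevelE (R : realType) (c : R) (v : nat -> {fset nat})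
    (Q : nat -> nat -> algorithm R) (m : nat) (n : nat -> nat)
    (f : (nat -> R) -> R) :
  alg_eval (multilevel c v Q m n) f = f (fun=> c) +
  \sum_(1 <= k < m.+1)
     alg_eval (Q k (n k)) (fun x => f x - Psi c (v k.-1) f x).
Proof.
rewrite /alg_eval big_cons /= mul1r; congr (_ + _).
rewrite big_flatten /= big_map /index_iota subSS subn0.
apply: eq_bigr => k _; rewrite big_cat big_map /= -big_split /=.
by apply: eq_bigr => q _; rewrite mulNr mulrBr.
Qed.

Definition establishes (R : realType) (c : R) (price : nat -> R)
    (err : algorithm R -> \bar R) (v : nat -> {fset nat})
    (Q : nat -> nat -> algorithm R) (B : \bar R) : Prop :=
  forall p : R, (B < p%:E)%E -> exists C : R,
    forall eps : R, 0 < eps <= 1 -> exists (m : nat) (n : nat -> nat),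
      [/\ (0 < m)%N,
          forall k, (1 <= k <= m)%N -> (0 < n k)%N,
          forall k, (1 <= k < m)%N -> (n k.+1 <= n k)%N,
          (err (multilevel c v Q m n) <= eps%:E)%E &
          (cost_nest c price (multilevel c v Q m n)
             <= (C * eps `^ (- p))%:E)%E].

(* The quadrature error condition for one value of tau; [erru u Q] is the worst
   case error of (Q)_u on H_u. *)
Definition quadrature_bound (R : realType) (gam : {fset nat} -> R)
    (erru : {fset nat} -> algorithm R -> \bar R) (v : nat -> {fset nat})
    (Q : nat -> nat -> algorithm R) (tau : R) : Prop :=
  exists2 C : R, 0 <= C & forall k n : nat, (0 < k)%N -> (0 < n)%N ->
    forall l : nat, l \in (v k `\` v k.-1)%fset ->
    (\sum_(u <- fpowerset (first_coords l.+1) | l \in u)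
        (gam u)%:E * erru u (Q k n) ^+ 2
     <= ((\sum_(u <- fpowerset (first_coords l.+1) | l \in u)
           gam u `^ (1 / (2 * tau)) * C ^+ #|` u|) `^ (2 * tau)
         * n%:R `^ (- (2 * tau)))%:E)%E.

(* Main.v *)
Require Import Defs.
From mathcomp Require Import all_boot all_order all_algebra.
From mathcomp Require Import finmap.
From mathcomp Require Import all_classical all_reals all_analysis.
From mathcomp Require Import measurable_realfun.
From mathcomp Require Import ring lra zify.
Import Order.TTheory GRing.Theory Num.Theory.
Import numFieldNormedType.Exports.
Local Open Scope classical_set_scope.
Local Open Scope ring_scope.
Set Implicit Arguments.
Unset Strict Implicit.
Unset Printing Implicit Defensive.

(* The span of the kernel sections is dense in the weighted space, and on it
   [f] is the sum of components in the spaces [H u], so the square of the error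
   is at most the sum over [u] of [gam u] times the square of the error on
   [H u].  On a component [u] with largest coordinate [l], the multilevel
   algorithm acts as the single quadrature of the first level that contains
   [l]: the lower levels vanish by the anchor condition, and in the higher ones
   the difference [f - Psi f] vanishes.  If [l] belongs to no level, the
   algorithm gives 0, and the error is at most the norm of the integral.

   If [g j = O(j ^ -p)], the growth condition on [Gam] gives
   [O(l ^ -p)] for the sum of [gam u * A ^ |u|] over all [u] with maximum [l];
   hence level [k] contributes [a ^ (- k (p - 1)) * n_k ^ (- 2 tau)] to the
   square of the error, and the truncation contributes [a ^ (- m (p - 1))].
   With [n_k = ceil (a ^ (beta (m - k)))] and [(p - 1) / (2 tau) < beta < s]
   (after increasing [s] slightly, if necessary) the error and the cost are both
   geometric sums dominated by the last level, which yields the exponent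
   [2 s / (p - 1)].  The four bounds are obtained by choosing [p] and [tau]; the
   same estimate also shows that [decay_gamma >= decay_{gamma,1}]. *)

(** * Sums over finite sets of coordinates *)

(** The structure [rkhs] comes with no decomposition of an element of the weighted space into
    components. A finite list of coefficients and points supplies one: the same list defines a
    combination of sections in every [H u], the component in [H u] is [gam u] times that
    combination, and the squared norms add up. The proof therefore works with lists and passes to
    general elements by a limit that is pointwise and increases the norm by an arbitrarily small
    amount.

    The growth condition on [Gam] is usable because [|u|!] is at most the product of the numbers
    [j + 1] over [j] in [u]. Almost one factor [|u|!] is absorbed by the denominator of an
    elementary symmetric sum, and the remaining power is paid for by the decay of the coordinates;
    this is where [q < p] enters.

    The decay of all weights is compared with that of [g] in both directions. A lower bound for
    [decay_gamma] makes large enough values of [tau] available; conversely, [2 tau < decay_gamma]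
    forces [g] to decay faster than [j ^ (- 2 tau)], as the singletons are among the active sets. *)

Section PowerSums.
Context {R : realType}.
Implicit Types (x y p k : R) (n N : nat).

(** The comparison of sum and integral in discrete form; it rests on [ln (1 - x) <= - x] and
    [1 + y <= expR y]. *)
Lemma powR_telescope (kap : R) n : 0 < kap -> (0 < n)%N ->
  kap * n.+1%:R `^ (- (1 + kap)) <= n%:R `^ (- kap) - n.+1%:R `^ (- kap).
Proof.
move=> kap0 n0.
have n0' : 0 < n%:R :> R by rewrite ltr0n.
have n1' : 0 < n.+1%:R :> R by rewrite ltr0n.
have nE : n%:R = n.+1%:R * (1 - n.+1%:R^-1) :> R.
  by rewrite mulrBr mulr1 divff ?gt_eqF// -natr1; lra.
have d0 : 0 < 1 - n.+1%:R^-1 :> R.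
  by rewrite subr_gt0 invf_lt1// ltr1n ltnS.
rewrite {1}nE powRM ?(ltW n1') ?(ltW d0)//.
have -> : n.+1%:R `^ (- (1 + kap)) = n.+1%:R `^ (- kap) * n.+1%:R^-1 :> R.
  rewrite opprD addrC powRD ?(gt_eqF n1') ?implybT//.
  by rewrite powR_inv1 ?ltW.
have P : 0 <= n.+1%:R `^ (- kap) :> R by exact: powR_ge0.
rewrite mulrCA -[X in _ <= _ - X]mulr1 -mulrBr ler_wpM2l//.
rewrite lerBrDl.
rewrite /powR (gt_eqF d0).
apply: (@le_trans _ _ (expR (kap * n.+1%:R^-1))); first exact: expR_ge1Dx.
rewrite ler_expR mulNr -mulrN ler_pM2l//.
have := @le_ln1Dx R (- n.+1%:R^-1); rewrite lerNr; apply.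
by rewrite ltrN2 invf_lt1// ltr1n ltnS.
Qed.

Lemma sum_powR_tail (p : R) : 1 < p -> exists2 C : R, 0 <= C &
  forall N n : nat, \sum_(N <= j < n) j.+1%:R `^ (- p) <= C * N.+1%:R `^ (1 - p).
Proof.
move=> p1; set kap := p - 1.
have kap0 : 0 < kap by rewrite subr_gt0.
have pE : p = 1 + kap by rewrite /kap; lra.
have tel N n : (0 < N <= n)%N ->
    kap * (\sum_(N <= j < n) j.+1%:R `^ (- p)) <= N%:R `^ (- kap) - n%:R `^ (- kap).
  move=> /andP[N0 Nn]; rewrite mulr_sumr.
  have -> : N%:R `^ (- kap) - n%:R `^ (- kap) =
      \sum_(N <= j < n) (j%:R `^ (- kap) - j.+1%:R `^ (- kap)) :> R.
    rewrite (@telescope_sumr_eq _ _ _ (fun j => - (j%:R `^ (- kap))))//.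
      by rewrite opprK addrC.
    by move=> k _; rewrite opprK addrC.
  apply: ler_sum_nat => i /andP[Ni _].
  by rewrite pE powR_telescope// (leq_trans N0).
have tel1 N n : (0 < N)%N ->
    \sum_(N <= j < n) j.+1%:R `^ (- p) <= N%:R `^ (- kap) / kap :> R.
  move=> N0; have [nN|Nn] := ltnP n N.
    by rewrite big_geq ?(ltnW nN)// divr_ge0 ?powR_ge0 ?ltW.
  rewrite ler_pdivlMr// mulrC; apply: (le_trans (tel _ _ _)); first by rewrite N0.
  by rewrite gerBl powR_ge0.
have kE : 1 - p = - kap by rewrite /kap; lra.
have k2 : 1 <= 2 `^ kap :> R by rewrite -[leLHS](powRr0 2) ler_powR ?ler1n ?ltW.
(* The 1 is the term [j = 0], where telescoping cannot start; [2 ^ kap] pays for the shift from [N]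
   to [N + 1]. *)
exists (1 + 2 `^ kap / kap); first by rewrite addr_ge0 ?divr_ge0 ?powR_ge0 ?ltW.
move=> [|N] n.
  rewrite powR1 mulr1; case: n => [|n].
    by rewrite big_geq// addr_ge0 ?divr_ge0 ?powR_ge0 ?ltW.
  rewrite big_nat_recl// powR1 lerD2l.
  rewrite -(big_add1 _ _ 0 n.+1 xpredT (fun i => i.+1%:R `^ (- p))).
  apply: le_trans (tel1 _ _ _) _ => //; rewrite powR1 ler_pM2r ?invr_gt0//.
apply: (le_trans (tel1 _ _ _)) => //; rewrite kE.
rewrite mulrDl mul1r ler_wpDl ?powR_ge0// mulrAC ler_pM2r ?invr_gt0//.
rewrite !powRN ler_pdivlMr ?powR_gt0 ?ltr0n// ler_pdivrMl ?powR_gt0 ?ltr0n//.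
rewrite mulrC -powRM ?ler0n// ge0_ler_powR ?(ltW kap0) ?nnegrE ?mulr_ge0 ?ler0n//.
by rewrite -natrM ler_nat; lia.
Qed.

End PowerSums.

(** * Subsets of initial segments, sorted by their maximum *)

Section Fpowerset.
Local Open Scope fset_scope.

Lemma in_first_coords n j : (j \in first_coords n) = (j < n)%N.
Proof. by rewrite /first_coords !inE mem_iota. Qed.

Lemma card_first_coords n : #|` first_coords n| = n.
Proof.
rewrite /first_coords card_fseq undup_id ?size_iota//.
by rewrite -[X in uniq X]map_id map_id iota_uniq.
Qed.

Lemma first_coordsS n : first_coords n.+1 = n |` first_coords n.
Proof. by apply/fsetP => j; rewrite !(in_first_coords, inE) ltnS leq_eqVlt. Qed.

Lemma first_coords_sub m n : (m <= n)%N -> first_coords m `<=` first_coords n.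
Proof.
by move=> mn; apply/fsubsetP => j; rewrite !in_first_coords => /leq_trans; apply.
Qed.

Lemma notin_fpowerset n u : u \in fpowerset (first_coords n) -> n \notin u.
Proof.
rewrite fpowersetE => /fsubsetP un; apply/negP => /un.
by rewrite in_first_coords ltnn.
Qed.

Context {R : Type} {idx : R} {op : Monoid.com_law idx}.

Lemma big_fpowerset_mem n (F : {fset nat} -> R) :
  \big[op/idx]_(u <- fpowerset (first_coords n.+1) | n \in u) F u =
  \big[op/idx]_(u <- fpowerset (first_coords n)) F (n |` u).
Proof.
rewrite -[LHS]big_filter -[RHS](big_map (fun u => n |` u) xpredT).
apply: perm_big; apply: uniq_perm.
- by rewrite filter_uniq// fset_uniq.
- rewrite map_inj_in_uniq ?fset_uniq// => u v /notin_fpowerset nu /notin_fpowerset nv.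
  move=> /(congr1 (fun w => w `\ n)).
  by rewrite !fsetU1K.
move=> u; rewrite mem_filter; apply/andP/mapP => [[nu]|[v vn ->]].
  rewrite fpowersetE first_coordsS => un; exists (u `\ n); last by rewrite fsetD1K.
  by rewrite fpowersetE fsubDset.
split; first by rewrite !inE eqxx.
by rewrite fpowersetE first_coordsS fsetUS// -fpowersetE.
Qed.

Lemma big_fpowerset_notin n (F : {fset nat} -> R) :
  \big[op/idx]_(u <- fpowerset (first_coords n.+1) | n \notin u) F u =
  \big[op/idx]_(u <- fpowerset (first_coords n)) F u.
Proof.
rewrite -[LHS]big_filter; apply: perm_big; apply: uniq_perm.
- by rewrite filter_uniq// fset_uniq.
- exact: fset_uniq.
move=> u; rewrite mem_filter; apply/andP/idP => [[nu]|un].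
  rewrite !fpowersetE first_coordsS => /fsubsetP un; apply/fsubsetP => j ju.
  move: (un _ ju); rewrite !inE => /orP[/eqP jn|//].
  by rewrite -jn ju in nu.
split; first exact: notin_fpowerset.
move: un; rewrite !fpowersetE first_coordsS => un.
by rewrite (fsubset_trans un)// fsubsetUr.
Qed.

Lemma big_fpowersetS n (F : {fset nat} -> R) :
  \big[op/idx]_(u <- fpowerset (first_coords n.+1)) F u =
  op (\big[op/idx]_(u <- fpowerset (first_coords n)) F u)
     (\big[op/idx]_(u <- fpowerset (first_coords n)) F (n |` u)).
Proof.
rewrite (bigID (fun u => n \notin u)) /=; congr (op _ _).
  exact: big_fpowerset_notin.
rewrite -big_fpowerset_mem; apply: eq_bigl => u; by rewrite negbK.
Qed.

(** The inner index sets are those of the quadrature hypothesis: a non-empty set with maximum [l] is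
    a subset of [{0, ..., l}] that contains [l]. *)
Lemma big_fpowerset_max N (F : {fset nat} -> R) :
  \big[op/idx]_(u <- fpowerset (first_coords N)) F u =
  op (F fset0) (\big[op/idx]_(l < N)
     \big[op/idx]_(u <- fpowerset (first_coords l.+1) | val l \in u) F u).
Proof.
elim: N => [|N IHN].
  have -> : first_coords 0 = fset0 by apply/fsetP => j; rewrite in_first_coords !inE.
  by rewrite fpowerset0 big_seq_fset1 big_ord0 Monoid.mulm1.
by rewrite big_fpowersetS big_ord_recr /= Monoid.mulmA IHN big_fpowerset_mem.
Qed.

End Fpowerset.

Lemma fpowerset_ind (P : nat -> {fset nat} -> Prop) :
  (P 0%N fset0) ->
  (forall n u, u \in fpowerset (first_coords n) -> P n u -> P n.+1 u) ->
  (forall n u, u \in fpowerset (first_coords n) -> P n u -> P n.+1 (n |` u)%fset) ->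
  forall n u, u \in fpowerset (first_coords n) -> P n u.
Proof.
move=> P0 P1 P2; elim=> [u|n IHn u].
  have -> : first_coords 0 = fset0 by apply/fsetP => j; rewrite in_first_coords !inE.
  by rewrite fpowerset0 inE => /eqP ->.
have [nu|nu] := boolP (n \in u) => un.
  rewrite -(fsetD1K nu); apply: P2; last apply: IHn.
    by move: un; rewrite !fpowersetE first_coordsS -fsubDset.
  by move: un; rewrite !fpowersetE first_coordsS -fsubDset.
suff un' : u \in fpowerset (first_coords n) by apply: P1 => //; exact: IHn.
move: un; rewrite !fpowersetE first_coordsS => /fsubsetP un; apply/fsubsetP => j ju.
by move: (un _ ju); rewrite !inE => /orP[/eqP jn|//]; rewrite -jn ju in nu.
Qed.

Lemma fset_in_fpowerset (u : {fset nat}) :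
  u \in fpowerset (first_coords (\max_(j <- u) j).+1).
Proof.
rewrite fpowersetE; apply/fsubsetP => j ju.
by rewrite in_first_coords ltnS (@leq_bigmax_seq _ (enum_fset u) xpredT (fun k : nat => k)).
Qed.

(** The i-th smallest element of [u] is at least [i - 1], so its successor is at least [i]. This
    lets the decay of the coordinates pay for a power of the factorial. *)
Lemma fact_card_le_prod (u : {fset nat}) : ((#|` u|)`! <= \prod_(j <- u) j.+1)%N.
Proof.
have := fset_in_fpowerset u; move: (_.+1) => n.
move: n u; apply: fpowerset_ind => [|//|n u un IH]; first by rewrite cardfs0 big_seq_fset0.
have nu := notin_fpowerset un.
rewrite cardfsU1 nu big_fsetU1//= add1n factS leq_mul// ltnS.
by rewrite -[leqRHS]card_first_coords fsubset_leq_card// -fpowersetE.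
Qed.

(** * Symmetric sums and order-dependent weights *)

Section SymmetricSums.
Context {R : realType}.

Lemma exprD_ge (x y : R) k : 0 <= x -> 0 <= y ->
  x ^+ k.+1 + k.+1%:R * y * x ^+ k <= (x + y) ^+ k.+1.
Proof.
move=> x0 y0; elim: k => [|k IHk]; first by rewrite !expr1 expr0 mul1r mulr1.
rewrite exprS [leRHS]exprS.
have xk : 0 <= x ^+ k by rewrite exprn_ge0.
apply: (@le_trans _ _ ((x + y) * (x ^+ k.+1 + k.+1%:R * y * x ^+ k))); last first.
  by rewrite ler_wpM2l// addr_ge0.
have -> : k.+2%:R = k.+1%:R + 1 :> R by rewrite natr1.
rewrite -subr_ge0 exprS.
have -> : (x + y) * (x * x ^+ k + k.+1%:R * y * x ^+ k) -
  (x * (x * x ^+ k) + (k.+1%:R + 1) * y * (x * x ^+ k)) = k.+1%:R * (y * y * x ^+ k).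
  by ring.
by rewrite !mulr_ge0.
Qed.

(* Generating-function form of [e_k (y_1, ..., y_n) <= (y_1 + ... + y_n)^k / k!],
   which is what makes the induction on [n] go through without splitting the
   sum according to the cardinality. *)
Lemma sum_fpowerset_prod_le (f y : nat -> R) n :
  (forall k, 0 <= f k) -> (forall j, 0 <= y j) ->
  \sum_(u <- fpowerset (first_coords n)) f #|` u| * \prod_(j <- u) y j <=
  \sum_(k < n.+1) f k * ((\sum_(j < n) y j) ^+ k / k`!%:R).
Proof.
move=> f0 y0; elim: n f f0 => [|n IHn] f f0.
  have -> : first_coords 0 = fset0 by apply/fsetP => j; rewrite in_first_coords !inE.
  rewrite fpowerset0 big_seq_fset1 big_ord_recl !big_ord0 cardfs0 big_seq_fset0.
  by rewrite addr0 expr0 fact0 divr1.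
rewrite big_fpowersetS /= [X in _ + X](_ : _ =
   y n * \sum_(u <- fpowerset (first_coords n)) f #|` u|.+1 * \prod_(j <- u) y j); last first.
  rewrite mulr_sumr !big_seq; apply: eq_bigr => u un.
  by rewrite cardfsU1 (notin_fpowerset un) big_fsetU1 ?(notin_fpowerset un)//= mulrCA.
have S0 : 0 <= \sum_(j < n) y j by rewrite sumr_ge0.
rewrite [X in _ <= \sum_(k < _) _ * (X ^+ _ / _)]big_ord_recr /=.
move: S0 (IHn f f0) (IHn (f \o S) (fun k => f0 k.+1)) => /=.
set S := \sum_(j < n) y j; move=> S0 H1 H2.
apply: le_trans (lerD H1 (ler_wpM2l (y0 n) H2)) _.
apply: (@le_trans _ _ (\sum_(k < n.+2) f k * (S ^+ k / k`!%:R) +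
    y n * \sum_(k < n.+1) f k.+1 * (S ^+ k / k`!%:R))).
  rewrite lerD2r [leRHS]big_ord_recr /= lerDl.
  by rewrite mulr_ge0// divr_ge0// exprn_ge0.
rewrite big_ord_recl [leRHS]big_ord_recl !expr0 -addrA lerD2l mulr_sumr -big_split /=.
apply: ler_sum => k _; rewrite /bump /= add1n [y n * _]mulrCA -mulrDr ler_wpM2l//.
have F : (k.+1`!%:R : R) != 0 by rewrite pnatr_eq0 -lt0n fact_gt0.
have -> : y n * (S ^+ k / k`!%:R) = (k.+1%:R * y n * S ^+ k) / k.+1`!%:R.
  rewrite factS natrM; field; rewrite addrC natr1 !pnatr_eq0 -lt0n fact_gt0.
  by [].
by rewrite -mulrDl ler_pM2r ?invr_gt0 ?ltr0n ?fact_gt0// exprD_ge.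
Qed.

Lemma expr_le_fact_expR (y : R) k : 0 <= y -> y ^+ k <= k`!%:R * expR y.
Proof.
move=> y0; case: k => [|k].
  by rewrite expr0 fact0 mul1r -expR0 ler_expR.
rewrite mulrC -ler_pdivrMr ?ltr0n ?fact_gt0//.
by apply: le_trans (expR_ge1Dxn k y0); rewrite lerDr.
Qed.

Lemma powR_expn_swap (x r : R) k : 0 <= x -> (x ^+ k) `^ r = (x `^ r) ^+ k.
Proof. by move=> x0; rewrite -powR_mulrn// -powRrM mulrC powRrM powR_mulrn// powR_ge0. Qed.

Lemma sum_geometric_fact (B d : R) : 0 <= B -> 0 < d ->
  exists2 C : R, 0 <= C &
    forall n, \sum_(k < n) B ^+ k * k`!%:R `^ (- d) <= C.
Proof.
(* With [y ^ d = 2 * B], bounding [y ^ k] by [k! * expR y] and taking the power [d] leaves a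
   geometric series of ratio 1/2. *)
move=> B0 d0; pose y := (2 * B) `^ d^-1.
have y0 : 0 <= y by exact: powR_ge0.
have yd : y `^ d = 2 * B.
  by rewrite /y -powRrM mulVf ?gt_eqF// powRr1// mulr_ge0.
have bnd k : B ^+ k * k`!%:R `^ (- d) <= expR y `^ d * (2^-1) ^+ k.
  rewrite powRN ler_pdivrMr ?powR_gt0 ?ltr0n ?fact_gt0//.
  have -> : B ^+ k = (2 * B) ^+ k * 2^-1 ^+ k.
    by rewrite -exprMn mulrAC divff// mul1r.
  rewrite mulrAC ler_wpM2r ?exprn_ge0// -yd -powR_expn_swap// mulrC -powRM ?ler0n ?expR_ge0//.
  by rewrite ge0_ler_powR ?(ltW d0) ?nnegrE ?mulr_ge0 ?exprn_ge0 ?expR_ge0 ?ler0n// expr_le_fact_expR.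
exists (2 * expR y `^ d) => [|n]; first by rewrite mulr_ge0 ?powR_ge0.
apply: (@le_trans _ _ (\sum_(k < n) expR y `^ d * (2^-1) ^+ k)).
  by apply: ler_sum => k _; exact: bnd.
rewrite -mulr_sumr mulrC ler_wpM2r ?powR_ge0//.
have : (1 - 2^-1) * (\sum_(i < n) 2^-1 ^+ i) = 1 - 2^-1 ^+ n :> R.
  by rewrite -opprB mulNr -subrX1 opprB.
have : 0 <= 2^-1 ^+ n :> R by rewrite exprn_ge0.
lra.
Qed.

End SymmetricSums.

Lemma powR_prod (R : realType) (I : Type) (r : seq I) (F : I -> R) (x : R) :
  (forall i, 0 <= F i) ->
  (\prod_(i <- r) F i) `^ x = \prod_(i <- r) F i `^ x.
Proof.
move=> F0; elim: r => [|i r IHr]; first by rewrite !big_nil powR1.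
by rewrite !big_cons powRM ?prodr_ge0// IHr.
Qed.

(** The parameter [x] will be 1 for the truncation, [1 / (2 tau)] for the quadratures and [1 / r]
    for the decay; [A] collects a constant per coordinate. The factorial is split: its power [1 - d]
    meets the [1 / k!] of the symmetric sum, and the rest goes into the product over [u], which
    keeps a summable factor [y j] per coordinate. *)
Lemma POD_sum_bound (R : realType) (Gam g : nat -> R) (q Cq p Cg x A : R) :
  (forall k, 0 <= Gam k) -> (forall k, (1 <= k)%N -> Gam k <= Cq * k`!%:R `^ q) ->
  (forall j, 0 <= g j) -> (forall j, g j <= Cg * j.+1%:R `^ (- p)) ->
  0 <= Cq -> 0 <= Cg -> 0 < x -> q < p -> 1 < p * x -> 0 <= A ->
  exists2 C : R, 0 <= C & forall l,
    \sum_(u <- fpowerset (first_coords l.+1) | l \in u)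
      POD Gam g u `^ x * A ^+ #|` u| <= C * l.+1%:R `^ (- (p * x)).
Proof.
move=> Gam0 GamC g0 gC Cq0 Cg0 x0 qp r1 A0.
set r := p * x in r1 *.
have qxr : q * x < r by rewrite ltr_pM2r.
(* [q' > 1] makes [q' - 1 + d] positive, and [r - q' = 2 d] leaves the exponent [1 + d] in [y] once
   [j.+1 ^ (q' - 1 + d)] has been spent on the factorial. *)
pose q' := Num.max (q * x) ((1 + r) / 2).
have q'r : q' < r by rewrite gt_max qxr/=; lra.
have q'1 : 1 < q' by rewrite lt_max; apply/orP; right; lra.
pose d := (r - q') / 2.
have d0 : 0 < d by rewrite /d; lra.
pose y j : R := j.+1%:R `^ (- (1 + d)).
have y0 j : 0 <= y j by exact: powR_ge0.
have [Z Z0 ZP] : exists2 Z : R, 0 <= Z & forall n, \sum_(j < n) y j <= Z.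
  have [|Z Z0 ZP] := @sum_powR_tail R (1 + d); first by lra.
  exists Z => // n; have := ZP 0%N n; rewrite powR1 mulr1 big_mkord; exact.
(* The constant contributed by each coordinate of [u]; [2 ^ q'] comes from [k + 1 <= 2 ^ k]. *)
pose A' := 2 `^ q' * Cg `^ x * A.
have A'0 : 0 <= A' by rewrite !mulr_ge0 ?powR_ge0.
have [C C0 CP] := @sum_geometric_fact R (A' * Z) d (mulr_ge0 A'0 Z0) d0.
pose f k : R := A' ^+ k * k`!%:R `^ (1 - d).
have f0 k : 0 <= f k by rewrite mulr_ge0 ?exprn_ge0 ?powR_ge0.
pose E := Cq `^ x * Cg `^ x * A.
have E0 : 0 <= E by rewrite !mulr_ge0 ?powR_ge0.
exists (E * C) => [|l]; first exact: mulr_ge0.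
rewrite big_fpowerset_mem /=.
have term u : u \in fpowerset (first_coords l) ->
    POD Gam g (l |` u)%fset `^ x * A ^+ #|` (l |` u)%fset| <=
    E * l.+1%:R `^ (- r) * (f #|` u| * \prod_(j <- u) y j).
  move=> ul; have lu := notin_fpowerset ul.
  rewrite /POD cardfsU1 lu big_fsetU1//= add1n.
  set k := #|` u|.
  have fk0 : 0 < k`!%:R :> R by rewrite ltr0n fact_gt0.
  have fk10 : 0 < (k.+1)`!%:R :> R by rewrite ltr0n fact_gt0.
  have fact_bnd : (k.+1)`!%:R `^ (q * x) <=
      (2 `^ q') ^+ k * k`!%:R `^ (1 - d) * \prod_(j <- u) j.+1%:R `^ (q' - 1 + d) :> R.
    apply: (@le_trans _ _ ((k.+1)`!%:R `^ q')).
      by rewrite ler_powR ?le_max ?lexx// ler1n fact_gt0.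
    rewrite factS natrM powRM ?ler0n// -mulrA ler_pM ?powR_ge0//.
      rewrite -powR_mulrn ?powR_ge0// -powRrM mulrC powRrM powR_mulrn//.
      rewrite ge0_ler_powR ?nnegrE ?exprn_ge0//; first by lra.
      by rewrite -natrX ler_nat ltn_expl.
    have {1}-> : q' = 1 - d + (q' - 1 + d) by ring.
    rewrite powRD ?(gt_eqF fk0) ?implybT// ler_wpM2l ?powR_ge0//.
    rewrite -powR_prod ?ge0_ler_powR ?nnegrE ?prodr_ge0//; first by lra.
    by rewrite -natr_prod ler_nat fact_card_le_prod.
  have POD_le : (Gam k.+1 * (g l * \prod_(j <- u) g j)) `^ x <=
     Cq `^ x * (k.+1)`!%:R `^ (q * x) * (Cg `^ x * l.+1%:R `^ (- r) *
       ((Cg `^ x) ^+ k * \prod_(j <- u) j.+1%:R `^ (- r))).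
    have -> : (Cg `^ x) ^+ k * \prod_(j <- u) j.+1%:R `^ (- r) =
       (\prod_(j <- u) (Cg * j.+1%:R `^ (- p))) `^ x.
      rewrite powR_prod; last by move=> j; rewrite mulr_ge0 ?powR_ge0.
      rewrite [RHS](eq_bigr (fun j => Cg `^ x * j.+1%:R `^ (- r))); last first.
        by move=> j _; rewrite powRM ?powR_ge0// -powRrM mulNr.
      by rewrite big_split /= big_const_seq count_predT iter_mulr_1.
    rewrite [q * x]mulrC /r -mulNr ![_ `^ (_ * x)]powRrM [x * q]mulrC powRrM.
    have c0 j : 0 <= Cg * j.+1%:R `^ (- p) by rewrite mulr_ge0 ?powR_ge0.
    have P0 : 0 <= \prod_(j <- u) (Cg * j.+1%:R `^ (- p)) by exact: prodr_ge0.
    have G0 : 0 <= \prod_(j <- u) g j by exact: prodr_ge0.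
    move: (GamC k.+1 isT) (gC l) (powR_ge0 k.+1`!%:R q) (powR_ge0 l.+1%:R (- p)).
    have : \prod_(j <- u) g j <= \prod_(j <- u) (Cg * j.+1%:R `^ (- p)).
      by apply: ler_prod => j _; rewrite g0 gC.
    move: (_ `^ q) (_ `^ (- p)) (\prod_(j <- u) _) P0 => fq lp P P0 HP HG Hg fq0 lp0.
    rewrite -!powRM ?mulr_ge0//.
    by rewrite ge0_ler_powR ?(ltW x0) ?nnegrE ?mulr_ge0// ler_pM ?mulr_ge0// ler_pM.
  apply: (le_trans (ler_wpM2r _ POD_le)); first exact: exprn_ge0.
  have prodE : \prod_(j <- u) y j =
     (\prod_(j <- u) j.+1%:R `^ (- r)) * \prod_(j <- u) j.+1%:R `^ (q' - 1 + d).
    rewrite -big_split; apply: eq_bigr => j _ /=.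
    rewrite -powRD ?pnatr_eq0 ?implybT//; congr (_ `^ _); rewrite /d; lra.
  rewrite prodE /E /f /A' !exprMn exprS.
  set X1 := Cq `^ x; set X2 := Cg `^ x; set X3 := _ `^ (- r).
  move: fact_bnd; set X4 := _ `^ (q * x); set X5 := (2 `^ q') ^+ k.
  set X6 := _ `^ (1 - d); set X7 := \prod_(j <- u) _ `^ (q' - 1 + d).
  set X8 := \prod_(j <- u) _ => H.
  have -> : X1 * X4 * (X2 * X3 * (X2 ^+ k * X8)) * (A * A ^+ k) =
     (X1 * X2 * X3 * X2 ^+ k * X8 * A * A ^+ k) * X4 by ring.
  have -> : X1 * X2 * A * X3 * (X5 * X2 ^+ k * A ^+ k * X6 * (X8 * X7)) =
     (X1 * X2 * X3 * X2 ^+ k * X8 * A * A ^+ k) * (X5 * X6 * X7) by ring.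
  have X80 : 0 <= X8 by apply: prodr_ge0 => j _; exact: powR_ge0.
  by rewrite ler_wpM2l// !mulr_ge0 ?exprn_ge0 ?powR_ge0.
rewrite big_seq.
apply: le_trans (ler_sum _ term) _; rewrite -big_seq -mulr_sumr.
rewrite [leRHS]mulrAC ler_wpM2l ?mulr_ge0 ?powR_ge0//.
apply: le_trans (@sum_fpowerset_prod_le _ f y l f0 y0) _.
apply: le_trans (CP l.+1); apply: ler_sum => k _.
have fk0 : 0 < k`!%:R :> R by rewrite ltr0n fact_gt0.
have -> : f k * ((\sum_(j < l) y j) ^+ k / k`!%:R) =
    A' ^+ k * k`!%:R `^ (- d) * (\sum_(j < l) y j) ^+ k.
  by rewrite /f powRD ?(gt_eqF fk0) ?implybT// powRr1 ?ltW//; field; rewrite gt_eqF.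
rewrite [(A' * Z) ^+ k]exprMn mulrAC ler_wpM2r ?powR_ge0// ler_wpM2l ?exprn_ge0//.
by rewrite lerXn2r ?nnegrE ?sumr_ge0.
Qed.

(** * Decay of the weights *)

Lemma injective_infinite_set (T : choiceType) (A : set T) (e : nat -> T) :
  injective e -> (forall n, A (e n)) -> infinite_set A.
Proof.
move=> einj eA /finite_seqP[t tE].
have := @uniq_leq_size _ (map e (iota 0 (size t).+1)) t.
rewrite map_inj_uniq// iota_uniq size_map size_iota ltnn => H.
suff : false by []. apply: H => // _ /mapP[n _ ->].
by have : [set` t] (e n) by rewrite -tE.
Qed.

Lemma ler_sum_subset (R : numDomainType) (T : eqType) (s t : seq T) (f : T -> R) :
  uniq s -> uniq t -> {subset s <= t} -> (forall x, 0 <= f x) ->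
  \sum_(x <- s) f x <= \sum_(x <- t) f x.
Proof.
move=> us ut st f0; rewrite [leRHS](bigID (mem s)) /= -[X in _ <= X + _]big_filter.
rewrite (perm_big [seq x <- t | x \in s]) /=; first by rewrite lerDl sumr_ge0.
apply: uniq_perm; rewrite ?filter_uniq// => x; rewrite mem_filter.
by have [/st ->|//] := boolP (x \in s).
Qed.

Lemma subset_fpowerset_first_coords (s : seq {fset nat}) :
  exists N, {subset s <= fpowerset (first_coords N)}.
Proof.
elim: s => [|u s [N sN]]; first by exists 0%N.
exists (maxn (\max_(j <- u) j).+1 N) => v; rewrite inE fpowersetE => /predU1P[->|/sN].
  apply: fsubset_trans (first_coords_sub (leq_maxl _ _)).
  by rewrite -fpowersetE fset_in_fpowerset.
by rewrite fpowersetE => /fsubset_trans; apply; rewrite first_coords_sub// leq_maxr.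
Qed.

Lemma cvg_powR_infty (R : realType) (d : R) : 0 < d ->
  i.+1%:R `^ (- d) @[i --> \oo] --> (0 : R).
Proof.
move=> d0; apply/cvgrPdist_le => /= eps eps0; near=> i.
rewrite sub0r normrN ger0_norm ?powR_ge0// powRN -[leRHS]invrK.
have X0 : 0 < eps^-1 by rewrite invr_gt0.
rewrite lef_pV2 ?posrE ?powR_gt0 ?ltr0n//.
have -> : eps^-1 = (eps^-1 `^ d^-1) `^ d.
  by rewrite -powRrM mulVf ?gt_eqF// powRr1// ltW.
rewrite ge0_ler_powR ?(ltW d0) ?nnegrE ?powR_ge0//.
rewrite -natr1; apply: ler_wpDr => //.
by near: i; exact: nbhs_infty_ger.
Unshelve. all: by end_near. Qed.

(** * Enumeration in non-increasing order *)

Section SortedEnumeration.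
Context {R : realType} {T : choiceType}.
Variables (A : set T) (h : T -> R).
Hypotheses (Ainf : infinite_set A) (h0 : forall u, A u -> 0 < h u)
  (hfin : forall d, 0 < d -> finite_set [set u | A u /\ d <= h u]).

Let next_spec (s : seq T) : exists u, [/\ A u, u \notin s &
  forall v, A v -> v \notin s -> h v <= h u].
Proof.
have [u0 [Au0 u0s]] : exists u, A u /\ u \notin s.
  apply: contrapT => /forallNP H; apply: Ainf.
  apply: (@sub_finite_set _ _ [set` s]) => [u Au|]; last exact: finite_seq.
  by apply/negPn/negP => us; apply: (H u).
(* A maximum exists because only the finitely many elements with [h] at least [h u0] compete with
   [u0]. *)
have := hfin (h0 Au0) => /finite_seqP[t tE].
have tP v : (v \in t) <-> A v /\ h u0 <= h v.
  by split => [vt|]; [have : [set` t] v by []; rewrite -tE|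
    move=> ?; have : [set` t] v by rewrite -tE].
pose t' := [seq v <- t | v \notin s].
have u0t : u0 \in t' by rewrite mem_filter u0s; apply/tP.
have [u ut um] : exists2 u, u \in t' & forall v, v \in t' -> h v <= h u.
  have : t' != [::] by apply/eqP => t0; rewrite t0 in u0t.
  elim: (t') => // x l IH _.
  case: l IH => [_|y l IH]; first by exists x; rewrite ?inE// => v; rewrite inE => /eqP ->.
  have [z zl zm] := IH isT.
  have [xz|zx] := leP (h x) (h z).
    exists z; first by rewrite inE zl orbT.
    by move=> v; rewrite inE => /predU1P[->//|/zm].
  exists x; first by rewrite inE eqxx.
  by move=> v; rewrite inE => /predU1P[->//|/zm /le_trans]; apply; exact: ltW.
move: (ut); rewrite mem_filter => /andP[us /tP[Au hu]].
exists u; split=> // v Av vs; have [hv|hv] := leP (h u0) (h v); last first.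
  exact: le_trans (ltW hv) hu.
by apply: um; rewrite mem_filter vs; apply/tP.
Qed.

(** A lower bound for [decay] has to exhibit such an enumeration. It is built greedily from the
    largest element left. If some [v] were never chosen, all values of the injective [e] would lie
    in the finite set where [h] is at least [h v]. *)
Lemma sorted_enumeration : exists e : nat -> T,
  set_bij [set: nat] A e /\ forall i j, (i <= j)%N -> h (e j) <= h (e i).
Proof.
have [next nextP] := choice next_spec.
pose chosen := fix chosen n := if n is m.+1 then next (chosen m) :: chosen m else [::].
pose e n := next (chosen n).
have sub i j : (i <= j)%N -> {subset chosen i <= chosen j}.
  move=> /subnK <-; elim: (j - i)%N => // k IH u /IH uk.
  by rewrite addSn inE uk orbT.
have e_in i j : (i < j)%N -> e i \in chosen j.
  by move=> ij; apply: (sub _ _ ij); rewrite /= inE eqxx.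
have e_notin n : e n \notin chosen n by have [] := nextP (chosen n).
have eA n : A (e n) by have [] := nextP (chosen n).
have e_inj i j : e i = e j -> i = j.
  move=> eij; have [ij|ji|//] := ltngtP i j.
    by have := e_notin j; rewrite -eij e_in.
  by have := e_notin i; rewrite eij e_in.
have emax n v : A v -> v \notin chosen n -> h v <= h (e n).
  by have [_ _ H] := nextP (chosen n); exact: H.
exists e; split; last first.
  move=> i j ij; apply: emax => //; apply/negP => /(sub _ _ ij).
  by apply/negP/e_notin.
split => [n _|i j _ _|v Av] //; first exact: e_inj.
apply: contrapT => nv.
have vn n : v \notin chosen n.
  elim: n => // n IH; rewrite inE negb_or IH andbT.
  by apply/negP => /eqP vE; apply: nv; exists n.
apply: (injective_infinite_set e_inj) (hfin (h0 Av)) => n.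
by split => //; exact: emax.
Qed.

End SortedEnumeration.

Section Decay.
Context {R : realType}.
Variables (C0 : R) (Gam g : nat -> R).
Hypotheses (C00 : 0 < C0) (Gam1 : Gam 1%N = 1) (g0 : forall j, 0 <= g j)
  (g_anti : forall j, g j.+1 <= g j).
Let gam := POD Gam g.

Lemma POD_singleton j : gam [fset j]%fset = g j.
Proof. by rewrite /gam /POD cardfs1 Gam1 mul1r big_seq_fset1. Qed.

(** By the pigeonhole principle one of the singletons [{0}, ..., {j}] stands at position [j] or
    later in the enumeration. Its weight is bounded by the decay at that position and is at least
    the weight of [{j}]. *)
Lemma lt_decay_power_bound (sigma : option nat) (p : R) :
  (if sigma is Some n then (0 < n)%N else true) -> 0 <= p ->
  (p%:E < decay C0 gam sigma)%E ->
  exists2 C : R, 0 <= C & forall j, g j <= C * j.+1%:R `^ (- p).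
Proof.
move=> sig0 p0.
have act j : 0 < g j -> active gam sigma [fset j]%fset.
  move=> gj; split; [|by rewrite POD_singleton|by case: sigma sig0 => // n; rewrite cardfs1].
  by apply/eqP => /fsetP/(_ j); rewrite !inE eqxx.
have gle i j : (i <= j)%N -> g j <= g i.
  move=> ij; apply: (@homo_leq _ g (fun x y => y <= x)) ij => //.
  by move=> x y z yx zy; exact: le_trans zy yx.
rewrite /decay; case: asboolP => [fin _|inf].
  (* With finitely many active sets [g] vanishes from some [j0] on, and the factor [j0.+1 ^ p]
     covers the earlier indices. *)
  have [j0 gj0] : exists j, g j = 0.
    apply: contrapT => /forallNP H.
    apply: (@injective_infinite_set _ _ (fun j : nat => [fset j]%fset) _ _ fin).
      by move=> i j /fsetP/(_ i); rewrite !inE eqxx => /esym/eqP.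
    by move=> j; apply: act; rewrite lt_def g0 andbT; apply/eqP/H.
  exists (g 0%N * j0.+1%:R `^ p) => [|j]; first by rewrite mulr_ge0 ?powR_ge0.
  have [jj0|jj0] := leqP j0 j.
    have -> : g j = 0 by apply/eqP; rewrite eq_le g0 -gj0 gle.
    by rewrite !mulr_ge0 ?powR_ge0.
  rewrite -mulrA; apply: le_trans (gle _ _ (leq0n j)) _; rewrite ler_peMr//.
  rewrite powRN ler_pdivlMr ?powR_gt0 ?ltr0n// mul1r.
  by rewrite ge0_ler_powR ?nnegrE ?ler_nat// ltnW.
move=> /ereal_sup_gt[_ [p' [e [ebij eanti ecvg]] <-]]; rewrite lte_fin => pp'.
have [B B0 HB] : exists2 B, 0 <= B & forall i, scaled C0 gam (e i) * i.+1%:R `^ p' <= B.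
  have /cvg_seq_bounded[B [_ HB]] : cvgn (fun i => scaled C0 gam (e i) * i.+1%:R `^ p').
    by apply/cvg_ex; exists 0.
  exists (`|B| + 1); first by rewrite addr_ge0.
  move=> i; apply: le_trans (HB _ _ i I); first exact: ler_norm.
  by rewrite (le_lt_trans (ler_norm _))// ltrDl.
exists (B / C0) => [|j]; first by rewrite divr_ge0 ?(ltW C00).
have [->|gj] := eqVneq (g j) 0; first by rewrite mulr_ge0 ?powR_ge0 ?divr_ge0 ?(ltW C00).
have gj0 : 0 < g j by rewrite lt_def gj g0.
have [_ _ esurj] := ebij.
have /choice[pos posP] : forall k, exists i, (k <= j)%N -> e i = [fset k]%fset.
  move=> k; have [kj|] := leqP k j; last by exists 0%N.
  have [|i _ <-] := esurj [fset k]%fset; last by exists i.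
  by apply: act; rewrite (lt_le_trans gj0)// gle.
have [k [kj jk]] : exists k, (k <= j)%N /\ (j <= pos k)%N.
  apply: contrapT => /forallNP H.
  have : uniq (map pos (iota 0 j.+1)).
    rewrite map_inj_in_uniq ?iota_uniq// => x y.
    rewrite !mem_iota /= !add0n !ltnS => xj yj xy.
    have : [fset x]%fset = [fset y]%fset :> {fset nat} by rewrite -!posP// xy.
    by move=> /fsetP/(_ x); rewrite !inE eqxx => /esym/eqP.
  move=> /uniq_leq_size => /(_ (iota 0 j)); rewrite size_map !size_iota ltnn => W.
  suff : false by [].
  apply: W => _ /mapP[k + ->]; rewrite !mem_iota /= !add0n ltnS => kj.
  by rewrite ltnNge; apply/negP => jk; apply: (H k).
have : C0 * g k <= B * (pos k).+1%:R `^ (- p').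
  rewrite powRN ler_pdivlMr ?powR_gt0 ?ltr0n//; apply: le_trans (HB (pos k)).
  by rewrite posP// /scaled POD_singleton cardfs1 expr1 [g k * _]mulrC.
move=> H; rewrite mulrAC ler_pdivlMr// mulrC.
apply: (@le_trans _ _ (C0 * g k)); first by rewrite ler_pM2l ?gle.
apply: (le_trans H); rewrite ler_wpM2l// !powRN lef_pV2 ?posrE ?powR_gt0 ?ltr0n//.
apply: (@le_trans _ _ (j.+1%:R `^ p')); first by rewrite ler_powR ?ler1n// ltW.
by rewrite ge0_ler_powR ?nnegrE ?ler_nat// (le_trans p0)// ltW.
Qed.

(** The powers [1 / r] of the scaled weights are summable because [p / r > 1]. In non-increasing
    order this forces the i-th weight to be [O(i ^ (- r))], and [p' < r] makes the limit 0. *)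
Lemma power_bound_le_decay (q Cq Cg p r p' : R) :
  (forall k, 0 <= Gam k) -> (forall k, (1 <= k)%N -> Gam k <= Cq * k`!%:R `^ q) ->
  0 <= Cq -> 0 <= Cg -> (forall j, g j <= Cg * j.+1%:R `^ (- p)) ->
  q < p -> 0 < r -> r < p -> p' < r -> (p'%:E <= decay C0 gam None)%E.
Proof.
move=> Gam0 GamC Cq0 Cg0 gC qp r0 rp p'r.
rewrite /decay; case: asboolP => [fin|inf]; first by rewrite leey.
have pr1 : 1 < p * r^-1 by rewrite ltr_pdivlMr ?mul1r.
have ri0 : 0 < r^-1 by rewrite invr_gt0.
have [C C_0 CP] := POD_sum_bound Gam0 GamC g0 gC Cq0 Cg0 ri0 qp pr1 (powR_ge0 C0 r^-1).
have [Z Z0 ZP] := sum_powR_tail pr1.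
pose h := scaled C0 gam.
have POD0 u : 0 <= POD Gam g u by rewrite mulr_ge0 ?prodr_ge0.
have h0 u : 0 <= h u by rewrite mulr_ge0 ?exprn_ge0 ?(ltW C00)//; exact: POD0.
pose B := h fset0 `^ r^-1 + C * Z.
have hsum s : uniq s -> \sum_(u <- s) h u `^ r^-1 <= B.
  move=> us; have [N sN] := subset_fpowerset_first_coords s.
  apply: le_trans (ler_sum_subset us (fset_uniq _) sN (fun u => powR_ge0 _ _)) _.
  rewrite big_fpowerset_max /= lerD2l.
  apply: (@le_trans _ _ (\sum_(l < N) C * l.+1%:R `^ (- (p * r^-1)))).
    apply: ler_sum => l _; apply: le_trans (CP l); apply: ler_sum => u _.
    by rewrite /h /scaled powRM ?exprn_ge0 ?(ltW C00) ?POD0// powR_expn_swap ?(ltW C00).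
  rewrite -mulr_sumr ler_wpM2l//.
  by have := ZP 0%N N; rewrite powR1 mulr1 big_mkord.
have B0 : 0 <= B by have := hsum [::] isT; rewrite big_nil.
have hpos u : active gam None u -> 0 < h u.
  by move=> [_ gu _]; rewrite /h /scaled mulr_gt0 ?exprn_gt0.
(* More than [B / d ^ (1 / r)] sets of scaled weight at least [d] would push the sum above [B]. *)
have hfin d : 0 < d -> finite_set [set u | active gam None u /\ d <= h u].
  move=> d0; apply: contrapT => /infinite_set_fset H.
  have dr0 : 0 < d `^ r^-1 by rewrite powR_gt0.
  have [F FA nF] := H (Num.bound (B / d `^ r^-1)).
  have := hsum F (fset_uniq F); rewrite leNgt => /negP; apply.
  apply: (@lt_le_trans _ _ (\sum_(u <- F) d `^ r^-1)).
    rewrite big_const_seq count_predT iter_addr_0 -[_ *+ _]mulr_natl -ltr_pdivrMr//.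
    apply: lt_le_trans (archi_boundP _) _; first by rewrite divr_ge0 ?powR_ge0.
    by rewrite ler_nat.
  rewrite big_seq [leRHS]big_seq; apply: ler_sum => u uF.
  have [_ du] := FA u uF.
  by rewrite ge0_ler_powR ?nnegrE ?(ltW ri0) ?(ltW d0).
have [e [ebij eanti]] := sorted_enumeration inf hpos hfin.
apply: ereal_sup_ubound; exists p' => //; exists e; split => //.
have ebnd i : h (e i) <= B `^ r * i.+1%:R `^ (- r).
  have : i.+1%:R * h (e i) `^ r^-1 <= B.
    have [_ einj _] := ebij.
    apply: le_trans (hsum (map e (iota 0 i.+1)) _); last first.
      by rewrite map_inj_uniq ?iota_uniq// => x y; apply: einj; rewrite inE.
    rewrite big_map; apply: (@le_trans _ _ (\sum_(j <- iota 0 i.+1) h (e i) `^ r^-1)).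
      by rewrite big_const_seq count_predT size_iota iter_addr_0 mulr_natl.
    rewrite big_seq [leRHS]big_seq; apply: ler_sum => j; rewrite mem_iota => /andP[_ ji].
    by rewrite ge0_ler_powR ?nnegrE ?(ltW ri0)//; apply: eanti.
  rewrite mulrC -ler_pdivlMr ?ltr0n// => H.
  have -> : h (e i) = (h (e i) `^ r^-1) `^ r.
    by rewrite -powRrM mulVf ?gt_eqF// powRr1.
  have -> : B `^ r * i.+1%:R `^ (- r) = (B / i.+1%:R) `^ r.
    by rewrite powRM ?invr_ge0// -powR_inv1// -powRrM mulN1r.
  by rewrite ge0_ler_powR ?(ltW r0) ?nnegrE ?powR_ge0 ?divr_ge0.
apply: (@squeeze_cvgr _ _ _ _ (fun=> 0) (fun i => B `^ r * i.+1%:R `^ (- (r - p')))).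
- near=> i; rewrite mulr_ge0 ?powR_ge0 ?h0//=.
  rewrite opprB addrC powRD ?pnatr_eq0 ?implybT// mulrA ler_wpM2r ?powR_ge0//.
- exact: cvg_cst.
- rewrite -[X in _ --> X](mulr0 (B `^ r)); apply: cvgM; first exact: cvg_cst.
  by apply: cvg_powR_infty; rewrite subr_gt0.
Unshelve. all: by end_near. Qed.

End Decay.

(** * Reproducing kernel Hilbert spaces *)

Section RKHS.
Context {R : realType} {T : choiceType} {X : set T} {K : T -> T -> R}.
Variable H : rkhs X K.
Implicit Types (f g h : H) (s : seq (R * T)).


Lemma rk_dot0l h : rk_dot (0 : H) h = 0.
Proof.
have := rk_dotP 1 (0 : H) 0 h; rewrite scaler0 addr0 mul1r.
by move=> /eqP; rewrite -subr_eq0 opprD addNKr oppr_eq0 => /eqP.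
Qed.

Lemma rk_dotDl f g h : rk_dot (f + g) h = rk_dot f h + rk_dot g h.
Proof. by have := rk_dotP 1 f g h; rewrite scale1r mul1r. Qed.

Lemma rk_dotZl a f h : rk_dot (a *: f) h = a * rk_dot f h.
Proof. by have := rk_dotP a f 0 h; rewrite addr0 rk_dot0l addr0. Qed.

Lemma rk_dotDr f g h : rk_dot f (g + h) = rk_dot f g + rk_dot f h.
Proof. by rewrite rk_dotC rk_dotDl ![rk_dot _ f]rk_dotC. Qed.

Lemma rk_dotZr a f h : rk_dot f (a *: h) = a * rk_dot f h.
Proof. by rewrite rk_dotC rk_dotZl rk_dotC. Qed.

Lemma rk_dotBl f g h : rk_dot (f - g) h = rk_dot f h - rk_dot g h.
Proof. by rewrite rk_dotDl -scaleN1r rk_dotZl mulN1r. Qed.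

Lemma rk_sqnormBZ f g (t : R) :
  `|f - t *: g| ^+ 2 = `|f| ^+ 2 - 2 * t * rk_dot f g + t ^+ 2 * `|g| ^+ 2.
Proof.
rewrite !rk_norm -scaleNr rk_dotDl !rk_dotDr !rk_dotZl !rk_dotZr [rk_dot g f]rk_dotC.
by ring.
Qed.

(* The optimal [t] in [|f - t g|^2 >= |f|^2 - eps^2]. *)
Lemma rk_dot_near_minimizer f g (eps : R) : 0 <= eps ->
  (forall t : R, `|f| ^+ 2 - eps ^+ 2 <= `|f - t *: g| ^+ 2) ->
  `|rk_dot f g| <= eps * `|g|.
Proof.
move=> e0 Hmin; have [g0|g0] := eqVneq g 0.
  by rewrite g0 rk_dotC rk_dot0l !normr0 mulr0.
have ng : 0 < `|g| by rewrite normr_gt0.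
rewrite -(@ler_pXn2r _ 2) ?nnegrE ?mulr_ge0//.
have := Hmin (rk_dot f g / `|g| ^+ 2); rewrite rk_sqnormBZ.
have -> : `|f| ^+ 2 - 2 * (rk_dot f g / `|g| ^+ 2) * rk_dot f g +
   (rk_dot f g / `|g| ^+ 2) ^+ 2 * `|g| ^+ 2 = `|f| ^+ 2 - rk_dot f g ^+ 2 / `|g| ^+ 2.
  by field; rewrite gt_eqF.
rewrite lerD2l lerN2 ler_pdivrMr ?exprn_gt0// -exprMn.
by rewrite real_normK ?num_real.
Qed.

(** For [eps = |f|] the near-minimality is vacuous: it reads [0 <= |f - t g| ^ 2]. *)
Lemma rk_cauchy_schwarz f g : `|rk_dot f g| <= `|f| * `|g|.
Proof.
apply: rk_dot_near_minimizer => // t; rewrite subrr; exact: exprn_ge0.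
Qed.

Lemma rk_funP a f g x : X x -> rk_fun (a *: f + g) x = a * rk_fun f x + rk_fun g x.
Proof. by move=> Xx; rewrite !rk_repro// rk_dotP. Qed.

Lemma rk_funB f g x : X x -> rk_fun (f - g) x = rk_fun f x - rk_fun g x.
Proof. by move=> Xx; rewrite !rk_repro// rk_dotBl. Qed.

Lemma rk_funZ a f x : X x -> rk_fun (a *: f) x = a * rk_fun f x.
Proof. by move=> Xx; rewrite !rk_repro// rk_dotZl. Qed.

Lemma rk_section_dot x y : X x -> X y ->
  rk_dot (rk_section H x) (rk_section H y) = K y x.
Proof. by move=> Xx Xy; rewrite -rk_repro// rk_sectionE. Qed.

Lemma rk_section_norm x : X x -> `|rk_section H x| ^+ 2 = K x x.
Proof. by move=> Xx; rewrite rk_norm rk_section_dot. Qed.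

Lemma rk_kernel_ge0 x : X x -> 0 <= K x x.
Proof. by move=> Xx; rewrite -rk_section_norm// exprn_ge0. Qed.

Lemma rk_fun_bound f x : X x -> `|rk_fun f x| <= `|f| * Num.sqrt (K x x).
Proof.
move=> Xx; rewrite rk_repro//; apply: le_trans (rk_cauchy_schwarz _ _) _.
by rewrite ler_wpM2l// -rk_section_norm// sqrtr_sqr normr_id.
Qed.

Lemma rk_kernel_bound x y : X x -> X y ->
  `|K x y| <= Num.sqrt (K x x) * Num.sqrt (K y y).
Proof.
move=> Xx Xy; rewrite -rk_section_dot//; apply: le_trans (rk_cauchy_schwarz _ _) _.
by rewrite -!rk_section_norm// !sqrtr_sqr !normr_id mulrC.
Qed.

(** The list is kept apart from the space, so that one and the same [s] names an element of every
    [H u] and of the weighted space. *)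
Definition section_comb s : H := \sum_(q <- s) q.1 *: rk_section H q.2.

Lemma rk_fun_sum s (F : R * T -> H) y : X y ->
  rk_fun (\sum_(q <- s) F q) y = \sum_(q <- s) rk_fun (F q) y.
Proof.
move=> Xy; elim: s => [|q s IHs]; first by rewrite !big_nil rk_repro// rk_dot0l.
by rewrite !big_cons -[F q]scale1r rk_funP// IHs mul1r scale1r.
Qed.

Lemma section_comb_fun s y : (forall q, q \in s -> X q.2) -> X y ->
  rk_fun (section_comb s) y = \sum_(q <- s) q.1 * K y q.2.
Proof.
move=> sX Xy; rewrite rk_fun_sum// big_seq [RHS]big_seq.
by apply: eq_bigr => q /sX Xq; rewrite rk_funZ// rk_sectionE.
Qed.

Lemma rk_dot_sumr f s (F : R * T -> H) :
  rk_dot f (\sum_(q <- s) F q) = \sum_(q <- s) rk_dot f (F q).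
Proof.
elim: s => [|q s IHs]; first by rewrite !big_nil rk_dotC rk_dot0l.
by rewrite !big_cons rk_dotDr IHs.
Qed.

Lemma section_comb_norm s : (forall q, q \in s -> X q.2) ->
  `|section_comb s| ^+ 2 =
  \sum_(q <- s) q.1 * \sum_(q' <- s) q'.1 * K q.2 q'.2.
Proof.
move=> sX; rewrite rk_norm [X in rk_dot _ X]/section_comb rk_dot_sumr.
rewrite big_seq [RHS]big_seq; apply: eq_bigr => q /sX Xq.
by rewrite rk_dotZr -rk_repro// section_comb_fun.
Qed.

(* A near-minimiser of the distance of [f] to the span of the sections: a
   minimiser would require completeness. *)
Lemma section_comb_approx f (eps : R) : 0 < eps ->
  exists s, [/\ forall q, q \in s -> X q.2,
    `|section_comb s| <= `|f| + eps &
    forall x, X x ->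
      `|rk_fun f x - rk_fun (section_comb s) x| <= eps * Num.sqrt (K x x)].
Proof.
move=> e0.
pose E := [set `|f - section_comb s| ^+ 2 | s in [set s : seq (R * T) | forall q, q \in s -> X q.2]].
have Einf : has_inf E.
  split; first by exists (`|f - section_comb [::]| ^+ 2), [::].
  by exists 0 => _ [s _ <-]; rewrite exprn_ge0.
have [_ [s sX <-] sE] := inf_adherent (exprn_gt0 2 e0 : 0 < eps ^+ 2) Einf.
(* Appending a multiple of [s'] to [s] gives another competitor, so the residual is nearly
   orthogonal to every combination. Applied to a single section this is the pointwise estimate,
   applied to [s] itself the norm bound. *)
have near s' : (forall q, q \in s' -> X q.2) ->
    `|rk_dot (f - section_comb s) (section_comb s')| <= eps * `|section_comb s'|.
  move=> s'X; apply: rk_dot_near_minimizer; first exact: ltW.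
  move=> t; rewrite lerBlDr; apply: (le_trans (ltW sE)); rewrite lerD2r.
  apply: (ge_inf Einf.2); exists (s ++ [seq (t * q.1, q.2) | q <- s']).
    by move=> q; rewrite mem_cat => /orP[/sX//|/mapP[q' /s'X + ->]].
  congr (`|_| ^+ 2); rewrite /section_comb big_cat big_map /= opprD addrA.
  congr (_ - _); rewrite scaler_sumr; apply: eq_bigr => q _.
  by rewrite scalerA.
exists s; split => // [|x Xx].
  have [->|c0] := eqVneq (section_comb s) 0; first by rewrite normr0 addr_ge0 ?(ltW e0).
  have nc : 0 < `|section_comb s| by rewrite normr_gt0.
  rewrite -(ler_pM2r nc) -expr2 rk_norm mulrDl.
  have -> : rk_dot (section_comb s) (section_comb s) =
     rk_dot f (section_comb s) - rk_dot (f - section_comb s) (section_comb s).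
    by rewrite rk_dotBl; ring.
  apply: le_trans (ler_norm _) _; apply: le_trans (ler_normB _ _) _.
  by rewrite lerD ?near// rk_cauchy_schwarz.
have := near [:: (1, x)]; rewrite /section_comb big_seq1 scale1r -/(section_comb s).
rewrite -rk_repro// rk_funB// -rk_section_norm// sqrtr_sqr normr_id; apply.
by move=> q; rewrite inE => /eqP ->.
Qed.

End RKHS.

(** * Product measures *)

Section ProductMeasure.
Context {R : realType} {J : choiceType}.
Local Notation PS := (prod_space R J).
Local Notation RR := (measurableTypeR R).
Local Open Scope ereal_scope.

Lemma measurable_cylinder (j : J) (B : set RR) :
  measurable B -> measurable ([set x | B (x j)] : set PS).
Proof. by move=> mB; apply: sub_gen_smallest; exists j, B. Qed.

Lemma measurable_coord (j : J) : measurable_fun [set: PS] (fun x : PS => x j : RR).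
Proof. by move=> _ B mB; rewrite setTI; exact: measurable_cylinder. Qed.

Lemma measurable_fun_to_prod d (T : measurableType d) (f : T -> PS) :
  (forall j, measurable_fun setT (fun t => f t j : RR)) -> measurable_fun setT f.
Proof.
move=> mf; apply: (@measurability _ _ T PS setT f (@cylinders R J)) => //.
move=> _ [_ [j [B [mB ->]]] <-]; exact: (mf j measurableT B mB).
Qed.

Definition boxes : set (set PS) := [set A | exists (s : {fset J}) (B : J -> set RR),
  (forall j, measurable (B j)) /\ A = [set x : PS | forall j, j \in s -> B j (x j)]].

Lemma boxes_setI : setI_closed boxes.
Proof.
move=> _ _ [s1 [B1 [mB1 ->]]] [s2 [B2 [mB2 ->]]].
exists (s1 `|` s2)%fset, (fun j => (if j \in s1 then B1 j else setT) `&`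
  (if j \in s2 then B2 j else setT)); split.
  by move=> j; apply: measurableI; case: ifP.
apply/seteqP; split => x /=.
  move=> [H1 H2] j; rewrite inE => /orP[] js; rewrite js; case: ifP => js'; split=> //;
  by [exact: H1|exact: H2].
move=> H; split => j js; have := H j; rewrite inE js ?orbT => /(_ isT) [];
by rewrite ?js.
Qed.

Lemma measurable_box (s : {fset J}) (B : J -> set RR) :
  (forall j, measurable (B j)) ->
  measurable ([set x : PS | forall j, j \in s -> B j (x j)]).
Proof.
move=> mB; rewrite (_ : [set x : PS | _] = \bigcap_(j in [set` s]) [set x : PS | B j (x j)]).
  apply: fin_bigcap_measurable; first exact: finite_fset.
  by move=> j _; exact: measurable_cylinder.
by apply/seteqP; split.
Qed.

Lemma measurable_boxesE : (measurable : set (set PS)) = <<s boxes >>.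
Proof.
apply/seteqP; split.
  apply: smallest_sub; first exact: smallest_sigma_algebra.
  move=> _ [j [B [mB ->]]]; apply: sub_gen_smallest.
  exists [fset j]%fset, (fun=> B); split => //; apply/seteqP; split => x /=.
    by move=> Bx k; rewrite inE => /eqP ->.
  by apply; rewrite inE.
apply: smallest_sub; first exact: sigma_algebra_measurable.
by move=> _ [s [B [mB ->]]]; exact: measurable_box.
Qed.

Variable rho : probability RR R.

Lemma product_measure_eq (m1 m2 : measure PS R) :
  (forall (s : {fset J}) (B : J -> set RR), (forall j, measurable (B j)) ->
     m1 [set x : PS | forall j, j \in s -> B j (x j)] =
     \prod_(j <- s) rho (B j)) ->
  (forall (s : {fset J}) (B : J -> set RR), (forall j, measurable (B j)) ->
     m2 [set x : PS | forall j, j \in s -> B j (x j)] =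
     \prod_(j <- s) rho (B j)) ->
  forall A, measurable A -> m1 A = m2 A.
Proof.
move=> H1 H2; apply: (@measure_unique _ _ _ boxes (fun=> setT)).
- exact: measurable_boxesE.
- exact: boxes_setI.
- by move=> n; exists fset0, (fun=> setT); split => //; apply/seteqP; split.
- by rewrite bigcup_const//; exists 0%N.
- by move=> _ [s [B [mB ->]]]; rewrite H1// H2.
move=> _; have := H1 fset0 (fun=> setT) (fun=> measurableT); rewrite big_seq_fset0.
rewrite (_ : [set x | _] = setT) => [->|]; first by rewrite ltry.
by apply/seteqP; split.
Qed.

Definition upd (j : J) (z : RR * PS) : PS := fun k => if k == j then z.1 else z.2 k.

Lemma measurable_upd j : measurable_fun setT (upd j).
Proof.
apply: measurable_fun_to_prod => k; rewrite /upd; have [kj|kj] := eqVneq k j.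
  exact: measurable_fst.
by apply: (measurableT_comp (measurable_coord k)); exact: measurable_snd.
Qed.

Variable m : probability PS R.
Hypothesis hm : is_product_measure rho m.

(** Drawing the coordinate [j] afresh leaves the law unchanged, since the two measures agree on
    boxes. This serves as Fubini's theorem for one coordinate, without splitting the index set. *)
Lemma resampling (j : J) (F : PS -> \bar R) : measurable_fun setT F ->
  (forall x, 0 <= F x) ->
  \int[m]_x F x = \int[m]_x \int[rho]_r F (upd j (r, x)).
Proof.
move=> mF F0.
have mu := measurable_upd j.
transitivity (\int[pushforward (rho \x m) (upd j)]_x F x).
  apply: eq_measure_integral => A mA _; apply/esym.
  apply: (product_measure_eq _ _ mA); last exact: hm.
  move=> s B mB.
  transitivity ((rho \x m) (upd j @^-1` [set x | forall k, k \in s -> B k (x k)])) => //.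
  have -> : upd j @^-1` [set x | forall k, k \in s -> B k (x k)] =
      (if j \in s then B j else setT) `*` [set x : PS | forall k, k \in (s `\ j)%fset -> B k (x k)].
    apply/seteqP; split => -[r x] /=; rewrite /upd /=.
      move=> H; split; first by case: ifPn => // js; have := H j js; rewrite eqxx.
      by move=> k; rewrite !inE => /andP[/negbTE kj ks]; have := H k ks; rewrite kj.
    move=> [Br H] k ks; have [kj|kj] := eqVneq k j; first by move: Br; rewrite -kj ks.
    by apply: H; rewrite !inE kj.
  rewrite product_measure1E//; [|by case: ifP|exact: measurable_box].
  transitivity (rho (if j \in s then B j else setT) * \prod_(k <- (s `\ j)%fset) rho (B k)).
    by congr (_ * _); exact: hm.
  case: ifPn => js.
    by rewrite [RHS](big_fsetD1 j).
  rewrite (_ : rho setT = 1) ?mul1e; last exact: probability_setT.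
  suff -> : (s `\ j)%fset = s by [].
  by apply/fsetP => k; rewrite !inE; case: eqP => // ->; rewrite (negbTE js).
rewrite (ge0_integral_pushforward mu)//.
rewrite preimage_setT fubini_tonelli2//=.
exact: measurableT_comp.
Qed.

Lemma integral_prod (s : seq J) (h : J -> RR -> R) : uniq s ->
  (forall j, measurable_fun setT (h j)) -> (forall j t, (0 <= h j t)%R) ->
  \int[m]_x (\prod_(j <- s) h j (x j))%:E = \prod_(j <- s) \int[rho]_t (h j t)%:E.
Proof.
move=> + mh h0; elim: s => [_|j s IHs /= /andP[js us]].
  under eq_integral do rewrite big_nil.
  by rewrite big_nil integral_cst// mul1e; exact: probability_setT.
have mP l : measurable_fun setT (fun x : PS => (\prod_(j <- l) h j (x j))%:E).
  apply/measurable_EFinP; apply: measurable_prod => k _.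
  exact: (measurableT_comp (mh k) (measurable_coord k)).
have P0 l x : (0 <= \prod_(j <- l) h j (x j))%R by exact: prodr_ge0.
rewrite (resampling j)//; last by move=> x; rewrite lee_fin.
rewrite big_cons -IHs//.
under eq_integral => x _.
  under eq_integral => r _.
    rewrite big_cons {1}/upd eqxx /=.
    rewrite (_ : (\prod_(k <- s) h k (upd j (r, x) k) = \prod_(k <- s) h k (x k))%R); last first.
      rewrite big_seq [RHS]big_seq; apply: eq_bigr => k ks.
      by rewrite /upd; case: eqP ks => // ->; rewrite (negbTE js).
    rewrite EFinM muleC.
    over.
  rewrite /= ge0_integralZl//; last 3 first.
  - exact/measurable_EFinP.
  - by move=> t _; rewrite lee_fin.
  - by rewrite lee_fin.
  over.
rewrite /= ge0_integralZr//; last first.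
- by apply: integral_ge0 => t _; rewrite lee_fin.
- by move=> x _; rewrite lee_fin.
by rewrite muleC.
Qed.

End ProductMeasure.

(** * Sums over all finite sets as limits *)

Section EsumFpowerset.
Context {R : realType}.
Local Open Scope ereal_scope.
Implicit Types a : {fset nat} -> \bar R.

Lemma lee_sum_subset a (s t : seq {fset nat}) : uniq s -> uniq t ->
  {subset s <= t} -> (forall u, 0 <= a u) -> \sum_(u <- s) a u <= \sum_(u <- t) a u.
Proof.
move=> us ut st a0; rewrite [leRHS](bigID (mem s)) /= -[X in _ <= X + _]big_filter.
rewrite (perm_big [seq x <- t | x \in s]) /=; first by rewrite leeDl// sume_ge0.
apply: uniq_perm; rewrite ?filter_uniq// => x; rewrite mem_filter.
by have [/st ->|//] := boolP (x \in s).
Qed.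

Lemma nondecreasing_sum_fpowerset a : (forall u, 0 <= a u) ->
  nondecreasing_seq (fun N => \sum_(u <- fpowerset (first_coords N)) a u).
Proof.
move=> a0 m n mn; apply: lee_sum_subset; rewrite ?fset_uniq// => u.
by rewrite !fpowersetE => /fsubset_trans; apply; exact: first_coords_sub.
Qed.

(** Every finite family of sets is eventually contained in the power set of [{0, ..., N - 1}]. Sums
    over all sets are handled along this sequence, so that identities and bounds for finite sums
    pass to the limit. *)
Lemma esum_fpowerset_cvg a : (forall u, 0 <= a u) ->
  (fun N => \sum_(u <- fpowerset (first_coords N)) a u) @ \oo -->
  \esum_(u in [set: {fset nat}]) a u.
Proof.
move=> a0.
suff -> : \esum_(u in [set: {fset nat}]) a u =
    ereal_sup (range (fun N => \sum_(u <- fpowerset (first_coords N)) a u)).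
  exact/ereal_nondecreasing_cvgn/nondecreasing_sum_fpowerset.
apply/eqP; rewrite eq_le; apply/andP; split.
  apply: ge_ereal_sup => _ [A [finA _] <-].
  rewrite fsbig_finite//=; have [N AN] := subset_fpowerset_first_coords (fset_set A).
  apply: le_trans (lee_sum_subset _ (fset_uniq _) AN a0) _; first exact: fset_uniq.
  by apply: ereal_sup_ubound; exists N.
apply: ge_ereal_sup => _ [N _ <-].
apply: ereal_sup_ubound; exists [set` fpowerset (first_coords N)].
  by split => //; exact: finite_fset.
by rewrite fsbig_finite//= set_fsetK.
Qed.

Lemma real_sum_cvg (S : set {fset nat}) (f : {fset nat} -> R) :
  (forall u, ~ S u -> f u = 0%R) ->
  \esum_(u in S) `|f u|%:E < +oo ->
  (fun N => (\sum_(u <- fpowerset (first_coords N)) f u)%R) @ \oo --> real_sum S f.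
Proof.
move=> Sf fin.
pose fp u := Num.max (f u) 0%R; pose fm u := Num.max (- f u)%R 0%R.
have fp0 u : (0 <= fp u)%R by rewrite le_max lexx orbT.
have fm0 u : (0 <= fm u)%R by rewrite le_max lexx orbT.
have esumE (h : {fset nat} -> R) : (forall u, ~ S u -> h u = 0%R) ->
    \esum_(u in S) (h u)%:E = \esum_(u in [set: {fset nat}]) (h u)%:E.
  move=> h0; rewrite esum_mkcond; apply: eq_esum => u _.
  by case: ifPn => //; rewrite notin_setE => /h0 ->.
have finp (h : {fset nat} -> R) : (forall u, (0 <= h u <= `|f u|)%R) ->
    exists2 r : R, \esum_(u in [set: {fset nat}]) (h u)%:E = r%:E &
    (fun N => (\sum_(u <- fpowerset (first_coords N)) h u)%R) @ \oo --> r.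
  move=> h0.
  have hS u : ~ S u -> h u = 0%R.
    move=> /Sf fu; have := h0 u; rewrite fu normr0 => H.
    by apply/eqP; rewrite eq_le andbC.
  have hfin : \esum_(u in [set: {fset nat}]) (h u)%:E \is a fin_num.
    rewrite ge0_fin_numE; last by apply: esum_ge0 => u _; rewrite lee_fin; case/andP: (h0 u).
    rewrite -esumE//; apply: le_lt_trans fin; apply: le_esum => u _.
    by rewrite lee_fin; case/andP: (h0 u).
  exists (fine (\esum_(u in [set: {fset nat}]) (h u)%:E)); first by rewrite fineK.
  have hE u : 0 <= (h u)%:E by rewrite lee_fin; case/andP: (h0 u).
  have := esum_fpowerset_cvg hE.
  set l := esum _ _ in hfin *; rewrite -(fineK hfin) => /fine_cvgP[_] /=.
  rewrite (_ : fine \o _ = fun N => (\sum_(u <- fpowerset (first_coords N)) h u)%R)//.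
  by apply/funext => N /=; rewrite sumEFin.
have [r1 E1 C1] : exists2 r : R, \esum_(u in [set: {fset nat}]) (fp u)%:E = r%:E &
    (fun N => (\sum_(u <- fpowerset (first_coords N)) fp u)%R) @ \oo --> r.
  by apply: finp => u; rewrite fp0 /fp ge_max normr_ge0 ler_norm.
have [r2 E2 C2] : exists2 r : R, \esum_(u in [set: {fset nat}]) (fm u)%:E = r%:E &
    (fun N => (\sum_(u <- fpowerset (first_coords N)) fm u)%R) @ \oo --> r.
  by apply: finp => u; rewrite fm0 /fm ge_max normr_ge0 -normrN ler_norm.
have -> : real_sum S f = (r1 - r2)%R.
  rewrite /real_sum !esumE ?E1 ?E2//.
    by move=> u /Sf fu; rewrite /fm fu oppr0 maxxx.
  by move=> u /Sf fu; rewrite /fp fu maxxx.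
have -> : (fun N => (\sum_(u <- fpowerset (first_coords N)) f u)%R) =
    (fun N => \sum_(u <- fpowerset (first_coords N)) fp u -
              \sum_(u <- fpowerset (first_coords N)) fm u)%R.
  apply/funext => N; rewrite -sumrB; apply: eq_bigr => u _.
  rewrite /fp /fm; have [h|h] := leP 0%R (f u).
    by rewrite (max_idPr _) ?oppr_le0// subr0.
  by rewrite (max_idPl _) ?oppr_ge0 ?ltW// sub0r opprK.
exact: cvgB.
Unshelve. all: by end_near. Qed.

End EsumFpowerset.

(** * Kernels that vanish at the anchor *)

Section AnchoredKernel.
Context {R : realType}.
Local Notation RR := (measurableTypeR R).
Variables (D : set RR) (K : R -> R -> R) (c : R).
Hypotheses (hD : measurable D) (hK : anchored_kernel D K c).
Variable H : forall u : {fset nat}, rkhs (inftuples D) (tensor_kernel K u).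

Let Dc : D c. Proof. by case: hK => _ _ _ _ []. Qed.

(** Through the singleton [{0}] the kernel [K] inherits the Hilbert space inequalities that hold for
    the spaces [H u]. *)
Lemma tensor_kernel_const x y : tensor_kernel K [fset 0%N]%fset (fun=> x) (fun=> y) = K x y.
Proof. by rewrite /tensor_kernel big_seq_fset1. Qed.

Lemma kernel_diag_ge0 t : D t -> 0 <= K t t.
Proof.
move=> Dt; rewrite -tensor_kernel_const.
exact: (rk_kernel_ge0 (H [fset 0%N]%fset)).
Qed.

(** Cauchy-Schwarz with [K c c = 0]. It makes elements of [H u] vanish wherever a coordinate in [u]
    equals [c]. *)
Lemma kernel_anchor y : D y -> K c y = 0.
Proof.
move=> Dy; apply/eqP; rewrite -normr_le0 -tensor_kernel_const.
apply: (le_trans (rk_kernel_bound (H [fset 0%N]%fset) _ _)) => //.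
by rewrite !tensor_kernel_const; case: hK => _ _ _ _ [_ ->]; rewrite sqrtr0 mul0r.
Qed.

(** Extension by 0 outside [D] gives functions measurable on the whole line, so that integrals can
    run over the full product space. *)
Definition ksec (y : R) : RR -> R := (fun t => K t y) \_ D.
Definition kdiag : RR -> R := (fun t => K t t) \_ D.

Lemma ksecE y t : D t -> ksec y t = K t y.
Proof. by move=> Dt; rewrite /ksec patchE mem_set. Qed.

Lemma kdiagE t : D t -> kdiag t = K t t.
Proof. by move=> Dt; rewrite /kdiag patchE mem_set. Qed.

Lemma ksec_out y t : ~ D t -> ksec y t = 0.
Proof. by move=> Dt; rewrite /ksec patchE memNset. Qed.

Lemma kdiag_ge0 t : 0 <= kdiag t.
Proof. by rewrite /kdiag patchE; case: ifPn => // /set_mem; exact: kernel_diag_ge0. Qed.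

Let measurable_K : measurable_fun (D `*` D : set (RR * RR)) (fun z => K z.1 z.2).
Proof. by case: hK. Qed.

Lemma measurable_ksec y : D y -> measurable_fun setT (ksec y).
Proof.
move=> Dy; apply/(measurable_restrictT _ hD).
apply: (@measurable_comp _ _ _ _ _ _ (D `*` D) (fun z : RR * RR => K z.1 z.2) _
  (fun t => (t, y))) => //.
- exact: measurableX.
- by move=> _ [t Dt <-].
by apply: measurable_funTS; exact: pair2_measurable.
Qed.

Lemma measurable_kdiag : measurable_fun setT kdiag.
Proof.
apply/(measurable_restrictT _ hD).
apply: (@measurable_comp _ _ _ _ _ _ (D `*` D) (fun z : RR * RR => K z.1 z.2) _
  (fun t => (t, t))) => //.
- exact: measurableX.
- by move=> _ [t Dt <-].
by apply: measurable_funTS; exact: measurable_fun_pair.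
Qed.

Lemma tensor_kernel_diag u x : inftuples D x ->
  tensor_kernel K u x x = \prod_(j <- u) kdiag (x j).
Proof. by move=> Dx; apply: eq_bigr => j _; rewrite kdiagE. Qed.

Lemma inftuples_anchor (u : {fset nat}) (x : u -> R) : fintuples D x -> inftuples D (anchor_ext c x).
Proof. by move=> Dx j; rewrite /anchor_ext; case: insubP. Qed.

Lemma anchor_projE u (x : nat -> R) j : anchor_proj c u x j = if j \in u then x j else c.
Proof.
rewrite /anchor_proj /anchor_ext; case: insubP => [k ku kj|/negbTE -> //].
by rewrite ku kj.
Qed.

Lemma inftuples_proj u x : inftuples D x -> inftuples D (anchor_proj c u x).
Proof. by move=> Dx j; rewrite anchor_projE; case: ifP. Qed.

(* The function of the combination [s] of sections in [H u], extended by 0 to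
   all sequences. *)
Definition tensor_comb (u : {fset nat}) (s : seq (R * (nat -> R))) (x : nat -> R) : R :=
  \sum_(q <- s) q.1 * \prod_(j <- u) ksec (q.2 j) (x j).

Lemma tensor_comb_eq (u : {fset nat}) s x x' : (forall j, j \in u -> x j = x' j) ->
  tensor_comb u s x = tensor_comb u s x'.
Proof.
move=> xx'; apply: eq_bigr => q _; congr (_ * _).
by rewrite big_seq [RHS]big_seq; apply: eq_bigr => j ju; rewrite xx'.
Qed.

Lemma tensor_comb_eq0 (u : {fset nat}) s x j : j \in u ->
  (forall q, q \in s -> inftuples D q.2) -> x j = c \/ ~ D (x j) ->
  tensor_comb u s x = 0.
Proof.
move=> ju sD xj; rewrite /tensor_comb big_seq big1// => q qs.
rewrite (big_fsetD1 j)//= (_ : ksec _ _ = 0) ?mul0r ?mulr0//.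
have [Dx|nDx] := pselect (D (x j)); last by rewrite ksec_out.
case: xj => // xj; rewrite xj ksecE// kernel_anchor//; exact: sD.
Qed.

Lemma tensor_combE (u : {fset nat}) s x : (forall q, q \in s -> inftuples D q.2) -> inftuples D x ->
  tensor_comb u s x = rk_fun (section_comb (H u) s) x.
Proof.
move=> sD Dx; rewrite section_comb_fun//; apply: eq_bigr => q _; congr (_ * _).
by apply: eq_bigr => j _; rewrite ksecE.
Qed.

Lemma tensor_comb_bound (u : {fset nat}) s x : (forall q, q \in s -> inftuples D q.2) ->
  `|tensor_comb u s x| <= `|section_comb (H u) s| * Num.sqrt (\prod_(j <- u) kdiag (x j)).
Proof.
move=> sD; have [[j [ju xj]]|nx] := pselect (exists j, j \in u /\ ~ D (x j)).
  by rewrite (tensor_comb_eq0 ju)//; [rewrite normr0 mulr_ge0|right].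
(* Coordinates outside [u] may lie outside [D]; resetting them to [c] changes neither side and leads
   into the domain of [H u]. *)
pose x' := anchor_proj c u x.
have Dx' : inftuples D x'.
  move=> j; rewrite /x' anchor_projE; case: ifPn => // ju.
  by apply: contrapT => Dj; apply: nx; exists j.
have xx' j : j \in u -> x j = x' j by move=> ju; rewrite /x' anchor_projE ju.
rewrite (tensor_comb_eq _ xx') tensor_combE//.
apply: (le_trans (rk_fun_bound _ Dx')); rewrite tensor_kernel_diag//.
rewrite [X in Num.sqrt X](_ : _ = \prod_(j <- u) kdiag (x j))//.
by rewrite big_seq [RHS]big_seq; apply: eq_bigr => j /xx' ->.
Qed.

Lemma sqrt_le1D (t : R) : 0 <= t -> Num.sqrt t <= 1 + t.
Proof.
move=> t0; rewrite -{2}(sqr_sqrtr t0); have := sqr_ge0 (Num.sqrt t - 1).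
have := sqrtr_ge0 t; nra.
Qed.

(** Trading the root for [1 + t] gives an integrable bound whose mean involves only powers of [M].
    The resulting constant [1 + M ^ |u|] is not sharp, but grows only geometrically in [|u|]. *)
Lemma tensor_comb_bound1 (u : {fset nat}) s x : (forall q, q \in s -> inftuples D q.2) ->
  `|tensor_comb u s x| <= `|section_comb (H u) s| * (1 + \prod_(j <- u) kdiag (x j)).
Proof.
move=> sD; apply: (le_trans (tensor_comb_bound _ _ sD)); rewrite ler_wpM2l//.
by rewrite sqrt_le1D// prodr_ge0// => j _; exact: kdiag_ge0.
Qed.

Lemma measurable_tensor_comb (u : {fset nat}) s : (forall q, q \in s -> inftuples D q.2) ->
  measurable_fun setT (tensor_comb u s : prod_space R nat -> R).
Proof.
(* The rule for sums asks for measurable summands at every [q], not only at those in [s]; the test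
   supplies 0 where the points leave [D]. *)
move=> sD; rewrite (_ : tensor_comb u s = fun x : prod_space R nat =>
   \sum_(q <- s) if `[< inftuples D q.2 >]
                 then q.1 * \prod_(j <- u) ksec (q.2 j) (x j) else 0); last first.
  apply/funext => x; rewrite /tensor_comb big_seq [RHS]big_seq.
  by apply: eq_bigr => q /sD qD; case: asboolP.
apply: measurable_sum => q; case: asboolP => qD; last exact: measurable_cst.
apply: measurable_funM; first exact: measurable_cst.
apply: measurable_prod => j _.
by apply: (measurableT_comp (measurable_ksec (qD j))); exact: measurable_coord.
Qed.

Lemma measurable_prod_kdiag (u : {fset nat}) :
  measurable_fun setT (fun x : prod_space R nat => \prod_(j <- u) kdiag (x j)).
Proof.
apply: measurable_prod => j _.
by apply: (measurableT_comp measurable_kdiag); exact: measurable_coord.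
Qed.

End AnchoredKernel.

(** * Integrals of combinations of sections *)

Section Integrals.
Context {R : realType}.
Local Notation RR := (measurableTypeR R).
Variables (D : set RR) (K : R -> R -> R) (c : R).
Hypotheses (hD : measurable D) (hK : anchored_kernel D K c).
Variable H : forall u : {fset nat}, rkhs (inftuples D) (tensor_kernel K u).
Variables (rho : probability RR R) (M : R).
Hypotheses (hrho : rho D = 1%E) (hM : (\int[rho]_(x in D) (K x x)%:E < +oo)%E)
  (M_def : M = \int[rho]_(x in D) K x x).
Variables (mu : probability (prod_space R nat) R)
  (rhou : forall u : {fset nat}, probability (prod_space R u) R).
Hypotheses (hmu : is_product_measure rho mu)
  (hrhou : forall u, is_product_measure rho (rhou u)).

Local Notation kd := (kdiag D K).

Lemma integral_kdiag : (\int[rho]_t (kd t)%:E)%E = M%:E.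
Proof.
have -> : (\int[rho]_t (kd t)%:E)%E = (\int[rho]_(t in D) (K t t)%:E)%E.
  rewrite [RHS]integral_mkcond; apply: eq_integral => t _.
  by rewrite /kdiag !patchE; case: ifP.
rewrite M_def /Rintegral fineK// ge0_fin_numE//.
by apply: integral_ge0 => t Dt; rewrite lee_fin (kernel_diag_ge0 H).
Qed.

Lemma kernel_mean_ge0 : 0 <= M.
Proof.
rewrite -lee_fin -integral_kdiag; apply: integral_ge0 => t _.
by rewrite lee_fin (kdiag_ge0 H).
Qed.

Lemma integral_prod_kdiag (u : {fset nat}) :
  (\int[mu]_x (\prod_(j <- u) kd (x j))%:E = (M ^+ #|` u|)%:E)%E.
Proof.
rewrite (integral_prod hmu (h := fun=> kd) (fset_uniq u))//.
- under eq_bigr do rewrite integral_kdiag.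
  elim: (enum_fset u) => [|j s IHs]; first by rewrite big_nil.
  by rewrite big_cons IHs /= exprS EFinM.
- by move=> j; exact: (measurable_kdiag hD hK).
- by move=> j t; exact: (kdiag_ge0 H).
Qed.

Lemma integrable_prod_kdiag (u : {fset nat}) :
  mu.-integrable setT (fun x => (\prod_(j <- u) kd (x j))%:E).
Proof.
apply/integrableP; split; first by apply/measurable_EFinP; exact: (measurable_prod_kdiag hD hK).
under eq_integral => x _.
  rewrite gee0_abs; last first.
    by rewrite lee_fin prodr_ge0// => j _; exact: (kdiag_ge0 H).
  over.
by rewrite integral_prod_kdiag ltry.
Qed.

Lemma integrable_cst1 : mu.-integrable setT (fun=> 1%:E).
Proof. by apply: finite_measure_integrable_cst. Qed.

Lemma integrable_tensor_comb u s : (forall q, q \in s -> inftuples D q.2) ->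
  mu.-integrable setT (fun x => (tensor_comb D K u s x)%:E).
Proof.
move=> sD.
apply: (@le_integrable _ _ _ mu setT measurableT _
  (fun x => (`|section_comb (H u) s|)%:E * (1%:E + (\prod_(j <- u) kd (x j))%:E))%E).
- by apply/measurable_EFinP; exact: (measurable_tensor_comb hD hK).
- move=> x _; rewrite -EFinD -EFinM /= lee_fin.
  apply: (@le_trans _ _ (`|section_comb (H u) s| * (1 + \prod_(j <- u) kd (x j)))).
    exact: (tensor_comb_bound1 hK H u x sD).
  exact: ler_norm.
apply: integrableZl => //; apply: integrableD => //; first exact: integrable_cst1.
exact: integrable_prod_kdiag.
Qed.

Lemma integral_tensor_comb_bound u s : (forall q, q \in s -> inftuples D q.2) ->
  `|\int[mu]_x tensor_comb D K u s x| <= `|section_comb (H u) s| * (1 + M ^+ #|` u|).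
Proof.
move=> sD.
have I1 := integrable_tensor_comb u sD.
apply: le_trans (le_normr_Rintegral measurableT I1) _.
have I2 : mu.-integrable setT (EFin \o (fun x => 1 + \prod_(j <- u) kd (x j))).
  exact: (integrableD measurableT integrable_cst1 (integrable_prod_kdiag u)).
apply: (@le_trans _ _ (\int[mu]_x (`|section_comb (H u) s| * (1 + \prod_(j <- u) kd (x j))))).
  apply: le_Rintegral => //.
  - exact: integrable_norm.
  - exact: (integrableZl measurableT `|section_comb (H u) s| I2).
  - by move=> x _; exact: (tensor_comb_bound1 hK H u x sD).
rewrite RintegralZl// RintegralD//.
- rewrite Rintegral_cst//= [X in fine X](_ : _ = 1%E); last exact: probability_setT.
  by rewrite mulr1 /Rintegral integral_prod_kdiag.
- exact: integrable_cst1.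
- exact: integrable_prod_kdiag.
Qed.

Definition restr (u : {fset nat}) (x : prod_space R nat) : prod_space R u :=
  fun k => x (val k).

Arguments restr : clear implicits.

Lemma measurable_restr u : measurable_fun setT (restr u).
Proof. by apply: measurable_fun_to_prod => k; exact: measurable_coord. Qed.

(** The marginal of [mu] on the coordinates in [u] is [rhou u], as both agree on boxes. All
    components can thus be integrated against the single measure [mu]. *)
Lemma integral_fin_tensor_comb u s : (forall q, q \in s -> inftuples D q.2) ->
  integral_fin D c (rhou u) (rk_fun (section_comb (H u) s)) =
  \int[mu]_x tensor_comb D K u s x.
Proof.
move=> sD; rewrite /integral_fin.
have mr := @measurable_restr u.
pose F (y : prod_space R u) := (tensor_comb D K u s (anchor_ext c y))%:E.
have Frestr x : F (restr u x) = (tensor_comb D K u s x)%:E.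
  rewrite /F; congr EFin; apply: tensor_comb_eq => j ju.
  by have := anchor_projE c u x j; rewrite ju.
have mF : measurable_fun setT F.
  rewrite /F; apply/measurable_EFinP.
  apply: (measurableT_comp (measurable_tensor_comb hD hK u sD)).
  apply: measurable_fun_to_prod => j; rewrite /anchor_ext.
  case: insubP => [k _ _|_]; last exact: measurable_cst.
  exact: measurable_coord.
(* Outside [D ^ u] some coordinate in [u] leaves [D], and there the extended function is 0. *)
transitivity (fine (\int[rhou u]_y F y)%E).
  rewrite Rintegral_mkcond /Rintegral; congr fine; apply: eq_integral => y _.
  rewrite patchE; case: ifPn => [/set_mem Dy|/negP nDy].
    by rewrite /F (tensor_combE H)//; exact: (inftuples_anchor hK Dy).
  have [k Dk] : exists k, ~ D (y k).
    by apply: contrapT => /forallNP Dy; apply: nDy; apply/mem_set => k; apply: contrapT; exact: Dy.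
  rewrite /F (tensor_comb_eq0 hK H (j := val k))//; first exact: fsvalP.
  by right; rewrite /anchor_ext valK.
rewrite /Rintegral; congr fine.
transitivity (\int[pushforward mu (restr u)]_y F y)%E.
  apply: eq_measure_integral => A mA _; apply: (product_measure_eq (rho := rho) _ _ mA).
    by move=> S B mB; exact: hrhou.
  move=> S B mB.
  pose S' := [fset val k | k in S]%fset.
  pose B' j := if insub j is Some k then B k else setT.
  transitivity (mu [set x | forall j, j \in S' -> B' j (x j)]).
    congr (mu _); apply/seteqP; split => x /=.
      by move=> Bx _ /imfsetP[k kS ->]; rewrite /B' valK; exact: Bx.
    move=> Bx k kS; have := Bx (val k); rewrite /B' valK; apply.
    by apply/imfsetP; exists k.
  rewrite hmu; last by move=> j; rewrite /B'; case: insubP.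
  rewrite /S' big_imfset/=; last by move=> i k _ _; exact: val_inj.
  by apply: eq_bigr => k _; rewrite /B' valK.
rewrite (integral_pushforward mr)//.
- by rewrite preimage_setT; apply: eq_integral => x _; exact: Frestr.
- rewrite (_ : F \o restr u = fun x => (tensor_comb D K u s x)%:E).
    exact: (integrable_tensor_comb u sD).
  by apply/funext => x; exact: Frestr.
Qed.

End Integrals.

(** * The error on the weighted space, component by component *)

Lemma Rintegral_dominated_cvg d (T : measurableType d) (R : realType)
    (mu : measure T R) (X : set T) (f_ : nat -> T -> R) (f G : T -> R) :
  measurable X -> (forall n, measurable_fun X (f_ n)) ->
  (forall x, X x -> f_ n x @[n --> \oo] --> f x) ->
  mu.-integrable X (EFin \o G) ->
  (forall n x, X x -> `|f_ n x| <= G x) ->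
  (\int[mu]_(x in X) f_ n x) @[n --> \oo] --> \int[mu]_(x in X) f x.
Proof.
move=> mX mf cf iG fG.
have cfE x : X x -> (f_ n x)%:E @[n --> \oo] --> (f x)%:E.
  by move=> Xx; apply: cvg_EFin; [near=> n|exact: cf].
have mf' n : measurable_fun X (EFin \o f_ n) by exact/measurable_EFinP.
have mfX : measurable_fun X (EFin \o f) by apply: (emeasurable_fun_cvg _ _ mf' cfE).
have fG' : {ae mu, forall x, forall n, X x -> (`|(EFin \o f_ n) x| <= (EFin \o G) x)%E}.
  by apply: aeW => x n Xx; rewrite /= lee_fin fG.
have [iF _ cF] := @dominated_convergence _ _ _ mu X mX (fun n => EFin \o f_ n) (EFin \o f)
  (EFin \o G) mf' mfX (aeW _ cfE) iG fG'.
apply: (@fine_cvg _ _ _ _ (fun n => \int[mu]_(x in X) (f_ n x)%:E)%E).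
by rewrite fineK//; exact: integrable_fin_num.
Unshelve. all: by end_near. Qed.

Lemma cvg_sum_seq (R : realType) (I : eqType) (s : seq I) (F : I -> nat -> R) (l : I -> R) :
  (forall i, i \in s -> F i N @[N --> \oo] --> l i) ->
  (\sum_(i <- s) F i N) @[N --> \oo] --> \sum_(i <- s) l i.
Proof.
elim: s => [|i s IHs] cF.
  rewrite big_nil (_ : (fun N => _) = fun=> 0); first exact: cvg_cst.
  by apply/funext => N; rewrite big_nil.
rewrite big_cons (_ : (fun N => _) = fun N => F i N + \sum_(i <- s) F i N).
  apply: cvgD; first by apply: cF; rewrite mem_head.
  by apply: IHs => j js; apply: cF; rewrite inE js orbT.
by apply/funext => N; rewrite big_cons.
Qed.

Section WeightedSpace.
Context {R : realType}.
Local Notation RR := (measurableTypeR R).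
Variables (D : set RR) (K : R -> R -> R) (c : R).
Hypotheses (hD : measurable D) (hK : anchored_kernel D K c).
Variable H : forall u : {fset nat}, rkhs (inftuples D) (tensor_kernel K u).
Variables (rho : probability RR R) (M : R).
Hypotheses (hrho : rho D = 1%E) (hM : (\int[rho]_(x in D) (K x x)%:E < +oo)%E)
  (M_def : M = \int[rho]_(x in D) K x x).
Variable mu : probability (prod_space R nat) R.
Hypothesis hmu : is_product_measure rho mu.
Variable gam : {fset nat} -> R.
Hypotheses (gam0 : forall u, 0 <= gam u)
  (gam_sum : (\esum_(u in [set: {fset nat}]) (gam u * M ^+ #|` u|)%:E < +oo)%E).
Variable Hgam : rkhs (weighted_domain D K gam) (weighted_kernel K gam).

Local Notation kd := (kdiag D K).
Local Notation fpw N := (fpowerset (first_coords N)).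
Let X : set (prod_space R nat) := weighted_domain D K gam.
Let S (x : prod_space R nat) : \bar R :=
  (\esum_(u in [set: {fset nat}]) (gam u * \prod_(j <- u) kd (x j))%:E)%E.

Lemma kd_prod0 (u : {fset nat}) x : 0 <= \prod_(j <- u) kd (x j).
Proof. by apply: prodr_ge0 => j _; exact: (kdiag_ge0 H). Qed.

Lemma gkd0 u (x : prod_space R nat) : (0 <= (gam u * \prod_(j <- u) kd (x j))%:E)%E.
Proof. by rewrite lee_fin mulr_ge0 ?kd_prod0. Qed.

Lemma esum_weight_support (f : {fset nat} -> R) :
  (\esum_(u in weight_support gam) (gam u * f u)%:E =
   \esum_(u in [set: {fset nat}]) (gam u * f u)%:E)%E.
Proof.
rewrite esum_mkcond; apply: eq_esum => u _; case: ifPn => //.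
rewrite notin_setE /weight_support /= => /negP; rewrite -leNgt => gu.
by rewrite (_ : gam u = 0) ?mul0r//; apply/eqP; rewrite eq_le gu gam0.
Qed.

Lemma SE x : inftuples D x ->
  (\esum_(u in weight_support gam) (gam u * tensor_kernel K u x x)%:E = S x)%E.
Proof.
move=> Dx; rewrite esum_weight_support; apply: eq_esum => u _.
by rewrite (tensor_kernel_diag K u Dx).
Qed.

Lemma XE : X = inftuples D `&` [set x | (S x < +oo)%E].
Proof.
apply/seteqP; split => x [Dx].
  by rewrite SE// => Sx; split.
by move=> Sx; split => //; rewrite SE.
Qed.

Lemma S_cvg x : (\sum_(u <- fpw N) (gam u * \prod_(j <- u) kd (x j))%:E)%E @[N --> \oo] --> S x.
Proof. by apply: esum_fpowerset_cvg => u; exact: gkd0. Qed.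

Lemma S0 x : (0 <= S x)%E. Proof. by apply: esum_ge0 => u _; exact: gkd0. Qed.

Lemma measurable_gkd u :
  measurable_fun setT (fun x : prod_space R nat => (gam u * \prod_(j <- u) kd (x j))%:E).
Proof.
apply/measurable_EFinP; apply: measurable_funM; first exact: measurable_cst.
exact: (measurable_prod_kdiag hD hK).
Qed.

Lemma measurable_S : measurable_fun setT S.
Proof.
apply: (@emeasurable_fun_cvg _ _ _ setT
  (fun N (x : prod_space R nat) => \sum_(u <- fpw N) (gam u * \prod_(j <- u) kd (x j))%:E)%E).
- by move=> N; apply: emeasurable_sum => u; exact: measurable_gkd.
- by move=> x _; exact: S_cvg.
Qed.

Lemma integral_S : (\int[mu]_x S x < +oo)%E.
Proof.
pose g N (x : prod_space R nat) := (\sum_(u <- fpw N) (gam u * \prod_(j <- u) kd (x j))%:E)%E.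
have mg N : measurable_fun setT (g N) by apply: emeasurable_sum => u; exact: measurable_gkd.
have g0 N x : setT x -> (0 <= g N x)%E by move=> _; apply: sume_ge0 => u _; exact: gkd0.
have nd x : setT x -> {homo g^~ x : n m / (n <= m)%N >-> (n <= m)%E}.
  by move=> _; apply: nondecreasing_sum_fpowerset => u; exact: gkd0.
have -> : (\int[mu]_x S x = \int[mu]_x limn (g^~ x))%E.
  by apply: eq_integral => x _; apply/esym/cvg_lim => //; exact: S_cvg.
rewrite monotone_convergence//; apply: le_lt_trans gam_sum.
have gE N : (\int[mu]_x g N x = \sum_(u <- fpw N) (gam u * M ^+ #|` u|)%:E)%E.
  rewrite /g ge0_integral_sum//; last 2 first.
  - by move=> u; exact: measurable_gkd.
  - by move=> u x _; exact: gkd0.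
  apply: eq_bigr => u _.
  under eq_integral do rewrite EFinM.
  rewrite ge0_integralZl_EFin//; last 2 first.
  - by move=> x _; rewrite lee_fin kd_prod0.
  - by apply/measurable_EFinP; exact: (measurable_prod_kdiag hD hK).
  by rewrite (integral_prod_kdiag hD hK H hM M_def hmu) EFinM.
have M0 := kernel_mean_ge0 H hM M_def.
have gM0 u : (0 <= (gam u * M ^+ #|` u|)%:E)%E.
  by rewrite lee_fin mulr_ge0 ?exprn_ge0.
have -> : (fun N => \int[mu]_x g N x)%E = (fun N => \sum_(u <- fpw N) (gam u * M ^+ #|` u|)%:E)%E.
  by apply/funext => N; exact: gE.
by rewrite (cvg_lim _ (esum_fpowerset_cvg gM0)).
Qed.

Lemma integrable_S : mu.-integrable setT S.
Proof.
apply/integrableP; split; first exact: measurable_S.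
under eq_integral => x _ do rewrite gee0_abs ?S0//.
exact: integral_S.
Qed.

Lemma measurable_inftuples : measurable (inftuples D : set (prod_space R nat)).
Proof.
rewrite (_ : inftuples D = \bigcap_j [set x : prod_space R nat | D (x j)]).
  by apply: bigcap_measurable => // j _; exact: measurable_cylinder.
by apply/seteqP; split => [x Dx j _|x Dx j]; exact: Dx.
Qed.

Lemma measurable_X : measurable (X : set (prod_space R nat)).
Proof.
rewrite XE; apply: measurableI; first exact: measurable_inftuples.
rewrite -[Y in measurable Y]setTI; apply: emeasurable_fun_infty_o => //.
exact: measurable_S.
Qed.

(** Each coordinate lies in [D] almost surely, hence all of them do, and [S] is finite almost
    everywhere because its integral is finite. *)
Lemma ae_X : mu (~` X) = 0%E.
Proof.
suff : {ae mu, forall x, X x}.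
  by move=> /negligibleP; apply; apply: measurableC; exact: measurable_X.
have aeD : {ae mu, forall x : prod_space R nat, forall j, D (x j)}.
  apply/ae_foralln => j; exists [set x : prod_space R nat | (~` D) (x j)]; split => //.
    by apply: measurable_cylinder; exact: measurableC.
  have mC (k : nat) : measurable ((fun=> ~` D : set RR) k) by exact: measurableC.
  have := hmu [fset j]%fset mC.
  rewrite big_seq_fset1.
  rewrite (_ : [set x : nat -> R | _] = [set x | (~` D) (x j)]); last first.
    apply/seteqP; split => x /= Dx; first by apply: Dx; rewrite inE.
    by move=> k; rewrite inE => /eqP ->.
  move=> E; apply: (eq_trans E); rewrite probability_setC// hrho; exact: subee.
have aeS : {ae mu, forall x, setT x -> S x \is a fin_num} := integrable_ae measurableT integrable_S.
move: aeD aeS; apply: filterS2 => x Dx /(_ I) Sx.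
by rewrite XE; split => //=; rewrite ltey_eq Sx.
Qed.

Lemma Rintegral_weighted_domain (f : prod_space R nat -> R) :
  mu.-integrable setT (EFin \o f) ->
  \int[mu]_(x in X) f x = \int[mu]_x f x.
Proof.
move=> intf; rewrite /Rintegral; congr fine.
rewrite [RHS](negligible_integral (N := ~` X))//; last 2 first.
- by apply: measurableC; exact: measurable_X.
- exact: ae_X.
by rewrite setTD setCK.
Qed.

Lemma X_inftuples x : X x -> inftuples D x. Proof. by case. Qed.

Lemma S_fin x : X x -> S x \is a fin_num.
Proof. by rewrite XE => -[_ Sx]; rewrite ge0_fin_numE// S0. Qed.

Lemma weighted_kernel_cvg x y : X x -> X y ->
  (\sum_(u <- fpw N) gam u * tensor_kernel K u x y) @[N --> \oo] -->
  weighted_kernel K gam x y.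
Proof.
move=> Xx Xy; apply: real_sum_cvg.
  move=> u /negP; rewrite -leNgt => gu.
  by rewrite (_ : gam u = 0) ?mul0r//; apply/eqP; rewrite eq_le gu gam0.
(* Absolute summability: off the diagonal the kernel is at most the geometric mean of the two
   diagonal values, hence at most their sum. *)
apply: (@le_lt_trans _ _ (S x + S y)%E); last by rewrite lte_add_pinfty// ltey_eq S_fin.
have Dx := X_inftuples Xx; have Dy := X_inftuples Xy.
rewrite -esumD; [|by move=> u _; exact: gkd0|by move=> u _; exact: gkd0].
rewrite esum_mkcond; apply: le_esum => u _.
have gg : (0 <= (gam u * \prod_(j <- u) kd (x j))%:E + (gam u * \prod_(j <- u) kd (y j))%:E)%E.
  by rewrite adde_ge0// gkd0.
case: ifP => // _; rewrite -EFinD lee_fin -mulrDr normrM ger0_norm ?gam0//.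
rewrite ler_wpM2l ?gam0//; apply: le_trans (rk_kernel_bound (H u) Dx Dy) _.
rewrite (tensor_kernel_diag K u Dx) (tensor_kernel_diag K u Dy).
have := sqr_ge0 (Num.sqrt (\prod_(j <- u) kd (x j)) - Num.sqrt (\prod_(j <- u) kd (y j))).
have h1 := sqr_sqrtr (kd_prod0 u x); have h2 := sqr_sqrtr (kd_prod0 u y).
have := sqrtr_ge0 (\prod_(j <- u) kd (x j)); have := sqrtr_ge0 (\prod_(j <- u) kd (y j)).
move: h1 h2; set a := Num.sqrt _; set b := Num.sqrt _ => <- <- a0 b0; nra.
Qed.

Lemma weighted_kernel_diag x : X x -> weighted_kernel K gam x x = fine (S x).
Proof.
move=> Xx; have Dx := X_inftuples Xx.
have := @S_cvg x; rewrite -[S x]fineK ?S_fin// => /fine_cvgP[_ C].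
rewrite /= -[LHS](cvg_lim _ (weighted_kernel_cvg Xx Xx))// -[RHS](cvg_lim _ C)//.
congr (limn _); apply/funext => N /=; rewrite sumEFin /=; apply: eq_bigr => u _.
by rewrite (tensor_kernel_diag K u Dx).
Qed.

Lemma sum_gkd_le x N : X x ->
  \sum_(u <- fpw N) gam u * \prod_(j <- u) kd (x j) <= fine (S x).
Proof.
move=> Xx; rewrite -lee_fin fineK ?S_fin// -sumEFin.
apply: ereal_sup_ubound; exists [set` fpw N]; first by split => //; exact: finite_fset.
by rewrite fsbig_finite//= set_fsetK.
Qed.

Lemma integrable_fine_S : mu.-integrable X (EFin \o (fine \o S)).
Proof.
apply: (@eq_integrable _ _ _ mu X measurable_X S).
  by move=> x /set_mem Xx; rewrite /= fineK// S_fin.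
apply: (integrableS measurableT measurable_X) => //.
exact: integrable_S.
Qed.

Section Combination.
Variable s : seq (R * (nat -> R)).
Hypothesis sX : forall q, q \in s -> X q.2.
Let sD q : q \in s -> inftuples D q.2. Proof. by move=> /sX/X_inftuples. Qed.
Let f := section_comb Hgam s.

(** The terms are the components of [f]: the one in [H u] is [gam u] times the combination that the
    same list [s] defines in [H u]. *)
Lemma weighted_comb_cvg x : X x ->
  (\sum_(u <- fpw N) gam u * tensor_comb D K u s x) @[N --> \oo] --> rk_fun f x.
Proof.
move=> Xx; rewrite section_comb_fun//.
rewrite (_ : (fun N => _) = fun N => \sum_(q <- s) q.1 *
   \sum_(u <- fpw N) gam u * tensor_kernel K u x q.2).
  by apply: cvg_sum_seq => q qs; apply: cvgM; [exact: cvg_cst|exact: weighted_kernel_cvg (sX qs)].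
apply/funext => N; rewrite /tensor_comb.
under eq_bigr do rewrite mulr_sumr.
rewrite exchange_big /=; apply: eq_bigr => q _; rewrite mulr_sumr; apply: eq_bigr => u _.
rewrite mulrCA; congr (_ * (_ * _)); apply: eq_bigr => j _.
by rewrite ksecE//; exact: X_inftuples.
Qed.

(** The component in [H u] carries a factor [gam u], hence [gam u ^ 2] in its squared norm; the
    weight [gam u ^ -1] of the norm leaves one factor. *)
Lemma weighted_comb_norm_cvg :
  (\sum_(u <- fpw N) gam u * `|section_comb (H u) s| ^+ 2) @[N --> \oo] --> `|f| ^+ 2.
Proof.
rewrite section_comb_norm//.
rewrite (_ : (fun N => _) = fun N => \sum_(q <- s) q.1 * \sum_(q' <- s) q'.1 *
   \sum_(u <- fpw N) gam u * tensor_kernel K u q.2 q'.2).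
  apply: cvg_sum_seq => q qs; apply: cvgM; first exact: cvg_cst.
  apply: cvg_sum_seq => q' q's; apply: cvgM; first exact: cvg_cst.
  exact: weighted_kernel_cvg (sX qs) (sX q's).
apply/funext => N.
under eq_bigr => u _.
  rewrite section_comb_norm// mulr_sumr.
  under eq_bigr do rewrite mulr_sumr mulr_sumr.
  over.
rewrite exchange_big /=; apply: eq_bigr => q _.
rewrite exchange_big /= mulr_sumr; apply: eq_bigr => q' _.
rewrite !mulr_sumr; apply: eq_bigr => u _.
by rewrite mulrCA; congr (_ * _); rewrite mulrCA.
Qed.

Lemma weighted_comb_norm_le N :
  \sum_(u <- fpw N) gam u * `|section_comb (H u) s| ^+ 2 <= `|f| ^+ 2.
Proof.
have nd : nondecreasing_seq (fun N => \sum_(u <- fpw N) gam u * `|section_comb (H u) s| ^+ 2).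
  move=> m n mn; apply: ler_sum_subset; rewrite ?fset_uniq// => u.
    by rewrite !fpowersetE => /fsubset_trans; apply; exact: first_coords_sub.
  by rewrite mulr_ge0 ?exprn_ge0.
rewrite -(cvg_lim _ weighted_comb_norm_cvg)//.
by apply: nondecreasing_cvgn_le => //; apply/cvg_ex; exists (`|f| ^+ 2); exact: weighted_comb_norm_cvg.
Qed.

(** Young's inequality separates the norm of [f] from the kernel at [x]; this yields a dominating
    function that does not depend on [N]. *)
Lemma weighted_comb_bound N x : X x ->
  `|\sum_(u <- fpw N) gam u * tensor_comb D K u s x| <= `|f| ^+ 2 + fine (S x).
Proof.
move=> Xx; apply: le_trans (ler_norm_sum _ _ _) _.
apply: le_trans (lerD (weighted_comb_norm_le N) (sum_gkd_le N Xx)).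
rewrite -big_split /=; apply: ler_sum => u _.
rewrite -mulrDr normrM ger0_norm ?gam0// ler_wpM2l ?gam0//.
apply: le_trans (tensor_comb_bound hK H u x sD) _.
have h1 := sqr_sqrtr (kd_prod0 u x); rewrite -[X in _ <= _ + X]h1.
have := sqrtr_ge0 (\prod_(j <- u) kd (x j)); have := normr_ge0 (section_comb (H u) s).
set a := Num.sqrt _; set b := `| _ | => a0 b0; have := sqr_ge0 (a - b); nra.
Qed.

Lemma measurable_weighted_comb N :
  measurable_fun X (fun x => \sum_(u <- fpw N) gam u * tensor_comb D K u s x).
Proof.
apply: measurable_sum => u; apply: measurable_funM; first exact: measurable_cst.
by apply: measurable_funTS; exact: (measurable_tensor_comb hD hK).
Qed.

Lemma measurable_rk_fun_comb : measurable_fun X (rk_fun f : prod_space R nat -> R).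
Proof.
apply/measurable_EFinP; apply: (@emeasurable_fun_cvg _ _ _ X
  (fun N (x : prod_space R nat) => (\sum_(u <- fpw N) gam u * tensor_comb D K u s x)%:E)).
  by move=> N; apply/measurable_EFinP; exact: measurable_weighted_comb.
by move=> x Xx; apply: cvg_EFin; [near=> N|exact: weighted_comb_cvg].
Unshelve. all: by end_near. Qed.

Lemma integral_weighted_comb_cvg :
  (\sum_(u <- fpw N) gam u * \int[mu]_x tensor_comb D K u s x) @[N --> \oo] -->
  integral_inf D K gam mu (rk_fun f).
Proof.
have iT u := integrable_tensor_comb hD hK H hM M_def hmu u sD.
have iX u : mu.-integrable X (EFin \o tensor_comb D K u s).
  by apply: (integrableS measurableT measurable_X) => //; exact: iT.
rewrite (_ : (fun N => _) = fun N =>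
   \int[mu]_(x in X) \sum_(u <- fpw N) gam u * tensor_comb D K u s x); last first.
  apply/funext => N; elim: (enum_fset (fpw N)) => [|u l IH].
    rewrite big_nil /Rintegral (_ : (\int[mu]_(x in X) _ = 0)%E)//.
    by apply: integral0_eq => x _; rewrite big_nil.
  rewrite big_cons IH -Rintegral_weighted_domain; last exact: iT.
  rewrite -(RintegralZl _ measurable_X (iX u)).
  rewrite -RintegralD//.
  - by apply: eq_Rintegral => x _; rewrite big_cons.
  - exact: measurable_X.
  - exact: (integrableZl measurable_X (gam u) (iX u)).
  elim: l {IH} => [|v l IH].
    rewrite (_ : EFin \o _ = fun=> 0%E); first exact: integrable0.
    by apply/funext => x /=; rewrite big_nil.
  rewrite (_ : EFin \o _ = fun x => ((gam v)%:E * (tensor_comb D K v s x)%:E +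
    (\sum_(u <- l) gam u * tensor_comb D K u s x)%:E)%E).
    apply: integrableD => //; first exact: measurable_X.
    exact: (integrableZl measurable_X (gam v) (iX v)).
  by apply/funext => x /=; rewrite big_cons.
apply: (Rintegral_dominated_cvg measurable_X measurable_weighted_comb weighted_comb_cvg
  (G := fun x => `|f| ^+ 2 + fine (S x))).
  apply: (integrableD measurable_X (f := fun=> (`|f| ^+ 2)%:E) _ integrable_fine_S).
  apply: (integrableS measurableT measurable_X) => //.
  exact: finite_measure_integrable_cst.
by move=> N x; exact: weighted_comb_bound.
Qed.

End Combination.

Lemma ler_cvg_to (u v : nat -> R) (a b : R) : u @ \oo --> a -> v @ \oo --> b ->
  (forall n, u n <= v n) -> a <= b.
Proof.
move=> ua vb uv; rewrite -(cvg_lim _ ua)// -(cvg_lim _ vb)//.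
apply: ler_lim; [by apply/cvg_ex; exists a|by apply/cvg_ex; exists b|by near=> n].
Unshelve. all: by end_near. Qed.

Section ErrorBound.
Variables (Q : algorithm R) (e : {fset nat} -> R) (E : R).
Hypotheses (QX : forall q, q \in Q -> X q.2) (E0 : 0 < E)
  (eQ : forall u s, 0 < gam u -> (forall q, q \in s -> inftuples D q.2) ->
     `|\int[mu]_x tensor_comb D K u s x - alg_eval Q (tensor_comb D K u s)| <=
     e u * `|section_comb (H u) s|)
  (eE : forall N, \sum_(u <- fpw N) gam u * e u ^+ 2 <= E ^+ 2).

Lemma alg_eval_cvg (F : nat -> (nat -> R) -> R) (f : (nat -> R) -> R) :
  (forall x, X x -> F n x @[n --> \oo] --> f x) ->
  alg_eval Q (F n) @[n --> \oo] --> alg_eval Q f.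
Proof.
move=> Ff; apply: cvg_sum_seq => q qQ; apply: cvgM; first exact: cvg_cst.
exact: Ff (QX qQ).
Qed.

(** Young's inequality with parameter [E], applied term by term, replaces Cauchy-Schwarz for the sum
    over [u]. It loses nothing where it counts: for norm at most 1 the bound is at most [E]. *)
Lemma comb_error_bound s : (forall q, q \in s -> X q.2) ->
  `|integral_inf D K gam mu (rk_fun (section_comb Hgam s)) -
    alg_eval Q (rk_fun (section_comb Hgam s))| <=
  (E + E * `|section_comb Hgam s| ^+ 2) / 2.
Proof.
move=> sX; have sD q : q \in s -> inftuples D q.2 by move=> /sX/X_inftuples.
have cI := integral_weighted_comb_cvg sX.
have cQ := alg_eval_cvg (weighted_comb_cvg sX).
apply: (ler_cvg_to (cvg_norm (cvgB cI cQ)) (cvg_cst _)) => N /=.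
have QE : alg_eval Q (fun x => \sum_(u <- fpw N) gam u * tensor_comb D K u s x) =
   \sum_(u <- fpw N) gam u * alg_eval Q (tensor_comb D K u s).
  rewrite /alg_eval; under eq_bigr do rewrite mulr_sumr.
  rewrite exchange_big /=; apply: eq_bigr => u _; rewrite mulr_sumr.
  by apply: eq_bigr => q _; rewrite mulrCA.
apply: (@le_trans _ _ `|\sum_(u <- fpw N) gam u * (\int[mu]_x tensor_comb D K u s x) -
    \sum_(u <- fpw N) gam u * alg_eval Q (tensor_comb D K u s)|); first by rewrite -QE.
rewrite -sumrB; apply: le_trans (ler_norm_sum _ _ _) _.
apply: (@le_trans _ _ (\sum_(u <- fpw N) (E^-1 * (gam u * e u ^+ 2) +
   E * (gam u * `|section_comb (H u) s| ^+ 2)) / 2)).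
  apply: ler_sum => u _; rewrite -mulrBr normrM ger0_norm ?gam0//.
  have [gu|gu] := ltP 0 (gam u); last first.
    have -> : gam u = 0 by apply/eqP; rewrite eq_le gu gam0.
    by rewrite !mul0r !mulr0 addr0 mul0r.
  have -> : (E^-1 * (gam u * e u ^+ 2) + E * (gam u * `|section_comb (H u) s| ^+ 2)) / 2 =
     gam u * ((E^-1 * e u ^+ 2 + E * `|section_comb (H u) s| ^+ 2) / 2) by ring.
  rewrite ler_pM2l//; apply: (le_trans (eQ gu sD)).
  rewrite -subr_ge0.
  have -> : (E^-1 * e u ^+ 2 + E * `|section_comb (H u) s| ^+ 2) / 2 -
     e u * `|section_comb (H u) s| = E^-1 * (e u - E * `|section_comb (H u) s|) ^+ 2 / 2.
    by field; rewrite gt_eqF.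
  by rewrite divr_ge0// mulr_ge0 ?sqr_ge0 ?invr_ge0// ltW.
rewrite -mulr_suml big_split /= -!mulr_sumr ler_pM2r// lerD//.
  by rewrite ler_pdivrMl// -expr2 eE.
by rewrite ler_pM2l// weighted_comb_norm_le.
Qed.

(** The approximating combinations have norms at most slightly above 1 and converge pointwise, which
    settles the nodes. The integrals converge by dominated convergence, as bounded point evaluation
    puts all of them below a multiple of [1 + S]. *)
Lemma weighted_error_bound :
  (worst_case_error Hgam (integral_inf D K gam mu) (alg_eval Q) <= E%:E)%E.
Proof.
apply: ge_ereal_sup => _ [f f1 <-]; rewrite lee_fin.
have /choice[s sP] : forall n : nat, exists s, [/\ forall q, q \in s -> X q.2,
    `|section_comb Hgam s| <= `|f| + n.+1%:R^-1 &
    forall x, X x -> `|rk_fun f x - rk_fun (section_comb Hgam s) x| <=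
      n.+1%:R^-1 * Num.sqrt (weighted_kernel K gam x x)].
  by move=> n; apply: section_comb_approx; rewrite invr_gt0.
have cf x : X x -> rk_fun (section_comb Hgam (s n)) x @[n --> \oo] --> rk_fun f x.
  move=> Xx; apply/cvgrPdist_le => /= eps eps0.
  set k := Num.sqrt (weighted_kernel K gam x x).
  have : n.+1%:R^-1 * k @[n --> \oo] --> 0 * k by apply: cvgM; [exact: cvg_harmonic|exact: cvg_cst].
  rewrite mul0r => /cvgrPdist_le/(_ eps eps0); apply: filterS => n /=.
  rewrite sub0r normrN => H1; have [_ _ /(_ x Xx) H2] := sP n.
  by apply: (le_trans H2); apply: le_trans H1; exact: ler_norm.
have norm2 n : `|section_comb Hgam (s n)| <= 1 + n.+1%:R^-1.
  have [_ H2 _] := sP n; apply: (le_trans H2); by rewrite lerD2r.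
have cI : integral_inf D K gam mu (rk_fun (section_comb Hgam (s n))) @[n --> \oo] -->
    integral_inf D K gam mu (rk_fun f).
  apply: (Rintegral_dominated_cvg measurable_X _ cf
    (G := fun x => 2 * (1 + fine (S x)))).
  - by move=> n; apply: measurable_rk_fun_comb; have [] := sP n.
  - apply: (integrableZl measurable_X 2 (f := fun x => (1 + fine (S x))%:E)).
    apply: (integrableD measurable_X (f := fun=> 1%:E) _ integrable_fine_S).
    by apply: (integrableS measurableT measurable_X) => //; exact: integrable_cst1.
  - move=> n x Xx; apply: le_trans (rk_fun_bound _ Xx) _.
    have Sx0 : 0 <= fine (S x) by rewrite fine_ge0// S0.
    apply: ler_pM => //; last by rewrite weighted_kernel_diag// sqrt_le1D.
    apply: le_trans (norm2 n) _; have : n.+1%:R^-1 <= 1 :> R by rewrite invf_le1 ?ler1n.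
    by move=> h; apply: le_trans (lerD (lexx 1) h) _; lra.
have cE : (E + E * (1 + n.+1%:R^-1) ^+ 2) / 2 @[n --> \oo] --> (E + E * (1 + 0) ^+ 2) / 2.
  apply: cvgM; last exact: cvg_cst.
  apply: cvgD; first exact: cvg_cst.
  apply: cvgM; first exact: cvg_cst.
  rewrite expr2; under eq_fun do rewrite expr2.
  by apply: cvgM; (apply: cvgD; [exact: cvg_cst|exact: cvg_harmonic]).
have -> : E = (E + E * (1 + 0) ^+ 2) / 2 by field.
apply: (ler_cvg_to (cvg_norm (cvgB cI (alg_eval_cvg cf))) cE) => n /=.
have [sX _ _] := sP n; apply: (le_trans (comb_error_bound sX)).
rewrite ler_pM2r// lerD2l ler_pM2l// lerXn2r ?nnegrE ?norm2// addr_ge0//.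
Qed.

End ErrorBound.

End WeightedSpace.

(** * Multilevel algorithms *)

Section Levels.
Context {R : realType}.
Variables (L : nat) (a : R).

Definition level_card (k : nat) : nat :=
  if k is k'.+1 then (L * `|Num.ceil (a ^+ k')|)%N else 0%N.

Lemma level_setE k : level_set L a k = first_coords (level_card k).
Proof.
case: k => [|k] //=; apply/fsetP => j; by rewrite in_first_coords !inE.
Qed.

Lemma level_card_mono k k' : 1 < a -> (k <= k')%N -> (level_card k <= level_card k')%N.
Proof.
move=> ha; case: k k' => [|k] [|k'] //=; rewrite ltnS => kk'.
rewrite leq_mul2l; apply/orP; right.
have a0 j : 0 <= a ^+ j by rewrite exprn_ge0// (le_trans ler01)// ltW.
rewrite -lez_nat !gez0_abs ?ceil_ge0 ?(lt_le_trans _ (a0 _)) ?ltrN10//.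
by apply: le_ceil; rewrite ler_weXn2l// ltW.
Qed.

(* [i < m] stands for level [i.+1], and [m] for the coordinates that belong to
   none of the levels [1, ..., m]. *)
Definition level_of (m l : nat) : nat :=
  find (fun i => l < level_card i.+1)%N (iota 0 m).

Lemma level_of_lt m l : (level_of m l < m)%N ->
  (level_card (level_of m l) <= l < level_card (level_of m l).+1)%N.
Proof.
move=> lm; apply/andP; split; last first.
  have : has (fun i => l < level_card i.+1)%N (iota 0 m) by rewrite has_find size_iota.
  by move=> /(nth_find 0%N); rewrite nth_iota.
case E : (level_of m l) => [|i] //.
have /(before_find 0%N) : (i < find (fun i => l < level_card i.+1)%N (iota 0 m))%N.
  by rewrite -/(level_of m l) E.
by rewrite nth_iota ?add0n; [rewrite ltnNge => /negbFE|by rewrite E in lm; exact: ltnW].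
Qed.

Lemma level_of_ge m l : (m <= level_of m l)%N -> (level_card m <= l)%N.
Proof.
case: m => [|m] // ml.
have /(before_find 0%N) : (m < find (fun i => l < level_card i.+1)%N (iota 0 m.+1))%N.
  exact: ml.
by rewrite nth_iota ?add0n// ltnNge => /negbFE.
Qed.

End Levels.

Section Multilevel.
Context {R : realType}.
Local Notation RR := (measurableTypeR R).
Variables (D : set RR) (K : R -> R -> R) (c : R).
Hypotheses (hD : measurable D) (hK : anchored_kernel D K c).
Variable H : forall u : {fset nat}, rkhs (inftuples D) (tensor_kernel K u).
Variables (rho : probability RR R) (M : R).
Hypotheses (hrho : rho D = 1%E) (hM : (\int[rho]_(x in D) (K x x)%:E < +oo)%E)
  (M_def : M = \int[rho]_(x in D) K x x).
Variables (mu : probability (prod_space R nat) R)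
  (rhou : forall u : {fset nat}, probability (prod_space R u) R).
Hypotheses (hmu : is_product_measure rho mu)
  (hrhou : forall u, is_product_measure rho (rhou u)).

Local Notation erru := (fun u Q =>
     worst_case_error (H u) (integral_fin D c (rhou u)) (alg_eval Q)).

Lemma section_combZ (u : {fset nat}) s (t : R) :
  section_comb (H u) [seq (t * q.1, q.2) | q <- s] = t *: section_comb (H u) s.
Proof.
rewrite /section_comb big_map scaler_sumr; apply: eq_bigr => q _ /=.
by rewrite scalerA.
Qed.

Lemma tensor_combZ (u : {fset nat}) s (t : R) x :
  tensor_comb D K u [seq (t * q.1, q.2) | q <- s] x = t * tensor_comb D K u s x.
Proof. by rewrite /tensor_comb big_map mulr_sumr; apply: eq_bigr => q _ /=; rewrite mulrA. Qed.

(** Homogeneity: the list is rescaled to norm 1. Norm 0 is treated apart; there the integral and all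
    values at the nodes vanish. *)
Lemma worst_case_error_comb (u : {fset nat}) (Q : algorithm R) s :
  (forall q, q \in Q -> inftuples D q.2) -> (forall q, q \in s -> inftuples D q.2) ->
  erru u Q \is a fin_num ->
  `|\int[mu]_x tensor_comb D K u s x - alg_eval Q (tensor_comb D K u s)| <=
  fine (erru u Q) * `|section_comb (H u) s|.
Proof.
move=> QD sD efin.
have algE s' : (forall q, q \in s' -> inftuples D q.2) ->
    alg_eval Q (rk_fun (section_comb (H u) s')) = alg_eval Q (tensor_comb D K u s').
  move=> s'D; rewrite /alg_eval big_seq [RHS]big_seq; apply: eq_bigr => q /QD qD.
  by rewrite (tensor_combE H).
set N := `|section_comb (H u) s|.
have [N0|N0] := eqVneq N 0.
  rewrite N0 mulr0 normr_le0 subr_eq0.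
  have I0 : \int[mu]_x tensor_comb D K u s x = 0.
    apply/eqP; rewrite -normr_le0.
    have := integral_tensor_comb_bound hD hK H hM M_def hmu u sD.
    by rewrite -/N N0 mul0r.
  rewrite I0 -algE// /alg_eval big_seq big1// => q /QD qD.
  have := rk_fun_bound (section_comb (H u) s) qD; rewrite -/N N0 mul0r normr_le0.
  by move=> /eqP ->; rewrite mulr0.
have Np : 0 < N by rewrite lt_def N0 normr_ge0.
pose s' := [seq (N^-1 * q.1, q.2) | q <- s].
have s'D q : q \in s' -> inftuples D q.2 by move=> /mapP[q' /sD q'D ->].
have norm1 : `|section_comb (H u) s'| <= 1.
  by rewrite section_combZ normrZ ger0_norm ?invr_ge0 ?(ltW Np)// mulVf.
have : (`|integral_fin D c (rhou u) (rk_fun (section_comb (H u) s')) -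
    alg_eval Q (rk_fun (section_comb (H u) s'))|%:E <= erru u Q)%E.
  by apply: ereal_sup_ubound; exists (section_comb (H u) s').
rewrite -[X in (_ <= X)%E]fineK// lee_fin algE//.
rewrite (integral_fin_tensor_comb hD hK H hM M_def hmu hrhou u s'D).
have -> : \int[mu]_x tensor_comb D K u s' x = N^-1 * \int[mu]_x tensor_comb D K u s x.
  rewrite -RintegralZl//; last exact: (integrable_tensor_comb hD hK H hM M_def hmu u sD).
  by apply: eq_Rintegral => x _; rewrite tensor_combZ.
have -> : alg_eval Q (tensor_comb D K u s') = N^-1 * alg_eval Q (tensor_comb D K u s).
  rewrite /alg_eval mulr_sumr; apply: eq_bigr => q _.
  by rewrite tensor_combZ mulrCA.
rewrite -mulrBr normrM ger0_norm ?invr_ge0 ?(ltW Np)//.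
by rewrite mulrC ler_pdivrMr.
Qed.

Variables (L : nat) (a : R).
Hypothesis ha : 1 < a.
Variables (Q : nat -> nat -> algorithm R).
Hypothesis hQ : forall k n, (0 < k)%N -> (0 < n)%N ->
  quadrature D c (level_set L a k) n (Q k n).
Local Notation v := (level_set L a).
Local Notation lev := (level_card L a).

Definition top (u : {fset nat}) := \max_(j <- u) j.

Lemma top_in (u : {fset nat}) : u != fset0 -> top u \in u.
Proof.
move=> /fset0Pn[j ju].
suff H0 (l : seq nat) : l != [::] -> \max_(i <- l) i \in l.
  by apply: H0; apply/eqP => u0; have : j \in enum_fset u := ju; rewrite u0.
elim: l => // i [|k l] IH _; first by rewrite big_seq1 mem_head.
rewrite big_cons in_cons; have [ik|ki] := leqP i (\max_(i <- k :: l) i).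
  by rewrite IH// orbT.
by rewrite eqxx.
Qed.

Lemma le_top (u : {fset nat}) j : j \in u -> (j <= top u)%N.
Proof. by move=> ju; rewrite (@leq_bigmax_seq _ (enum_fset u) xpredT (fun k : nat => k)). Qed.

Lemma quadrature_node k n q : (0 < k)%N -> (0 < n)%N -> q \in Q k n ->
  inftuples D q.2 /\ forall j, (lev k <= j)%N -> q.2 j = c.
Proof.
move=> k0 n0 qQ; have [_ /(_ q qQ)[t [Dt ->]]] := hQ k0 n0; split.
  exact: (inftuples_anchor hK Dt).
move=> j kj; have jk : j \notin v k by rewrite level_setE in_first_coords -leqNgt.
by rewrite /anchor_ext; case: insubP => // i ji; rewrite ji in jk.
Qed.

Section Evaluation.
Variables (u : {fset nat}) (s : seq (R * (nat -> R))).
Hypothesis sD : forall q, q \in s -> inftuples D q.2.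
Let g := tensor_comb D K u s.

Lemma level_term_low k n : (0 < k)%N -> (0 < n)%N -> u != fset0 ->
  (lev k <= top u)%N ->
  alg_eval (Q k n) (fun x => g x - Psi c (v k.-1) g x) = 0.
Proof.
move=> k0 n0 u0 ku; rewrite /alg_eval big_seq big1// => q /(quadrature_node k0 n0)[_ qc].
rewrite /g (tensor_comb_eq0 hK H (top_in u0))//; last by left; exact: qc.
rewrite /Psi (tensor_comb_eq0 hK H (top_in u0))//; first by rewrite subrr mulr0.
by left; rewrite anchor_projE; case: ifP => // _; exact: qc.
Qed.

Lemma level_term_high (Qa : algorithm R) k :
  (u != fset0 -> (top u < lev k)%N) ->
  alg_eval Qa (fun x => g x - Psi c (v k) g x) = 0.
Proof.
move=> uk; rewrite /alg_eval big1// => q _.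
suff -> : Psi c (v k) g q.2 = g q.2 by rewrite subrr mulr0.
apply: tensor_comb_eq => j ju; rewrite anchor_projE level_setE in_first_coords.
rewrite (leq_ltn_trans (le_top ju)) ?uk//.
by apply/eqP => u0; rewrite u0 in ju.
Qed.

Lemma level_term_mid (Qa : algorithm R) k : u != fset0 -> (lev k <= top u)%N ->
  alg_eval Qa (fun x => g x - Psi c (v k) g x) = alg_eval Qa g.
Proof.
move=> u0 ku; apply: eq_bigr => q _; congr (_ * _).
rewrite /Psi [X in _ - X](tensor_comb_eq0 hK H (top_in u0)) ?subr0//; left.
by rewrite anchor_projE level_setE in_first_coords ltnNge ku.
Qed.

Variables (m : nat) (n : nat -> nat).
Hypothesis n0 : forall k, (1 <= k <= m)%N -> (0 < n k)%N.

Lemma multilevel_comb0 : u = fset0 ->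
  alg_eval (multilevel c v Q m n) g = g (fun=> c).
Proof.
move=> u0; rewrite multilevelE big1 ?addr0// => k _.
by apply: level_term_high; rewrite u0 eqxx.
Qed.

Lemma multilevel_comb : u != fset0 ->
  alg_eval (multilevel c v Q m n) g =
  let i := level_of L a m (top u) in
  if (i < m)%N then alg_eval (Q i.+1 (n i.+1)) g else 0.
Proof.
move=> u0 /=; set i := level_of _ _ _ _.
rewrite multilevelE {1}/g (tensor_comb_eq0 hK H (top_in u0))//; last by left.
rewrite add0r; have [im|mi] := ltnP i m; last first.
  rewrite big_nat_cond big1// => k /andP[/andP[k1 km] _].
  apply: level_term_low => //; first by apply: n0; rewrite k1 -ltnS.
  exact: leq_trans (level_card_mono L ha (km : (k <= m)%N)) (@level_of_ge _ L a m (top u) mi).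
have /andP[li1 li2] := level_of_lt im.
rewrite (@big_cat_nat _ _ _ i.+1)//=; last by rewrite ltnW// ltnS.
rewrite big_nat_cond big1 => [|k /andP[/andP[k1 ki] _]]; last first.
  apply: level_term_low => //; first by apply: n0; rewrite k1/=; lia.
  by apply: leq_trans li1; apply: level_card_mono ha _.
rewrite add0r big_ltn//= big_nat_cond big1 => [|k /andP[/andP[ik km] _]]; last first.
  apply: level_term_high => _; apply: (leq_trans li2); apply: level_card_mono ha _.
  by rewrite -ltnS prednK// (ltn_trans _ ik).
by rewrite addr0; exact: level_term_mid.
Qed.

End Evaluation.

Variable gam : {fset nat} -> R.
Variables (m : nat) (n : nat -> nat).
Hypotheses (n0 : forall k, (1 <= k <= m)%N -> (0 < n k)%N)
  (efin : forall k n, (0 < k)%N -> (0 < n)%N -> forall u, 0 < gam u ->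
     u != fset0 -> (lev k.-1 <= top u < lev k)%N -> erru u (Q k n) \is a fin_num).

(** An upper bound for the error on [H u], not the error itself. Constants are integrated exactly by
    the first term [f (c, c, ...)]; if the maximum of [u] is in none of the levels, [1 + M ^ |u|]
    bounds the norm of the integral. *)
Definition multilevel_error (u : {fset nat}) : R :=
  if u == fset0 then 0 else
  let i := level_of L a m (top u) in
  if (i < m)%N then fine (erru u (Q i.+1 (n i.+1))) else 1 + M ^+ #|` u|.

Lemma multilevel_error_comb (u : {fset nat}) s : 0 < gam u ->
  (forall q, q \in s -> inftuples D q.2) ->
  `|\int[mu]_x tensor_comb D K u s x -
    alg_eval (multilevel c v Q m n) (tensor_comb D K u s)| <=
  multilevel_error u * `|section_comb (H u) s|.
Proof.
move=> gu sD; rewrite /multilevel_error; case: eqVneq => [u0|u0].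
  rewrite multilevel_comb0// mul0r normr_le0 subr_eq0; apply/eqP.
  rewrite (_ : tensor_comb D K u s = fun=> tensor_comb D K u s (fun=> c)).
    rewrite Rintegral_cst// [X in fine X](_ : _ = 1%E) ?mulr1//.
    exact: probability_setT.
  by apply/funext => x; apply: tensor_comb_eq => j; rewrite u0.
rewrite multilevel_comb//=; case: ifPn => im; last first.
  by rewrite subr0 mulrC; exact: (integral_tensor_comb_bound hD hK H hM M_def hmu u sD).
have n1 : (0 < n (level_of L a m (top u)).+1)%N by apply: n0.
apply: worst_case_error_comb => //; last exact: efin (level_of_lt im).
by move=> q /(quadrature_node _ n1)[].
Qed.

End Multilevel.

(** * Cost and error of the levels *)

Section Numeric.
Context {R : realType}.

Lemma absz_ceil_bounds (x : R) : 0 <= x ->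
  x <= `|Num.ceil x|%:R /\ `|Num.ceil x|%:R <= x + 1.
Proof.
move=> x0; have c0 : 0 <= Num.ceil x by rewrite ceil_ge0 (lt_le_trans _ x0)// ltrN10.
rewrite natr_absz ger0_norm//; split; first exact: ceil_ge.
by rewrite -lerBlDr ltW// -[X in _ - X]/(1%:~R) -intrB ceilB1_lt.
Qed.

Lemma level_card_lb (L : nat) (a : R) k : (0 < L)%N -> 1 < a ->
  a^-1 * a ^+ k <= (level_card L a k).+1%:R.
Proof.
move=> L0 a1; have a0 : 0 < a by rewrite (lt_trans ltr01).
case: k => [|k]; first by rewrite expr0 mulr1 /= invf_le1// ltW.
have [lb _] := absz_ceil_bounds (ltW (exprn_gt0 k a0)).
rewrite exprS mulKf ?gt_eqF//; apply: (le_trans lb); rewrite ler_nat /=.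
by rewrite leqW// leq_pmull.
Qed.

Lemma level_card_ub (L : nat) (a : R) k : 1 < a ->
  (level_card L a k)%:R <= 2 * L%:R * a ^+ k.
Proof.
move=> a1; have a0 : 0 < a by rewrite (lt_trans ltr01).
case: k => [|k]; first by rewrite expr0 mulr1 /= mulr_ge0.
have [_ ub] := absz_ceil_bounds (ltW (exprn_gt0 k a0)).
rewrite /= natrM [2 * _]mulrC -mulrA ler_wpM2l//.
have ak : 1 <= a ^+ k by rewrite exprn_ege1// ltW.
have aS : a ^+ k <= a ^+ k.+1 by rewrite ler_weXn2l// ltW.
by apply: (le_trans ub); lra.
Qed.

Lemma geometric_sum_le (r : R) n : 0 <= r -> r < 1 ->
  \sum_(i < n) r ^+ i <= (1 - r)^-1.
Proof.
move=> r0 r1; have r1' : 0 < 1 - r by rewrite subr_gt0.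
rewrite -[leRHS]mul1r ler_pdivlMr// mulrC.
have -> : (1 - r) * (\sum_(i < n) r ^+ i) = 1 - r ^+ n.
  by rewrite -opprB mulNr -subrX1 opprB.
by rewrite gerBl exprn_ge0.
Qed.

Lemma rev_geometric_sum_le (b d : R) m : 0 < b -> 0 <= d -> d < b ->
  \sum_(i < m) d ^+ (m - i.+1) * b ^+ i <= b ^+ m.-1 * (1 - d / b)^-1.
Proof.
move=> b0 d0 db; have r0 : 0 <= d / b by rewrite divr_ge0// ltW.
have r1 : d / b < 1 by rewrite ltr_pdivrMr// mul1r.
apply: le_trans (ler_wpM2l (exprn_ge0 _ (ltW b0)) (geometric_sum_le m r0 r1)).
rewrite mulr_sumr (reindex_inj rev_ord_inj) /=; apply: ler_sum => i _.
have im : (m - (m - i.+1).+1 = i)%N by have := ltn_ord i; lia.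
have mE : (m.-1 = (m - i.+1) + i)%N by have := ltn_ord i; lia.
rewrite im mE exprD expr_div_n -mulrA [b ^+ i * _]mulrCA mulfV ?mulr1 1?mulrC//.
by rewrite gt_eqF// exprn_gt0.
Qed.

(** For the minimal [m] the inequality fails at [m - 1], unless [m = 1]; then [b ^ 0 = 1] is at
    least [eps ^ 2], which accounts for the minimum with 1. *)
Lemma exists_level (b C : R) : 0 < b -> b < 1 -> 0 < C ->
  forall eps : R, 0 < eps <= 1 -> exists m : nat,
    [/\ (0 < m)%N, C * b ^+ m <= eps ^+ 2 & Num.min 1 C^-1 * eps ^+ 2 <= b ^+ m.-1].
Proof.
move=> b0 b1 C0 eps /andP[e0 e1].
have ex : exists m, (0 < m)%N && (C * b ^+ m <= eps ^+ 2).
  have : b ^+ n @[n --> \oo] --> 0.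
    by apply: cvg_expr; rewrite ger0_norm// ltW.
  have ee : 0 < eps ^+ 2 / C by rewrite divr_gt0// exprn_gt0.
  move=> /cvgrPdist_le/(_ _ ee)[N _ HN].
  exists N.+1 => /=; have := HN N.+1 (leqnSn N); rewrite /= sub0r normrN ger0_norm.
    by rewrite ler_pdivlMr// mulrC.
  by rewrite exprn_ge0// ltW.
case: (ex_minnP ex) => m /andP[m0 Hm] mmin; exists m; split=> //.
have e20 : 0 <= eps ^+ 2 by rewrite exprn_ge0// ltW.
case: m m0 Hm mmin => // m _ _ mmin /=.
have [->|m0] := posnP m.
  rewrite expr0; apply: (@le_trans _ _ (1 * 1)); last by rewrite mulr1.
  by rewrite ler_pM ?ge_min ?lexx// ?le_min ?ler01 ?invr_ge0 ?(ltW C0)// expr_le1// ltW.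
have : ~~ (C * b ^+ m <= eps ^+ 2).
  by apply/negP => H1; have := mmin m; rewrite m0 H1 ltnn => /(_ isT).
rewrite -ltNge => H1; apply: (@le_trans _ _ (C^-1 * eps ^+ 2)).
  by rewrite ler_wpM2r// ge_min lexx orbT.
by rewrite ler_pdivrMl// ltW.
Qed.

Lemma price_power_bound (price : nat -> R) (s sg : R) :
  (forall k, 1 <= price k) -> (forall k l, (k <= l)%N -> price k <= price l) ->
  (price : nat -> R^o) =O_\oo (fun k => k%:R `^ s : R^o) -> 0 <= s -> s <= sg ->
  exists2 C : R, 0 <= C & forall k, (0 < k)%N -> price k <= C * k%:R `^ sg.
Proof.
move=> p1 pm /eqOP [M0 [_ /(_ (`|M0| + 1))]].
rewrite (le_lt_trans (ler_norm _)) ?ltrDl// => /(_ isT)[N _ HN] s0 ssg.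
have pN : 0 <= price N by rewrite (le_trans ler01).
have M1 : 0 <= `|M0| + 1 by rewrite addr_ge0.
exists (price N + (`|M0| + 1)) => [|k k0]; first by rewrite addr_ge0.
have k1 : 1 <= k%:R :> R by rewrite ler1n.
have kss : k%:R `^ s <= k%:R `^ sg by rewrite ler_powR.
have [kN|Nk] := leqP k N; last first.
  have := HN k (ltnW Nk); rewrite /= => H1.
  apply: le_trans (ler_norm _) _; apply: (le_trans H1).
  rewrite (ger0_norm (powR_ge0 _ _)) ler_pM ?powR_ge0//.
  by rewrite lerDr.
(* Up to the threshold [N] monotonicity gives the bound [price N], and [k ^ sg] is at least 1. *)
apply: (le_trans (pm _ _ kN)); rewrite -[leLHS]mulr1 ler_pM//.
  by rewrite lerDl.
by rewrite -[leLHS](powRr0 k%:R) ler_powR// (le_trans s0).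
Qed.

Lemma level_sum_bound (L : nat) (a p : R) : (0 < L)%N -> 1 < a -> 1 < p ->
  exists2 C : R, 0 <= C & forall k n : nat,
    \sum_(level_card L a k <= j < n) j.+1%:R `^ (- p) <= C * (a `^ (1 - p)) ^+ k.
Proof.
move=> L0 a1 p1; have a0 : 0 < a by rewrite (lt_trans ltr01).
have [C C0 HC] := sum_powR_tail p1.
exists (C * a^-1 `^ (1 - p)) => [|k n]; first by rewrite mulr_ge0 ?powR_ge0.
apply: (le_trans (HC _ _)); rewrite -mulrA ler_wpM2l//.
rewrite -powR_expn_swap ?(ltW a0)// -powRM ?invr_ge0 ?exprn_ge0 ?(ltW a0)//.
rewrite -opprB !powRN lef_pV2 ?posrE ?powR_gt0 ?ltr0n ?mulr_gt0 ?invr_gt0 ?exprn_gt0//.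
rewrite ge0_ler_powR ?nnegrE ?subr_ge0 ?(ltW p1) ?mulr_ge0 ?invr_ge0 ?exprn_ge0 ?(ltW a0)//.
exact: level_card_lb.
Qed.

(** Level [i.+1] is charged for all coordinates from [level_card L a i] on, and not only for its
    own: the tail of the series has the same order. *)
Lemma level_error_sum (L : nat) (a p t : R) : (0 < L)%N -> 1 < a -> 1 < p ->
  exists2 C : R, 0 <= C & forall (C3 : R) (T : nat -> R) (m N : nat) (n : nat -> nat),
    0 <= C3 ->
    (forall l, (level_of L a m l < m)%N ->
      T l <= C3 * l.+1%:R `^ (- p) * (n (level_of L a m l).+1)%:R `^ (- t)) ->
    (forall l, (m <= level_of L a m l)%N -> T l <= C3 * l.+1%:R `^ (- p)) ->
    \sum_(l < N) T l <= C3 * C *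
      (\sum_(i < m) (n i.+1)%:R `^ (- t) * (a `^ (1 - p)) ^+ i + (a `^ (1 - p)) ^+ m).
Proof.
move=> L0 a1 p1; have [C C0 HC] := level_sum_bound L0 a1 p1.
exists C => // C3 T m N n C30 HT1 HT2.
pose y l : R := l.+1%:R `^ (- p).
have y0 l : 0 <= y l by exact: powR_ge0.
pose ind k l : R := if (level_card L a k <= l)%N then y l else 0.
have ind0 k l : 0 <= ind k l by rewrite /ind; case: ifP.
have indE k : \sum_(l < N) ind k l <= C * (a `^ (1 - p)) ^+ k.
  apply: le_trans (HC k N).
  have [kN|Nk] := leqP (level_card L a k) N; last first.
    rewrite big1 ?sumr_ge0// => l _; rewrite /ind leqNgt.
    by rewrite (ltn_trans (ltn_ord l) Nk).
  rewrite -(big_mkord xpredT (ind k)) (@big_cat_nat _ _ _ (level_card L a k))//=.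
  rewrite [X in X + _]big_nat_cond [X in X + _]big1 ?add0r; last first.
    by move=> l /andP[/andP[_ lk] _]; rewrite /ind leqNgt lk.
  by apply: ler_sum_nat => l /andP[kl _]; rewrite /ind kl.
have Tle l : T l <= C3 * (\sum_(i < m) (n i.+1)%:R `^ (- t) * ind i l + ind m l).
  have S0 : 0 <= \sum_(i < m) (n i.+1)%:R `^ (- t) * ind i l.
    by apply: sumr_ge0 => i _; rewrite mulr_ge0 ?powR_ge0.
  have [lm|ml] := ltnP (level_of L a m l) m; last first.
    apply: (le_trans (HT2 l ml)); rewrite ler_wpM2l//.
    by rewrite /ind (level_of_ge ml) lerDr.
  apply: (le_trans (HT1 l lm)); rewrite -mulrA ler_wpM2l// ler_wpDr//.
  have /andP[l1 _] := level_of_lt lm.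
  rewrite (bigD1 (Ordinal lm))//= {1}/ind l1 mulrC ler_wpDr// sumr_ge0// => i _.
  by rewrite mulr_ge0 ?powR_ge0.
apply: (@le_trans _ _ (\sum_(l < N)
    C3 * (\sum_(i < m) (n i.+1)%:R `^ (- t) * ind i l + ind m l))).
  by apply: ler_sum => l _; exact: Tle.
rewrite -mulr_sumr -mulrA ler_wpM2l// big_split /= mulrDr lerD//.
rewrite exchange_big /= mulr_sumr; apply: ler_sum => i _.
by rewrite -mulr_sumr mulrCA ler_wpM2l ?powR_ge0.
Qed.

(* The number of nodes on level [k]: with [A = a ^ beta] it decays like
   [a ^ (- beta k)] and equals 1 on the last level [m]. *)
Definition level_nodes (A : R) (m k : nat) : nat := `|Num.ceil (A ^+ (m - k))|%N.

Lemma level_nodes_gt0 (A : R) m k : 1 < A -> (0 < level_nodes A m k)%N.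
Proof.
move=> A1; have A0 : 0 < A by rewrite (lt_trans ltr01).
have [lb _] := absz_ceil_bounds (ltW (exprn_gt0 (m - k) A0)).
by rewrite -(ltr0n R) (lt_le_trans _ lb)// exprn_gt0.
Qed.

Lemma level_nodes_mono (A : R) m k : 1 < A -> (level_nodes A m k.+1 <= level_nodes A m k)%N.
Proof.
move=> A1; have A0 : 0 < A by rewrite (lt_trans ltr01).
have c0 j : 0 <= Num.ceil (A ^+ j) by rewrite ceil_ge0 (lt_trans _ (exprn_gt0 j A0))// ltrN10.
rewrite /level_nodes -lez_nat !gez0_abs ?c0//.
by apply: le_ceil; rewrite ler_weXn2l ?(ltW A1)//; lia.
Qed.

(** Since [A ^ (- t) < b], the reversed geometric sum is dominated by its last term, so the level
    errors are of the order [b ^ m] of the truncation error. Rounding up the number of nodes only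
    decreases the terms. *)
Lemma level_nodes_error (A b t : R) : 1 < A -> 0 < t -> 0 < b -> A `^ (- t) < b ->
  exists2 C : R, 0 <= C & forall m, (0 < m)%N ->
    \sum_(i < m) (level_nodes A m i.+1)%:R `^ (- t) * b ^+ i + b ^+ m <= C * b ^+ m.
Proof.
move=> A1 t0 b0 db; have A0 : 0 < A by rewrite (lt_trans ltr01).
set d := A `^ (- t) in db *; have d0 : 0 <= d by exact: powR_ge0.
have r1 : 0 < 1 - d / b by rewrite subr_gt0 ltr_pdivrMr// mul1r.
exists ((1 - d / b)^-1 / b + 1) => [|m m0].
  by rewrite addr_ge0// divr_ge0 ?invr_ge0 ?(ltW r1) ?(ltW b0).
rewrite mulrDl mul1r lerD2r.
have -> : (1 - d / b)^-1 / b * b ^+ m = b ^+ m.-1 * (1 - d / b)^-1.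
  by case: m m0 => // m _; rewrite exprS mulrA divfK ?gt_eqF// mulrC.
apply: le_trans (rev_geometric_sum_le m b0 d0 db); apply: ler_sum => i _.
rewrite ler_wpM2r ?exprn_ge0 ?(ltW b0)// /d -powR_expn_swap ?(ltW A0)//.
have [lb _] := absz_ceil_bounds (ltW (exprn_gt0 (m - i.+1) A0)).
rewrite !powRN lef_pV2 ?posrE ?powR_gt0 ?exprn_gt0 ?ltr0n ?level_nodes_gt0//.
by rewrite ge0_ler_powR ?nnegrE ?exprn_ge0 ?(ltW A0) ?(ltW t0).
Qed.

Lemma level_nodes_cost (price : nat -> R) (L : nat) (a Cp A sg : R) : (0 < L)%N ->
  1 < a -> 1 < A -> 0 <= sg -> A < a `^ sg -> 0 <= Cp ->
  (forall k, (0 < k)%N -> price k <= Cp * k%:R `^ sg) ->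
  exists2 C : R, 0 <= C & forall m, (0 < m)%N ->
    price 0%N + \sum_(1 <= k < m.+1)
       2 * (level_nodes A m k)%:R * price (level_card L a k) <= C * (a `^ sg) ^+ m.-1.
Proof.
move=> L0 a1 A1 sg0 AB Cp0 Hp.
have a0 : 0 < a by rewrite (lt_trans ltr01).
have A0 : 0 < A by rewrite (lt_trans ltr01).
set B := a `^ sg in AB *; have B0 : 0 < B by rewrite powR_gt0.
have B1 : 1 <= B by rewrite (le_trans _ (ltW AB))// ltW.
have r1 : 0 < 1 - A / B by rewrite subr_gt0 ltr_pdivrMr// mul1r.
(* One factor 2 is for rounding up the number of nodes, the other for evaluating both [f] and
   [Psi f]; [2 * L] and [B] come from the size of level [i.+1]. *)
pose C1 := 4 * Cp * (2 * L%:R) `^ sg * B.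
have C10 : 0 <= C1 by rewrite !mulr_ge0 ?powR_ge0 ?(ltW B0).
exists (`|price 0%N| + C1 * (1 - A / B)^-1) => [|m m0].
  by rewrite addr_ge0// mulr_ge0// invr_ge0 ltW.
rewrite mulrDl lerD//.
  apply: (le_trans (ler_norm _)); rewrite ler_peMr//; exact: exprn_ege1.
rewrite -mulrA [_^-1 * _]mulrC.
apply: le_trans (ler_wpM2l C10 (rev_geometric_sum_le m B0 (ltW A0) AB)).
rewrite mulr_sumr big_add1 /= big_mkord; apply: ler_sum => i _.
have [_ ub] := absz_ceil_bounds (ltW (exprn_gt0 (m - i.+1) A0)).
have nub : (level_nodes A m i.+1)%:R <= 2 * A ^+ (m - i.+1).
  apply: (le_trans ub); have : 1 <= A ^+ (m - i.+1) by rewrite exprn_ege1// ltW.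
  lra.
have lc0 : (0 < level_card L a i.+1)%N.
  have [lb _] := absz_ceil_bounds (ltW (exprn_gt0 i a0)).
  by rewrite /= muln_gt0 L0 -(ltr0n R) (lt_le_trans _ lb)// exprn_gt0.
have pub : price (level_card L a i.+1) <= Cp * ((2 * L%:R) `^ sg * (B * B ^+ i)).
  apply: (le_trans (Hp _ lc0)); rewrite ler_wpM2l//.
  rewrite -exprS -powR_expn_swap ?(ltW a0)// -powRM ?mulr_ge0 ?exprn_ge0 ?(ltW a0)//.
  rewrite ge0_ler_powR ?nnegrE ?mulr_ge0 ?exprn_ge0 ?(ltW a0)//.
  exact: level_card_ub.
have -> : C1 * (A ^+ (m - i.+1) * B ^+ i) =
  2 * (2 * A ^+ (m - i.+1)) * (Cp * ((2 * L%:R) `^ sg * (B * B ^+ i))) by rewrite /C1; ring.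
apply: (@le_trans _ _ (2 * (level_nodes A m i.+1)%:R * (Cp * ((2 * L%:R) `^ sg * (B * B ^+ i))))).
  by rewrite ler_wpM2l// mulr_ge0.
rewrite ler_wpM2r ?ler_wpM2l// !mulr_ge0 ?powR_ge0 ?exprn_ge0 ?(ltW B0)//.
Qed.

(** [a ^ sg] is the power [- sg / kap] of [a ^ (- kap)], so a lower bound for the error factor
    becomes an upper bound for the cost. *)
Lemma cost_exponent (a kap sg c0 : R) : 1 < a -> 0 < kap -> 0 <= sg -> 0 < c0 ->
  forall (eps : R) m, 0 < eps -> c0 * eps ^+ 2 <= (a `^ (- kap)) ^+ m ->
  (a `^ sg) ^+ m <= c0 `^ (- (sg / kap)) * eps `^ (- (2 * sg / kap)).
Proof.
move=> a1 kap0 sg0 c00 eps m e0 H1; have a0 : 0 < a by rewrite (lt_trans ltr01).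
have -> : (a `^ sg) ^+ m = ((a `^ (- kap)) ^+ m) `^ (- (sg / kap)).
  rewrite powR_expn_swap ?powR_ge0// -powRrM; congr (_ `^ _ ^+ _).
  by field; rewrite gt_eqF.
have -> : c0 `^ (- (sg / kap)) * eps `^ (- (2 * sg / kap)) = (c0 * eps ^+ 2) `^ (- (sg / kap)).
  rewrite powRM ?exprn_ge0 ?(ltW c00) ?(ltW e0)//; congr (_ * _).
  by rewrite -powR_mulrn ?(ltW e0)// -powRrM; congr (_ `^ _); ring.
have k0 : 0 <= sg / kap by rewrite divr_ge0// ltW.
have cc0 : 0 < c0 * eps ^+ 2 by rewrite mulr_gt0// exprn_gt0.
have : 0 < a `^ (- kap) by exact: powR_gt0.
move: (a `^ (- kap)) H1 => b H1 b0.
rewrite !powRN lef_pV2 ?posrE ?powR_gt0 ?exprn_gt0//.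
by rewrite ge0_ler_powR ?nnegrE ?exprn_ge0 ?(ltW b0) ?(ltW cc0).
Qed.

End Numeric.

(** * Nested cost and admissibility *)

Section Costs.
Context {R : realType}.
Variables (c : R) (price : nat -> R).
Hypothesis price_ge1 : forall k, 1 <= price k.

(** The initial segments themselves serve as the increasing sequence of sets in the cost of every
    algorithm. *)
Lemma first_coords_proper i : (first_coords i `<` first_coords i.+1)%fset.
Proof.
by rewrite fproperEcard first_coords_sub// !card_first_coords ltnSn.
Qed.

Lemma node_cost_first_coords N (x : nat -> R) : (forall j, (N <= j)%N -> x j = c) ->
  (node_cost c price first_coords x <= (price N)%:E)%E.
Proof.
move=> xc; apply: ereal_inf_lbound; exists N; last by rewrite card_first_coords.
by move=> j; rewrite in_first_coords -leqNgt => /xc.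
Qed.

Lemma cost_nest_le (Q : algorithm R) (F : R * (nat -> R) -> nat) :
  (forall q, q \in Q -> forall j, (F q <= j)%N -> q.2 j = c) ->
  (cost_nest c price Q <= \sum_(q <- Q) (price (F q))%:E)%E.
Proof.
move=> QF; apply: (@le_trans _ _ (\sum_(q <- Q) node_cost c price first_coords q.2)%E).
  by apply: ereal_inf_lbound; exists first_coords => // i; exact: first_coords_proper.
rewrite big_seq [leRHS]big_seq; apply: lee_sum => q /QF qc.
exact: node_cost_first_coords.
Qed.

Lemma cost_nest_nil : cost_nest c price [::] = 0%E.
Proof.
apply/eqP; rewrite eq_le; apply/andP; split.
  have := @cost_nest_le [::] (fun=> 0%N); rewrite big_nil; exact.
by apply: le_ereal_inf_tmp => _ [w _ <-]; rewrite big_nil.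
Qed.

End Costs.

Section MultilevelNodes.
Context {R : realType}.
Local Notation RR := (measurableTypeR R).
Variables (D : set RR) (K : R -> R -> R) (c : R).
Hypotheses (hK : anchored_kernel D K c).
Variables (L : nat) (a : R).
Variables (Q : nat -> nat -> algorithm R).
Hypothesis hQ : forall k n, (0 < k)%N -> (0 < n)%N ->
  quadrature D c (level_set L a k) n (Q k n).
Local Notation v := (level_set L a).
Local Notation lev := (level_card L a).
Variables (m : nat) (n : nat -> nat).
Hypothesis n0 : forall k, (1 <= k <= m)%N -> (0 < n k)%N.

Lemma multilevel_nodes q : q \in multilevel c v Q m n ->
  inftuples D q.2 /\ exists N, forall j, (N <= j)%N -> q.2 j = c.
Proof.
have Dc : D c by case: hK => _ _ _ _ [].
rewrite inE => /predU1P[->|/flattenP[_ /mapP[k + ->]]]; first by split => //; exists 0%N.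
rewrite mem_iota => /andP[k1 km]; have nk : (0 < n k)%N by apply: n0; rewrite k1 -ltnS -add1n.
have node q' : q' \in Q k (n k) -> inftuples D q'.2 /\ forall j, (lev k <= j)%N -> q'.2 j = c.
  exact: (quadrature_node hK hQ).
rewrite mem_cat => /orP[/node[Dq qc]|/mapP[q' /node[Dq qc] ->]].
  by split => //; exists (lev k).
split; first exact: (inftuples_proj hK).
by exists (lev k) => j kj; rewrite /= anchor_projE qc//; case: ifP.
Qed.

Lemma multilevel_admissible : admissible D c (multilevel c v Q m n).
Proof.
move=> q /multilevel_nodes[Dq [N qc]].
(* A quadrature node may have coordinates equal to [c]; these are dropped. *)
pose w := [fset j in iota 0 N | q.2 j != c]%fset.
exists w, (fun k => q.2 (val k)); split; first by move=> k; exact: Dq.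
  by move=> k; have := fsvalP k; rewrite /w !inE => /andP[_ /eqP].
apply/funext => j; rewrite /anchor_ext; case: insubP => [k _ -> //|].
by rewrite /w !inE /= mem_iota /= add0n negb_and negbK -leqNgt => /orP[/qc|/eqP].
Qed.

Lemma multilevel_cost (price : nat -> R) : (forall k, 1 <= price k) ->
  (cost_nest c price (multilevel c v Q m n) <=
   (price 0%N + \sum_(1 <= k < m.+1) 2 * (n k)%:R * price (lev k))%:E)%E.
Proof.
move=> p1.
have sum_le (s : algorithm R) (N : nat) :
    (forall q, q \in s -> forall j, (N <= j)%N -> q.2 j = c) ->
    (\sum_(q <- s) node_cost c price first_coords q.2 <= ((size s)%:R * price N)%:E)%E.
  elim: s => [|q s IHs] sN; first by rewrite big_nil mul0r.
  rewrite big_cons /= -natr1 mulrDl mul1r addrC EFinD; apply: leeD.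
    by apply: IHs => q' q's; apply: sN; rewrite inE q's orbT.
  by apply: node_cost_first_coords; apply: sN; rewrite mem_head.
apply: (@le_trans _ _ (\sum_(q <- multilevel c v Q m n) node_cost c price first_coords q.2)%E).
  by apply: ereal_inf_lbound; exists first_coords => // i; exact: first_coords_proper.
rewrite big_cons EFinD leeD//; first exact: node_cost_first_coords.
rewrite big_flatten /= big_map -sumEFin /index_iota subSS subn0.
rewrite big_seq [leRHS]big_seq; apply: lee_sum => k; rewrite mem_iota => /andP[k1 km].
have nk : (0 < n k)%N by apply: n0; rewrite k1 -ltnS -add1n.
have node q' : q' \in Q k (n k) -> inftuples D q'.2 /\ forall j, (lev k <= j)%N -> q'.2 j = c.
  exact: (quadrature_node hK hQ).
apply: (le_trans (sum_le _ (lev k) _)).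
  move=> q; rewrite mem_cat => /orP[/node[_]//|/mapP[q' /node[_ qc] ->]] j kj.
  by rewrite /= anchor_projE qc//; case: ifP.
have [sz _] := hQ k1 nk.
by rewrite size_cat size_map sz addnn -muln2 natrM [_ * 2]mulrC.
Qed.

Variable H : forall u : {fset nat}, rkhs (inftuples D) (tensor_kernel K u).

(** [K c c = 0] removes every [u] that is not contained in [{0, ..., N - 1}] from the sum. This
    places the nodes of the algorithms in the domain of the weighted space. *)
Lemma finite_nodes_weighted_domain (gam : {fset nat} -> R) (x : nat -> R) :
  (forall u, 0 <= gam u) -> inftuples D x ->
  (exists N, forall j, (N <= j)%N -> x j = c) -> weighted_domain D K gam x.
Proof.
move=> gam0 Dx [N xc]; split => //.
have Kcc : K c c = 0 by case: hK => _ _ _ _ [].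
rewrite esum_mkcond (_ : (\esum_(i in _) _)%E = (\esum_(i in [set: {fset nat}])
   if i \in [set` fpowerset (first_coords N)] then
     if i \in weight_support gam then (gam i * tensor_kernel K i x x)%:E else 0 else 0)%E).
  rewrite -esum_mkcond esum_fset//.
  - rewrite fsbig_finite//=; apply/lte_sum_pinfty => u _; case: ifP => _; exact: ltry.
  move=> u _; case: ifP => // _; rewrite lee_fin mulr_ge0//.
  exact: (rk_kernel_ge0 (H u)).
apply: eq_esum => u _; case: (boolP (u \in [set` _])) => // uN.
case: ifP => // _; rewrite (_ : tensor_kernel K u x x = 0) ?mulr0//.
have [j ju jN] : exists2 j, j \in u & (N <= j)%N.
  apply: contrapT => nj; move/negP: uN; apply; apply/mem_set => /=.
  rewrite fpowersetE; apply/fsubsetP => j ju; rewrite in_first_coords ltnNge.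
  by apply/negP => jN; apply: nj; exists j.
by rewrite /tensor_kernel (big_fsetD1 j)//= xc// Kcc mul0r.
Qed.

End MultilevelNodes.

Lemma worst_case_error_ge0 (R : realType) (T : Type) (X : set T) (K : T -> T -> R)
  (H : rkhs X K) (I Q : (T -> R) -> R) : (0 <= worst_case_error H I Q)%E.
Proof.
apply: (@le_trans _ _ (`|I (rk_fun (0 : H)) - Q (rk_fun (0 : H))|)%:E).
  by rewrite lee_fin.
by apply: ereal_sup_ubound; exists 0 => //=; rewrite normr0.
Qed.

(** In the extended reals [0 * +oo = 0], so a finite sum yields finite errors only where
    [gam u > 0], which are the components that count. *)
Lemma weighted_sqr_sum_le (R : realType) (I : eqType) (s : seq I) (P : pred I)
    (gam : I -> R) (e : I -> \bar R) (r : R) :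
  (forall u, 0 <= gam u) -> (forall u, 0 <= e u)%E ->
  (\sum_(u <- s | P u) (gam u)%:E * e u ^+ 2 <= r%:E)%E ->
  (forall u, u \in s -> P u -> 0 < gam u -> e u \is a fin_num) /\
  \sum_(u <- s | P u) gam u * fine (e u) ^+ 2 <= r.
Proof.
move=> gam0 e0 sumr.
have F0 u : (0 <= (gam u)%:E * e u ^+ 2)%E by rewrite mule_ge0 ?lee_fin ?expe_ge0.
have efin u : u \in s -> P u -> 0 < gam u -> e u \is a fin_num.
  move=> us Pu gu; rewrite ge0_fin_numE// ltey; apply/negP => /eqP eoo.
  move: sumr; rewrite (big_rem u)//= Pu eoo.
  rewrite mulyy gt0_muley ?lte_fin// addye ?leye_eq//.
  rewrite gt_eqF//; apply: (@lt_le_trans _ _ 0%E); first exact: ltNy0.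
  by apply: sume_ge0 => y _; exact: F0.
split => //; rewrite -lee_fin -sumEFin; apply: le_trans sumr.
rewrite big_seq_cond [leRHS]big_seq_cond; apply: lee_sum => u /andP[us Pu].
have [gu|gu] := ltP 0 (gam u); last first.
  by rewrite (_ : gam u = 0) ?mul0r ?mul0e//; apply/eqP; rewrite eq_le gu gam0.
by rewrite -[X in (_ <= _ * X ^+ 2)%E](fineK (efin u us Pu gu)).
Qed.

(* Strictly above both exponents there is room for [sg > s] with
   [2 * sg / (p - 1) = P] and for a decay [be] of the node numbers that makes both
   the error and the cost sums geometric and dominated by the last level. *)
Lemma exponent_choice (R : realFieldType) (P p s tau : R) : 0 < tau -> 1 < p -> 0 <= s ->
  1 / tau < P -> 2 * s / (p - 1) < P ->
  exists sg be : R, [/\ s <= sg, 0 < be, be < sg, p - 1 < 2 * tau * be &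
    2 * sg / (p - 1) = P].
Proof.
move=> tau0 p1 s0 Ptau Ps.
pose kap := p - 1; have kap0 : 0 < kap by rewrite subr_gt0.
exists (P * kap / 2), ((kap / (2 * tau) + P * kap / 2) / 2).
have ssg : s < P * kap / 2 by move: Ps; rewrite ltr_pdivrMr// /kap; lra.
have kt0 : 0 < kap / (2 * tau) by rewrite divr_gt0// mulr_gt0.
have tsg : kap / (2 * tau) < P * kap / 2.
  move: Ptau; rewrite ltr_pdivrMr// => Ptau.
  by rewrite ltr_pdivrMr ?mulr_gt0//; nra.
have tk : kap = 2 * tau * (kap / (2 * tau)) by field; rewrite gt_eqF.
split; [exact: ltW|lra|lra| |by rewrite -/kap; field; rewrite gt_eqF].
by rewrite -/kap {1}tk ltr_pM2l ?mulr_gt0//; lra.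
Qed.

Lemma oneD_expr_le (R : realFieldType) (x : R) k : 0 <= x -> (0 < k)%N ->
  1 + x ^+ k <= (1 + x) ^+ k.
Proof.
move=> x0; case: k => // k _; elim: k => [|k IH]; first by rewrite !expr1.
rewrite [leRHS]exprS exprS; apply: le_trans (ler_wpM2l _ IH); last by rewrite addr_ge0.
have : 0 <= x ^+ k.+1 by rewrite exprn_ge0.
nra.
Qed.

(** * Error and cost of the multilevel algorithm *)

Section Complexity.
Context {R : realType}.
Local Notation RR := (measurableTypeR R).
Variables (D : set RR) (K : R -> R -> R) (c : R).
Hypotheses (hD : measurable D) (hK : anchored_kernel D K c).
Variable H : forall u : {fset nat}, rkhs (inftuples D) (tensor_kernel K u).
Variables (rho : probability RR R) (M : R).
Hypotheses (hrho : rho D = 1%E) (hM : (\int[rho]_(x in D) (K x x)%:E < +oo)%E)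
  (M_def : M = \int[rho]_(x in D) K x x).
Variables (mu : probability (prod_space R nat) R)
  (rhou : forall u : {fset nat}, probability (prod_space R u) R).
Hypotheses (hmu : is_product_measure rho mu)
  (hrhou : forall u, is_product_measure rho (rhou u)).
Variables (Gam g : nat -> R).
Hypotheses (hGam : forall k, 0 <= Gam k) (hg0 : forall j, 0 <= g j).
Let gam := POD Gam g.
Hypothesis gam_sum :
  (\esum_(u in [set: {fset nat}]) (gam u * M ^+ #|` u|)%:E < +oo)%E.
Variable Hgam : rkhs (weighted_domain D K gam) (weighted_kernel K gam).
Variables (price : nat -> R) (s : R).
Hypotheses (price_ge1 : forall k, 1 <= price k)
  (price_mono : forall k l, (k <= l)%N -> price k <= price l) (hs : 0 <= s)
  (price_O : (price : nat -> R^o) =O_\oo (fun k => k%:R `^ s : R^o)).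
Variables (L : nat) (a : R) (Q : nat -> nat -> algorithm R).
Hypotheses (hL : (0 < L)%N) (ha : 1 < a)
  (hQ : forall k n, (0 < k)%N -> (0 < n)%N ->
     quadrature D c (level_set L a k) n (Q k n)).
Local Notation err := (fun Q =>
     worst_case_error Hgam (integral_inf D K gam mu) (alg_eval Q)).
Local Notation erru := (fun u Q =>
     worst_case_error (H u) (integral_fin D c (rhou u)) (alg_eval Q)).
Local Notation v := (level_set L a).
Local Notation fpw N := (fpowerset (first_coords N)).

Let gam0 u : 0 <= gam u.
Proof. by rewrite mulr_ge0// prodr_ge0. Qed.

Variables (q Cq p Cg tau : R).
Hypotheses (GamC : forall k, (1 <= k)%N -> Gam k <= Cq * k`!%:R `^ q) (Cq0 : 0 <= Cq)
  (gC : forall j, g j <= Cg * j.+1%:R `^ (- p)) (Cg0 : 0 <= Cg)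
  (qp : q < p) (p1 : 1 < p) (tau0 : 0 < tau) (taup : 2 * tau < p)
  (hquad : quadrature_bound gam erru v Q tau).

Lemma top_eq l (u : {fset nat}) : u \in fpw l.+1 -> l \in u -> u != fset0 /\ top u = l.
Proof.
rewrite fpowersetE => /fsubsetP ul lu.
have u0 : u != fset0 by apply/eqP => u0; rewrite u0 in lu.
split => //; apply/eqP; rewrite eqn_leq le_top// andbT.
by have := ul _ (top_in u0); rewrite in_first_coords ltnS.
Qed.

Lemma multilevel_error_square : exists2 C : R, 0 < C & forall m n N,
  (forall k, (1 <= k <= m)%N -> (0 < n k)%N) ->
  (forall k n', (0 < k)%N -> (0 < n')%N -> forall u, 0 < gam u -> u != fset0 ->
     (level_card L a k.-1 <= top u < level_card L a k)%N -> erru u (Q k n') \is a fin_num) /\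
  \sum_(u <- fpw N) gam u * multilevel_error c H M rhou L a Q m n u ^+ 2 <=
  C * (\sum_(i < m) (n i.+1)%:R `^ (- (2 * tau)) * (a `^ (1 - p)) ^+ i + (a `^ (1 - p)) ^+ m).
Proof.
have t0 : 0 < 2 * tau by rewrite mulr_gt0.
have [Ct Ct0 HCt] := hquad.
have x0 : 0 < 1 / (2 * tau) by rewrite divr_gt0.
have px1 : 1 < p * (1 / (2 * tau)) by rewrite mulrA mulr1 ltr_pdivlMr// mul1r.
(* The inner sum has exponent [p / (2 tau) > 1]; the outer power [2 tau] of the hypothesis restores
   the order [l ^ (- p)]. *)
have [C1 C10 HC1] := POD_sum_bound hGam GamC hg0 gC Cq0 Cg0 x0 qp px1 Ct0.
have M0 := kernel_mean_ge0 H hM M_def.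
(* The base [(1 + M) ^ 2] dominates the square of the truncation constant [1 + M ^ |u|]. *)
have [|C2 C20 HC2] := POD_sum_bound hGam GamC hg0 gC Cq0 Cg0 ltr01 qp _ (sqr_ge0 (1 + M)).
  by rewrite mulr1.
have [C C0 HC] := level_error_sum (2 * tau) hL ha p1.
pose C3 := C1 `^ (2 * tau) + C2.
have C30 : 0 <= C3 by rewrite addr_ge0// powR_ge0.
exists (C3 * C + 1) => [|m n N n0]; first by rewrite ltr_wpDl// mulr_ge0.
have levk k l : (level_card L a k.-1 <= l < level_card L a k)%N -> l \in (v k `\` v k.-1)%fset.
  by move=> /andP[l1 l2]; rewrite !level_setE inE !in_first_coords -leqNgt l1 l2.
have quad k n' l : (0 < k)%N -> (0 < n')%N -> (level_card L a k.-1 <= l < level_card L a k)%N ->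
    (forall u, u \in fpw l.+1 -> l \in u -> 0 < gam u -> erru u (Q k n') \is a fin_num) /\
    \sum_(u <- fpw l.+1 | l \in u) gam u * fine (erru u (Q k n')) ^+ 2 <=
    C1 `^ (2 * tau) * l.+1%:R `^ (- p) * n'%:R `^ (- (2 * tau)).
  move=> k0 n'0 lk; have := HCt k n' k0 n'0 l (levk _ _ lk).
  move=> /(weighted_sqr_sum_le gam0 (fun u => worst_case_error_ge0 _ _ _))[Hfin Hsum].
  split => //; apply: (le_trans Hsum); rewrite ler_wpM2r ?powR_ge0//.
  have -> : C1 `^ (2 * tau) * l.+1%:R `^ (- p) =
     (C1 * l.+1%:R `^ (- (p * (1 / (2 * tau))))) `^ (2 * tau).
    rewrite powRM ?powR_ge0// -powRrM; congr (_ * _ `^ _).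
    by field; rewrite gt_eqF.
  rewrite ge0_ler_powR ?(ltW t0) ?nnegrE ?mulr_ge0 ?powR_ge0//.
  by rewrite sumr_ge0// => u _; rewrite mulr_ge0 ?powR_ge0 ?exprn_ge0.
split.
  move=> k n' k0 n'0 u gu u0 uk; have [Hfin _] := quad k n' (top u) k0 n'0 uk.
  by apply: Hfin => //; [exact: fset_in_fpowerset|exact: top_in].
pose T l := \sum_(u <- fpw l.+1 | l \in u) gam u * multilevel_error c H M rhou L a Q m n u ^+ 2.
rewrite big_fpowerset_max /= {1}/multilevel_error eqxx expr0n mulr0 add0r.
have S0 : 0 <= \sum_(i < m) (n i.+1)%:R `^ (- (2 * tau)) * (a `^ (1 - p)) ^+ i + (a `^ (1 - p)) ^+ m.
  rewrite addr_ge0 ?exprn_ge0 ?powR_ge0// sumr_ge0// => i _.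
  by rewrite mulr_ge0 ?exprn_ge0 ?powR_ge0.
move: S0; set E2 := _ + _ => S0; apply: (@le_trans _ _ (C3 * C * E2)); last first.
  by rewrite ler_wpM2r// lerDl.
apply: (HC C3 T) => // l.
  move=> lm; have /andP[l1 l2] := level_of_lt lm.
  have nk : (0 < n (level_of L a m l).+1)%N by apply: n0.
  have [|_ Hs] := quad (level_of L a m l).+1 _ l isT nk; first by rewrite /= l1 l2.
  rewrite (_ : T l = \sum_(u <- fpw l.+1 | l \in u) gam u *
     fine (erru u (Q (level_of L a m l).+1 (n (level_of L a m l).+1))) ^+ 2); last first.
    rewrite /T big_seq_cond [RHS]big_seq_cond; apply: eq_bigr => u /andP[ul lu].
    have [u0 tu] := top_eq ul lu.
    by rewrite /multilevel_error (negbTE u0) tu /= lm.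
  apply: (le_trans Hs); rewrite ler_wpM2r ?powR_ge0// ler_wpM2r ?powR_ge0//.
  by rewrite lerDl.
move=> ml.
apply: (@le_trans _ _ (C2 * l.+1%:R `^ (- (p * 1)))); last first.
  by rewrite mulr1 ler_wpM2r ?powR_ge0// lerDr powR_ge0.
apply: le_trans (HC2 l); rewrite /T big_seq_cond [leRHS]big_seq_cond.
apply: ler_sum => u /andP[ul lu]; have [u0 tu] := top_eq ul lu.
rewrite /multilevel_error (negbTE u0) tu /= ltnNge ml /= powRr1; last exact: gam0.
rewrite ler_wpM2l//.
have M1 : 0 <= 1 + M by rewrite addr_ge0.
rewrite -exprM mulnC exprM lerXn2r ?nnegrE ?exprn_ge0//.
  by rewrite addr_ge0 ?exprn_ge0.
by apply: oneD_expr_le => //; rewrite cardfs_gt0.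
Qed.

Lemma multilevel_complexity (P : R) : 1 / tau < P -> 2 * s / (p - 1) < P ->
  exists C : R, forall eps : R, 0 < eps <= 1 -> exists (m : nat) (n : nat -> nat),
      [/\ (0 < m)%N,
          forall k, (1 <= k <= m)%N -> (0 < n k)%N,
          forall k, (1 <= k < m)%N -> (n k.+1 <= n k)%N,
          (err (multilevel c v Q m n) <= eps%:E)%E &
          (cost_nest c price (multilevel c v Q m n)
             <= (C * eps `^ (- P))%:E)%E].
Proof.
move=> Ptau Ps.
have [sg [be [ssg be0 besg kapbe PE]]] := exponent_choice tau0 p1 hs Ptau Ps.
have a0 : 0 < a by rewrite (lt_trans ltr01).
have sg0 : 0 <= sg by apply: le_trans ssg.
have kap0 : 0 < p - 1 by rewrite subr_gt0.
have apow x y : x < y -> a `^ x < a `^ y.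
  by move=> xy; rewrite /powR gt_eqF// ltr_expR ltr_pM2r// ln_gt0.
(* [A < a ^ sg] and [A ^ (- (2 * tau)) < b] are the conditions under which the last level dominates
   the cost and the error. *)
pose A := a `^ be.
have A1 : 1 < A by rewrite /A -[ltLHS](powRr0 a) apow.
have AB : A < a `^ sg by exact: apow.
set b := a `^ (1 - p).
have b0 : 0 < b by rewrite powR_gt0.
have b1 : b < 1 by rewrite /b -[ltRHS](powRr0 a) apow// subr_lt0.
have t0 : 0 < 2 * tau by rewrite mulr_gt0.
have dA : A `^ (- (2 * tau)) < b.
  by rewrite /A -powRrM apow// mulrN ltrNl opprB mulrC.
have [Ce Ce0 HCe] := multilevel_error_square.
have [C5 C50 HC5] := level_nodes_error A1 t0 b0 dA.
have [Cp Cp0 HCp] := price_power_bound price_ge1 price_mono price_O hs ssg.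
have [C6 C60 HC6] := level_nodes_cost hL ha A1 sg0 AB Cp0 HCp.
have C70 : 0 < Ce * (C5 + 1) by rewrite mulr_gt0// ltr_wpDl.
pose c0 := Num.min 1 (Ce * (C5 + 1))^-1.
have c00 : 0 < c0 by rewrite lt_min ltr01 invr_gt0.
exists (C6 * c0 `^ (- (sg / (p - 1)))) => eps /andP[e0 e1].
have [|m [m0 mlt mge]] := exists_level b0 b1 C70 (eps := eps); first by rewrite e0.
pose n := level_nodes A m.
have n0 k : (1 <= k <= m)%N -> (0 < n k)%N by move=> _; exact: level_nodes_gt0.
exists m, n; split => //.
- by move=> k _; exact: level_nodes_mono.
- have QX x : x \in multilevel c v Q m n -> weighted_domain D K gam x.2.
    move=> /(multilevel_nodes hK hQ n0)[Dx xc].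
    exact: (finite_nodes_weighted_domain hK H gam0 Dx xc).
  apply: (weighted_error_bound hD hK hrho hM M_def hmu gam0 gam_sum Hgam QX e0 (H := H)
    (e := multilevel_error c H M rhou L a Q m n)).
    move=> u s' gu s'D; have [efin _] := HCe m n 0%N n0.
    exact: (multilevel_error_comb hD hK hM M_def hmu hrhou ha hQ n0 efin gu s'D).
  move=> N; have [_ Hs] := HCe m n N n0.
  apply: (le_trans Hs); apply: le_trans mlt; rewrite -mulrA ler_pM2l//.
  apply: (le_trans (HC5 m m0)).
  by rewrite ler_wpM2r ?exprn_ge0 ?(ltW b0)// lerDl.
apply: (le_trans (multilevel_cost hK hQ n0 price_ge1)); rewrite lee_fin.
apply: (le_trans (HC6 m m0)); rewrite -mulrA ler_wpM2l//.
rewrite -PE; apply: (cost_exponent ha kap0 sg0 c00 e0).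
by rewrite opprB.
Qed.

End Complexity.

(** * Arithmetic of the exponents *)

Section Exponents.
Context {R : realFieldType}.
Variables (al s d P : R).
Hypotheses (al2 : 1 / 2 <= al) (s0 : 0 <= s) (d1 : 1 < d).

Let al0 : 0 < al. Proof. by apply: lt_le_trans al2; rewrite divr_gt0. Qed.

(** Every bound is reduced to [1 / al < P], [2 < P * d] and [2 * s < P * (d - 1)]; the second makes
    room for [tau > 1 / P] below half of the decay. Here it follows from the other two: if
    [d < 2 * al], then [1 - 1 / d < 1 - 1 / (2 * al) <= s]. *)
Lemma exponent_large_cost : (2 * al - 1) / (2 * al) <= s -> 1 / al < P ->
  2 * s < P * (d - 1) -> 2 < P * d.
Proof.
move=> sal; rewrite ltr_pdivrMr// => Pal Ps.
have [dal|ald] := leP (2 * al) d.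
  have P0 : 0 < P by rewrite -(pmulr_lgt0 _ al0) (lt_trans ltr01).
  by have := ler_wpM2l (ltW P0) dal; lra.
have al20 : 0 < 2 * al by rewrite mulr_gt0.
move: sal; rewrite ler_pdivrMr// => sal.
have d0 : 0 < d by rewrite (lt_trans ltr01).
have h1 : d - 1 < s * d.
  have : (2 * al - 1) * d <= s * (2 * al) * d by rewrite ler_pM2r.
  have h : (d - 1) * (2 * al) < (2 * al - 1) * d by lra.
  move=> h2; rewrite -(ltr_pM2r al20); lra.
have h3 : 2 * (d - 1) < P * d * (d - 1).
  have := ltr_pM2r d0 (2 * s) (P * (d - 1)); rewrite Ps => h4; lra.
by rewrite ltr_pM2r ?subr_gt0 in h3.
Qed.

(** [2 * s * al < 2 * al - 1] and [1 < P * al] give the cost condition at [d = 2 * al], and it is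
    monotone in [d]. *)
Lemma exponent_fast_decay : s < (2 * al - 1) / (2 * al) -> 1 / al < P -> 2 * al <= d ->
  2 < P * d /\ 2 * s < P * (d - 1).
Proof.
move=> sal; rewrite ltr_pdivrMr// => Pal ald.
have P0 : 0 < P by rewrite -(pmulr_lgt0 _ al0) (lt_trans ltr01).
have al20 : 0 < 2 * al by rewrite mulr_gt0.
move: sal; rewrite ltr_pdivlMr// => sal.
have h1 := ler_wpM2l (ltW P0) ald.
split; first lra.
have h2 : 0 < 2 * al - 1 by apply: le_lt_trans sal; rewrite mulr_ge0// ltW.
have h3 : 2 * s * al < P * al * (2 * al - 1).
  by apply: (@lt_trans _ _ (2 * al - 1)); [lra|rewrite ltr_pMl].
have h4 : 2 * s < P * (2 * al - 1) by rewrite -(ltr_pM2r al0); lra.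
lra.
Qed.

(** [1 / (1 - s) < d] means [s * d < d - 1], so [2 < P * d] implies the cost condition. *)
Lemma exponent_medium_decay : s < (2 * al - 1) / (2 * al) -> d < 2 * al ->
  1 / (1 - s) < d -> 2 / d < P -> 1 / al < P /\ 2 * s < P * (d - 1).
Proof.
have d0 : 0 < d by rewrite (lt_trans ltr01).
have al20 : 0 < 2 * al by rewrite mulr_gt0.
rewrite ltr_pdivlMr// => sal ald.
have s1 : s < 1 by rewrite -(ltr_pM2r al20); lra.
rewrite ltr_pdivrMr ?subr_gt0// => ds; rewrite ltr_pdivrMr// => Pd.
have P0 : 0 < P by rewrite -(pmulr_lgt0 _ d0) (lt_trans _ Pd).
split; first by rewrite ltr_pdivrMr//; have := ltr_pM2l P0 d (2 * al); rewrite ald; lra.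
have h1 : s * d < d - 1 by lra.
have d10 : 0 < d - 1 by rewrite subr_gt0.
have h2 := ltr_pM2r d10 2 (P * d); rewrite Pd in h2.
by rewrite -(ltr_pM2r d0); lra.
Qed.

(** [d <= 1 / (1 - s)] means [d - 1 <= s * d], which reverses the implication; moreover
    [1 / (1 - s) < 2 * al]. *)
Lemma exponent_slow_decay : s < (2 * al - 1) / (2 * al) -> d <= 1 / (1 - s) ->
  2 * s < P * (d - 1) -> 1 / al < P /\ 2 < P * d.
Proof.
have d0 : 0 < d by rewrite (lt_trans ltr01).
have al20 : 0 < 2 * al by rewrite mulr_gt0.
rewrite ltr_pdivlMr// => sal.
have s1 : s < 1 by rewrite -(ltr_pM2r al20); lra.
rewrite ler_pdivlMr ?subr_gt0// => ds Ps.
have d10 : 0 < d - 1 by rewrite subr_gt0.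
have h1 : d - 1 <= s * d by lra.
have h3 : 2 < P * d.
  by rewrite -(ltr_pM2r d10); have := ltr_pM2r d0 (2 * s) (P * (d - 1)); rewrite Ps; lra.
have P0 : 0 < P by rewrite -(pmulr_lgt0 _ d0) (lt_trans _ h3).
split => //.
have h4 : d < 2 * al.
  have s10 : 0 < 1 - s by rewrite subr_gt0.
  by rewrite -(ltr_pM2r s10); lra.
by rewrite ltr_pdivrMr//; have := ltr_pM2l P0 d (2 * al); rewrite h4; lra.
Qed.

End Exponents.

Lemma ereal_real_between (R : realType) (x y : \bar R) : (x < y)%E ->
  exists r : R, (x < r%:E)%E /\ (r%:E < y)%E.
Proof.
case: x => [x| |] //; case: y => [y| |] //=.
- by rewrite lte_fin => xy; exists ((x + y) / 2); rewrite !lte_fin; split; lra.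
- by move=> _; exists (x + 1); rewrite lte_fin ltrDl ltr01 ltry.
- by move=> _; exists (y - 1); rewrite ltNyr lte_fin ltrBlDr ltrDl ltr01.
- by move=> _; exists 0; rewrite ltNyr ltry.
Qed.

(** One algorithm of finite error suffices to bound the integral on the unit ball, since point
    evaluations are bounded. Hence for large [eps] the empty algorithm is good enough. *)
Lemma worst_case_error_nil (R : realType) (T : choiceType) (X : set T) (K : T -> T -> R)
    (H : rkhs X K) (I : (T -> R) -> R) (Q : seq (R * T)) (e : R) :
  (forall q, q \in Q -> X q.2) ->
  (worst_case_error H I (fun f => \sum_(q <- Q) q.1 * f q.2)%R <= e%:E)%E ->
  (worst_case_error H I (fun=> 0)%R <=
   (e + \sum_(q <- Q) `|q.1| * Num.sqrt (K q.2 q.2))%:E)%E.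
Proof.
move=> QX He; apply: ge_ereal_sup => _ [f f1 <-]; rewrite lee_fin subr0.
set Qf := \sum_(q <- Q) q.1 * rk_fun f q.2.
have : (`|I (rk_fun f) - Qf|%:E <= e%:E)%E.
  by apply: le_trans He; apply: ereal_sup_ubound; exists f.
rewrite lee_fin => H1.
have H2 : `|Qf| <= \sum_(q <- Q) `|q.1| * Num.sqrt (K q.2 q.2).
  apply: le_trans (ler_norm_sum _ _ _) _; rewrite big_seq [leRHS]big_seq.
  apply: ler_sum => q /QX Xq; rewrite normrM ler_wpM2l//.
  by apply: le_trans (rk_fun_bound _ Xq) _; rewrite ler_piMl.
have -> : I (rk_fun f) = (I (rk_fun f) - Qf) + Qf by rewrite subrK.
by apply: le_trans (ler_normD _ _) _; exact: lerD.
Qed.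

(** * The complexity bounds *)

Theorem theorem6 (R : realType)
  (* domain, kernel, measures *)
  (D : set (measurableTypeR R)) (hD : measurable D)
  (K : R -> R -> R) (c : R) (hK : anchored_kernel D K c)
  (rho : probability (measurableTypeR R) R) (hrho : rho D = 1%E)
  (hM : (\int[rho]_(x in D) (K x x)%:E < +oo)%E)
  (M : R) (M_def : M = \int[rho]_(x in D) K x x)
  (C0 : R) (C0_def : C0 = \int[rho]_(x in D) (\int[rho]_(y in D) K x y))
  (hC0 : 0 < C0)
  (mu : probability (prod_space R nat) R) (hmu : is_product_measure rho mu)
  (rhou : forall u : {fset nat}, probability (prod_space R u) R)
  (hrhou : forall u, is_product_measure rho (rhou u))
  (* POD weights *)
  (Gam g : nat -> R)
  (hGam0 : Gam 0%N = 1) (hGam1 : Gam 1%N = 1) (hGam : forall k, 0 <= Gam k)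
  (hg0 : forall j, 0 <= g j) (hg : forall j, g j.+1 <= g j)
  (gam : {fset nat} -> R) (gam_def : gam = POD Gam g)
  (gam_sum : (\esum_(u in [set: {fset nat}]) (gam u * M ^+ #|` u|)%:E
                < +oo)%E)
  (gam_nontriv : exists2 u, weight_support gam u & u != fset0)
  (* reproducing kernel Hilbert spaces and worst case errors *)
  (H : forall u : {fset nat}, rkhs (inftuples D) (tensor_kernel K u))
  (Hgam : rkhs (weighted_domain D K gam) (weighted_kernel K gam))
  (err : algorithm R -> \bar R)
  (err_def : err = fun Q =>
     worst_case_error Hgam (integral_inf D K gam mu) (alg_eval Q))
  (erru : {fset nat} -> algorithm R -> \bar R)
  (erru_def : erru = fun u Q =>
     worst_case_error (H u) (integral_fin D c (rhou u)) (alg_eval Q))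
  (* cost function *)
  (price : nat -> R) (price_ge1 : forall k, 1 <= price k)
  (price_mono : forall k l, (k <= l)%N -> price k <= price l)
  (s : R) (hs : 0 <= s)
  (price_O : (price : nat -> R^o) =O_\oo (fun k => k%:R `^ s : R^o))
  (* decay and growth assumptions *)
  (decay1 : \bar R) (decay1_def : decay1 = decay C0 gam (Some 1%N))
  (decay1_gt1 : (1 < decay1)%E)
  (hGamq : exists q Cq : R, [/\ (q%:E < decay1)%E, 0 < Cq &
     forall k, (1 <= k)%N -> Gam k <= Cq * k`!%:R `^ q])
  (* levels and quadratures *)
  (L : nat) (hL : (0 < L)%N) (a : R) (ha : 1 < a)
  (alpha : R) (halpha : 1 / 2 <= alpha)
  (Q : nat -> nat -> algorithm R)
  (hQ : forall k n, (0 < k)%N -> (0 < n)%N ->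
     quadrature D c (level_set L a k) n (Q k n))
  (hQ_half : alpha = 1 / 2 ->
     quadrature_bound gam erru (level_set L a) Q (1 / 2))
  (hQ_gt : 1 / 2 < alpha ->
     let bnd := Order.min alpha%:E (decay C0 gam None / 2%:E)%E in
     forall t : R, (t%:E < bnd)%E -> exists tau : R,
       [/\ t < tau, 1 / 2 <= tau, (tau%:E < bnd)%E &
           quadrature_bound gam erru (level_set L a) Q tau]) :
  let upper_bound (B : \bar R) :=
    establishes c price err (level_set L a) Q B /\
    (p_nest D c price err <= B)%E in
  ((2 * alpha - 1) / (2 * alpha) <= s ->
     upper_bound (Order.max (1 / alpha)%:E ((2 * s)%:E / (decay1 - 1))%E)) /\
  (s < (2 * alpha - 1) / (2 * alpha) ->
     [/\ ((2 * alpha)%:E <= decay1)%E ->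
           upper_bound (1 / alpha)%:E,
         (decay1 < (2 * alpha)%:E)%E -> ((1 / (1 - s))%:E < decay1)%E ->
           upper_bound (2%:E / decay1)%E &
         (decay1 <= (1 / (1 - s))%:E)%E -> (1 < decay1)%E ->
           upper_bound ((2 * s)%:E / (decay1 - 1))%E]).
Proof.
subst gam err erru decay1 => upper_bound.
set gam := POD Gam g in gam_sum gam_nontriv Hgam upper_bound hQ_half hQ_gt decay1_gt1 hGamq *.
set d := decay C0 gam (Some 1%N) in upper_bound decay1_gt1 hGamq *.
have al0 : 0 < alpha by apply: lt_le_trans halpha; rewrite divr_gt0.
have gam0 u : 0 <= gam u by rewrite mulr_ge0// prodr_ge0.
(* The conditions are strict, so the decay, which may be infinite, can be replaced by a real [r]
   below it. *)
have key (B : \bar R) : (forall P : R, (B < P%:E)%E -> exists r : R,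
    [/\ 1 < r, (r%:E < d)%E, 1 / alpha < P, 2 < P * r & 2 * s < P * (r - 1)]) ->
    upper_bound B.
  move=> HB.
  have est : establishes c price
      (fun Q => worst_case_error Hgam (integral_inf D K gam mu) (alg_eval Q))
      (level_set L a) Q B.
    move=> P /HB[r [r1 rd alP rP sP]].
    have r0 : 0 < r by rewrite (lt_trans ltr01).
    have P0 : 0 < P by apply: lt_trans alP; rewrite divr_gt0.
    have [q [Cq [qd Cq0 GamC]]] := hGamq.
    (* [p1] must exceed [q] for the sums of POD weights and [r] for the rate. *)
    have [p1 [rqp1 p1d]] : exists p1 : R, ((Order.max r q)%:E < p1%:E)%E /\ (p1%:E < d)%E.
      by apply: ereal_real_between; rewrite EFin_max gt_max rd qd.
    move: rqp1; rewrite lte_fin gt_max => /andP[rp1 qp1].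
    have p10 : 0 <= p1 by apply/ltW/(lt_trans r0).
    have [Cg1 Cg10 gC1] := lt_decay_power_bound (sigma := Some 1%N) hC0 hGam1 hg0 hg isT p10 p1d.
    (* [p] stays free above [p1], since a large [tau] may call for a faster decay of [g] than [p1]
       records. *)
    have complexity p Cg tau : 0 <= Cg -> (forall j, g j <= Cg * j.+1%:R `^ (- p)) ->
        p1 <= p -> 0 < tau -> 2 * tau < p -> 1 / tau < P ->
        quadrature_bound gam (fun u Q =>
          worst_case_error (H u) (integral_fin D c (rhou u)) (alg_eval Q))
          (level_set L a) Q tau ->
        exists C : R, forall eps : R, 0 < eps <= 1 -> exists (m : nat) (n : nat -> nat),
        [/\ (0 < m)%N, forall k, (1 <= k <= m)%N -> (0 < n k)%N,
          forall k, (1 <= k < m)%N -> (n k.+1 <= n k)%N,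
          (worst_case_error Hgam (integral_inf D K gam mu)
             (alg_eval (multilevel c (level_set L a) Q m n)) <= eps%:E)%E &
          (cost_nest c price (multilevel c (level_set L a) Q m n)
             <= (C * eps `^ (- P))%:E)%E].
      move=> Cg0 gC pp tau0 taup tauP quad.
      have rp : r < p by apply: lt_le_trans pp.
      have sP' : 2 * s / (p - 1) < P.
        rewrite ltr_pdivrMr ?subr_gt0 ?(lt_trans r1 rp)//; apply: (lt_trans sP).
        by rewrite ltr_pM2l// ltrD2r.
      exact: (multilevel_complexity hD hK hrho hM M_def hmu hrhou hGam hg0
        gam_sum Hgam price_ge1 price_mono hs price_O hL ha hQ GamC (ltW Cq0) gC Cg0
        (lt_le_trans qp1 pp) (lt_trans r1 rp) tau0 taup quad tauP sP').
    move: halpha; rewrite le_eqVlt => /predU1P[alE|al12].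
      apply: (complexity p1 Cg1 (1 / 2)) => //.
      - by rewrite mulrCA divff// mulr1 (lt_trans r1 rp1).
      - by rewrite alE.
      exact: hQ_half.
    have Pr : 2 / P < r by rewrite ltr_pdivrMr// mulrC.
    (* Through [p' <= decay_gamma], the choice [2 / P < p'] puts [1 / P] below the limit up to which
       values of [tau] are available. *)
    have [p' /andP[Pp' p'r]] : exists p', 2 / P < p' < r.
      by exists ((2 / P + r) / 2); apply/andP; split; lra.
    have p'd : (p'%:E <= decay C0 gam None)%E.
      exact: (power_bound_le_decay hC0 hg0 hGam GamC (ltW Cq0) Cg10 gC1 qp1 r0 rp1 p'r).
    have half (x : R) (y : \bar R) : (x%:E < y / 2%:E)%E = ((2 * x)%:E < y)%E.
      by rewrite inver pnatr_eq0 /= lte_pdivlMr// -EFinM mulrC.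
    have [|tau [ttau tau12 taubnd quad]] := hQ_gt al12 (1 / P).
      rewrite lt_min lte_fin half; apply/andP; split.
        by rewrite ltr_pdivrMr// mulrC -ltr_pdivrMr.
      by apply: lt_le_trans p'd; rewrite lte_fin mulrA mulr1.
    have tau0 : 0 < tau by apply: lt_trans ttau; rewrite divr_gt0.
    have tauP : 1 / tau < P by rewrite ltr_pdivrMr// mulrC -ltr_pdivrMr.
    (* [2 * tau] is known to be below [decay_gamma] only and may exceed [p1]. This decay bounds [g]
       as well, with some exponent [p2 > 2 * tau]; the larger of [p1] and [p2] is used. *)
    move: taubnd; rewrite lt_min half => /andP[_ /ereal_real_between[p2 [taup2 p2d]]].
    rewrite lte_fin in taup2.
    have p20 : 0 <= p2 by apply/ltW/(lt_trans _ taup2); rewrite mulr_gt0.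
    have [Cg2 Cg20 gC2] := lt_decay_power_bound (sigma := None) hC0 hGam1 hg0 hg isT p20 p2d.
    have [p12|p21] := leP p1 p2; first exact: (complexity p2 Cg2 tau).
    by apply: (complexity p1 Cg1 tau) => //; exact: lt_trans p21.
  split => //.
  (* Otherwise some real [P] lies strictly between. The bound is known for [eps <= 1] only: for
     [1 < eps < e0] the algorithm for [eps = 1] is reused, and from [e0] on, a bound for the error
     of the empty algorithm, the cost is 0. *)
  rewrite leNgt; apply/negP => /ereal_real_between[P [BP]]; apply/negP; rewrite -leNgt.
  have [r [_ _ alP _ _]] := HB P BP; have [C HC] := est P BP.
  have P0 : 0 < P by apply: lt_trans alP; rewrite divr_gt0.
  have [|m1 [n1 [_ n10 _ err1 cost1]]] := HC 1; first by rewrite ltr01 lexx.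
  pose Q1 := multilevel c (level_set L a) Q m1 n1.
  have QX x : x \in Q1 -> weighted_domain D K gam x.2.
    move=> /(multilevel_nodes hK hQ n10)[Dx xc].
    exact: (finite_nodes_weighted_domain hK H gam0 Dx xc).
  pose e0 := 1 + \sum_(q <- Q1) `|q.1| * Num.sqrt (weighted_kernel K gam q.2 q.2).
  have e01 : 1 <= e0 by rewrite lerDl sumr_ge0// => x _; rewrite mulr_ge0.
  have err0 : (worst_case_error Hgam (integral_inf D K gam mu) (alg_eval [::]) <= e0%:E)%E.
    have := worst_case_error_nil QX err1.
    by rewrite (_ : alg_eval [::] = fun=> 0)//; apply/funext => f; rewrite /alg_eval big_nil.
  pose C' := Num.max C 0.
  have C'0 : 0 <= C' by rewrite le_max lexx orbT.
  have CC' : C <= C' by rewrite le_max lexx.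
  have e0P : 1 <= e0 `^ P by rewrite -[leLHS](powRr0 e0) ler_powR// ltW.
  apply: ereal_inf_lbound; exists P => //; split; first exact: ltW.
  exists (C' * e0 `^ P) => [|eps eps0]; first by rewrite mulr_ge0// powR_ge0.
  have [eps1|eps1] := leP eps 1.
    have [|m [n [_ n0 _ errm costm]]] := HC eps; first by rewrite eps0.
    apply: (@le_trans _ _ (cost_nest c price (multilevel c (level_set L a) Q m n))).
      apply: ereal_inf_lbound; exists (multilevel c (level_set L a) Q m n) => //.
      by split => //; exact: (multilevel_admissible hK hQ n0).
    apply: (le_trans costm); rewrite lee_fin ler_wpM2r ?powR_ge0//.
    by apply: (le_trans CC'); rewrite ler_peMr.
  have [epse|eeps] := ltP eps e0.
    apply: (@le_trans _ _ (cost_nest c price Q1)).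
      apply: ereal_inf_lbound; exists Q1 => //.
      split; first exact: (multilevel_admissible hK hQ n10).
      by apply: (le_trans err1); rewrite lee_fin ltW.
    apply: (le_trans cost1); rewrite lee_fin powR1 mulr1 -mulrA.
    apply: (le_trans CC'); rewrite ler_peMr// powRN ler_pdivlMr ?powR_gt0// mul1r.
    by rewrite ge0_ler_powR ?(ltW P0) ?nnegrE ?(ltW eps0) ?(le_trans ler01 e01)// ltW.
  apply: (@le_trans _ _ (cost_nest c price [::])).
    apply: ereal_inf_lbound; exists [::] => //.
    by split => //; apply: (le_trans err0); rewrite lee_fin.
  by rewrite cost_nest_nil lee_fin !mulr_ge0// powR_ge0.
(* If the decay is infinite, every large [r] will do, so the two inequalities are required for
   finite decay only. *)
have rate (P : R) : 1 / alpha < P -> (forall x : R, d = x%:E -> 1 < x ->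
    2 < P * x /\ 2 * s < P * (x - 1)) ->
    exists r : R, [/\ 1 < r, (r%:E < d)%E, 1 / alpha < P, 2 < P * r & 2 * s < P * (r - 1)].
  move=> alP Hx; have P0 : 0 < P by apply: lt_trans alP; rewrite divr_gt0.
  have [r [Hr rd]] : exists r : R,
      ((Num.max 1 (Num.max (2 / P) (1 + 2 * s / P)))%:E < r%:E)%E /\ (r%:E < d)%E.
    apply: ereal_real_between; move: decay1_gt1 Hx; case: (d) => [x| |] //= x1 Hx.
      rewrite lte_fin in x1; have [h1 h2] := Hx x erefl x1.
      rewrite lte_fin !gt_max x1 /= ltr_pdivrMr// mulrC h1 /=.
      by rewrite -ltrBrDl ltr_pdivrMr// [ltRHS]mulrC.
    by rewrite ltry.
  move: Hr; rewrite lte_fin !gt_max => /and3P[r1 r2 r3].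
  exists r; split => //; first by rewrite mulrC -ltr_pdivrMr.
  by rewrite [ltRHS]mulrC -ltr_pdivrMr// ltrBrDl.
have div_decay (x y : R) : d = x%:E -> 1 < x -> (y%:E / (d - 1) = (y / (x - 1))%:E)%E.
  by move=> -> x1; rewrite -EFinB inver subr_eq0 gt_eqF.
have finite (y : R) : (d <= y%:E)%E -> exists2 x, d = x%:E & 1 < x.
  by move: decay1_gt1; case: (d) => [x| |] //; rewrite lte_fin => x1 _; exists x.
split=> [sal|sal].
  apply: key => P; rewrite gt_max lte_fin => /andP[alP sP]; apply: rate => // x dx x1.
  move: sP; rewrite (div_decay x)// lte_fin ltr_pdivrMr ?subr_gt0// => sP.
  by split => //; exact: exponent_large_cost sal alP sP.
split=> [ald|dal ds|ds _].
- apply: key => P; rewrite lte_fin => alP; apply: rate => // x dx x1.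
  rewrite dx lee_fin in ald; exact: (exponent_fast_decay _ _ sal alP ald).
- apply: key => P; have [x dx x1] := finite _ (ltW dal).
  rewrite dx !lte_fin in dal ds.
  rewrite {1}dx inver gt_eqF ?(lt_trans ltr01 x1)// -EFinM lte_fin => dP.
  have [alP sP] := exponent_medium_decay halpha x1 sal dal ds dP.
  apply: rate => // y; rewrite dx => -[<-] _; split => //.
  by rewrite -ltr_pdivrMr// (lt_trans ltr01).
- apply: key => P; have [x dx x1] := finite _ ds.
  rewrite dx lee_fin in ds.
  rewrite (div_decay x)// lte_fin ltr_pdivrMr ?subr_gt0// => sP.
  have [alP dP] := exponent_slow_decay halpha x1 sal ds sP.
  by apply: rate => // y; rewrite dx => -[<-] _.
Qed.
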